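(* Let $Q\subset\mathbb{R}^{d+1}$ be an open set with coordinates $x=(x_0,x_1,\dots,x_d)$, and let $\mathcal M\subset\mathbb{R}^k$ be a bounded open convex set. For $i=0,1,\dots,d$ let $A_i\in C^2(\mathcal M;\mathbb{R}^l)$. Let $u:Q\to\mathcal M$ be a weak solution of the system of conservation laws $$\sum_{i=0}^d \partial_{x_i}A_i(u)=0 \quad\text{in } Q,$$ i.e. $\sum_{i=0}^d\int_Q \partial_{x_i}\psi(x)\cdot A_i(u(x))\,dx=0$ for every $\psi\in C_c^\infty(Q;\mathbb{R}^l)$. Suppose that $B:\mathcal M\to\mathcal L(\mathbb{R}^l;\mathbb{R})$, written as a row vector $B(u)=(b_1(u),\dots,b_l(u))$, is a $C^1$ map which is a generalized entropy, i.e. for every $i=0,1,\dots,d$ there exists a $C^2$ function $q_i:\mathcal M\to\mathbb{R}$ with $$B(u)\cdot\nabla_u A_i(u)=\nabla_u q_i(u)\qquad\text{for all } u\in\mathcal M.$$ Assume moreover that for every compact $\mathcal K\subset Q$ there exists $\alpha>\tfrac13$ (possibly depending on $\mathcal K$) such that $u\in C^{0,\alpha}(\mathcal K)$. Then $$\sum_{i=0}^d\partial_{x_i}q_i(u)=0\quad\text{in }\mathcal D'(Q),$$ i.e. $\sum_{i=0}^d\int_Q\partial_{x_i}\phi(x)\,q_i(u(x))\,dx=0$ for every $\phi\in C_c^\infty(Q)$.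
   Context: $\nabla_u A_i(u)$ denotes the $l\times k$ Jacobian matrix of $A_i$ at $u$, and $\nabla_u q_i(u)$ the gradient of $q_i$ written as a row vector of length $k$; the product $B(u)\cdot\nabla_uA_i(u)$ is the row vector $\big(\sum_{j=1}^l b_j(u)\,\partial A_i^j/\partial u_\beta\big)_{\beta=1,\dots,k}$, where $A_i^j$ is the $j$-th component of $A_i$. $C^{0,\alpha}(\mathcal K)$ denotes the space of $\alpha$-Hölder continuous functions on $\mathcal K$. *)

(* Defs.v *)
From Stdlib Require Import Reals List.
Open Scope R_scope.

(* Points of R^n are represented as  x : nat -> R  with x i = 0 for i >= n
   (coordinates x_0, ..., x_{n-1}). *)
Definition pt := nat -> R.

Definition in_Rn (n : nat) (x : pt) : Prop := forall i, (n <= i)%nat -> x i = 0.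

Fixpoint sumR (m : nat) (g : nat -> R) : R :=
  match m with O => 0 | S m' => sumR m' g + g m' end.

Fixpoint normn (n : nat) (x : pt) : R :=
  match n with O => 0 | S m => Rmax (normn m x) (Rabs (x m)) end.
Definition distn (n : nat) (x y : pt) : R := normn n (fun i => x i - y i).

Definition upd (x : pt) (j : nat) (v : R) : pt :=
  fun i => if Nat.eqb i j then v else x i.

Definition open_in (n : nat) (U : pt -> Prop) : Prop :=
  forall x, U x -> in_Rn n x /\
    exists r, 0 < r /\ forall y, in_Rn n y -> distn n x y < r -> U y.

Definition compact_in (n : nat) (K : pt -> Prop) : Prop :=
  (forall x, K x -> in_Rn n x) /\
  forall (I : Type) (U : I -> pt -> Prop),
    (forall i, open_in n (U i)) ->
    (forall x, K x -> exists i, U i x) ->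
    exists l : list I, forall x, K x -> exists i, In i l /\ U i x.

Definition bounded_in (n : nat) (D : pt -> Prop) : Prop :=
  exists C, forall x, D x -> normn n x <= C.

Definition convex (D : pt -> Prop) : Prop :=
  forall x y t, D x -> D y -> 0 <= t <= 1 -> D (fun i => t * x i + (1 - t) * y i).

Definition cont_on (n : nat) (D : pt -> Prop) (f : pt -> R) : Prop :=
  forall x, D x -> forall eps, 0 < eps ->
    exists delta, 0 < delta /\
      forall y, D y -> distn n x y < delta -> Rabs (f y - f x) < eps.

Definition has_partial (f : pt -> R) (j : nat) (x : pt) (L : R) : Prop :=
  derivable_pt_lim (fun t => f (upd x j (x j + t))) 0 L.

Fixpoint Cm (n : nat) (D : pt -> Prop) (m : nat) (f : pt -> R) : Prop :=
  match m with
  | O => cont_on n D f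
  | S m' => cont_on n D f /\
      exists Df : nat -> pt -> R,
        forall j, (j < n)%nat ->
          (forall x, D x -> has_partial f j x (Df j x)) /\ Cm n D m' (Df j)
  end.

Definition Cinf (n : nat) (D : pt -> Prop) (f : pt -> R) : Prop :=
  forall m, Cm n D m f.

Definition test_fn (n : nat) (Q : pt -> Prop) (f : pt -> R) : Prop :=
  Cinf n (in_Rn n) f /\
  exists K, compact_in n K /\ (forall x, K x -> Q x) /\
    (forall x, in_Rn n x -> ~ K x -> f x = 0).

(* Riemann sums on the uniform grid of mesh 1/N over [-N, N)^n *)
Fixpoint gsum (n N : nat) (f : pt -> R) : R :=
  match n with
  | O => f (fun _ => 0)
  | S m => sumR (2 * N * N)
      (fun a => gsum m N (fun x => f (upd x m ((INR a - INR (N * N)) / INR N))))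
  end.

Definition riemann (n : nat) (f : pt -> R) (N : nat) : R :=
  gsum n N f * (/ INR N) ^ n.

(* the integral over R^n of f equals I (for continuous compactly supported f
   this is the usual Lebesgue/Riemann integral) *)
Definition integral_is (n : nat) (f : pt -> R) (I : R) : Prop :=
  Un_cv (fun m => riemann n f (S m)) I.

Definition holder_on (n k : nat) (K : pt -> Prop) (alpha : R) (u : pt -> pt) : Prop :=
  exists C, forall x y, K x -> K y -> 0 < distn n x y ->
    normn k (fun j => u x j - u y j) <= C * Rpower (distn n x y) alpha.

(* Main.v *)
(** The paper's argument, run on Riemann sums instead of integrals.  Let [v = mol_vec u] be the average
    of [u] against a smooth kernel of width [1/P] over the grid of mesh [1/N], with [P] dividing [N]; the kernel
    is a tensor product of a one-dimensional bump whose integer translates sum to [1], so that the discrete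
    averages are exact: constants are reproduced and the sum of any first derivative of the kernel vanishes.  For
    each fixed centre the weak equation, tested with the kernel, says that the averages [G_i] of [A_i(u)] are
    almost divergence free when [N] is large.  The field
      [F_i = phi (B(v) . (G_i - A_i(v)) + q_i(v))]
    is differentiable with compact support, hence the Riemann sums of [sum_i d_i F_i] tend to [0] by summation by
    parts.  By the entropy identity [B . grad A_i = grad q_i],
      [sum_i d_i F_i = sum_i d_i phi . q_i(u) + O(s + P s^3) + o(1)],   [s = P^-alpha],
    because [v - u = O(s)], [grad v = O(P s)], and the commutator [G_i - A_i(v)] is [O(s^2)].  Since [alpha > 1/3],
    [P s^3] tends to [0]. *)

Require Import Defs.
From Stdlib Require Import ZArith Reals List Lra Lia FunctionalExtensionality ClassicalEpsilon.
Open Scope R_scope.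

(** * Finite sums, the sup norm and the mean value inequality *)

(** Since the integral is itself a limit of Riemann sums, a mollifier defined by an integral would
    bring in existence of integrals, Fubini and differentiation under the integral sign. A grid
    average is a finite sum of smooth functions of its centre, so none of these questions arises.
    Two meshes occur. The inner mesh 1/(P r) of the averages is frozen before the mesh of the outer
    sums tends to zero; [eps] determines [P], and [P] determines [r]. The obstacle is the choice of
    [r]: the weak equation gives for each centre a limit without a rate, whereas the averages must
    be almost divergence free at all centres in the support of phi at once. For fixed [P] the
    kernels are equicontinuous in the centre, and compactness yields a common threshold. Exactness
    of the discrete kernel matters because an error in the zero sum of its derivative would be
    amplified by P in the gradient of v. The term B(v) . (G_i - A_i(v)) in the field keeps B(v)
    undifferentiated in front of the divergence of G, while the derivative of B(v) meets only the
    small commutator; thus B of class C^1 suffices. *)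

Lemma sumR_ext m f g : (forall i, (i < m)%nat -> f i = g i) -> sumR m f = sumR m g.
Proof.
  induction m as [|m IH]; simpl; intros H; auto.
  rewrite IH by (intros; apply H; lia). rewrite H by lia. auto.
Qed.

Lemma sumR_plus m f g : sumR m (fun i => f i + g i) = sumR m f + sumR m g.
Proof. induction m; simpl; lra. Qed.

Lemma sumR_scal m c f : sumR m (fun i => c * f i) = c * sumR m f.
Proof. induction m; simpl; lra. Qed.

Lemma sumR_minus m f g : sumR m (fun i => f i - g i) = sumR m f - sumR m g.
Proof. induction m; simpl; lra. Qed.

Lemma sumR_0 m f : (forall i, (i < m)%nat -> f i = 0) -> sumR m f = 0.
Proof.
  induction m as [|m IH]; simpl; intros H; auto.
  rewrite IH by (intros; apply H; lia). rewrite H by lia. lra.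
Qed.

Lemma sumR_le m f g : (forall i, (i < m)%nat -> f i <= g i) -> sumR m f <= sumR m g.
Proof.
  induction m as [|m IH]; simpl; intros H; [lra|].
  assert (H1 := IH (fun i hi => H i ltac:(lia))). assert (H2 := H m ltac:(lia)). lra.
Qed.

Lemma sumR_Rabs m f : Rabs (sumR m f) <= sumR m (fun i => Rabs (f i)).
Proof.
  induction m; simpl; [rewrite Rabs_R0; lra|].
  eapply Rle_trans; [apply Rabs_triang|lra].
Qed.

Lemma sumR_const m c : sumR m (fun _ => c) = INR m * c.
Proof. induction m; [simpl; lra|]. rewrite S_INR. simpl. rewrite IHm. lra. Qed.

Lemma sumR_Rabs_le m f c : (forall i, (i < m)%nat -> Rabs (f i) <= c) -> Rabs (sumR m f) <= INR m * c.
Proof.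
  intros H. eapply Rle_trans; [apply sumR_Rabs|].
  rewrite <- sumR_const. apply sumR_le; auto.
Qed.

Lemma sumR_swap m p f :
  sumR m (fun i => sumR p (fun j => f i j)) = sumR p (fun j => sumR m (fun i => f i j)).
Proof.
  induction m; simpl.
  - symmetry; apply sumR_0; auto.
  - rewrite IHm, <- sumR_plus. auto.
Qed.

Lemma sumR_single m j f : (j < m)%nat -> (forall i, (i < m)%nat -> i <> j -> f i = 0) -> sumR m f = f j.
Proof.
  induction m as [|m IH]; intros Hj H; [lia|]. simpl.
  destruct (Nat.eq_dec j m) as [->|Hne].
  - rewrite sumR_0; [lra|]. intros; apply H; lia.
  - rewrite IH by (auto; try lia; intros; apply H; lia). rewrite (H m) by lia. lra.
Qed.

Lemma sumR_shift p m f : sumR m (fun a => f (a + p)%nat) = sumR (m + p) f - sumR p f.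
Proof. induction m; simpl; lra. Qed.

(** * The sup norm and coordinate updates *)

Lemma normn_nonneg n x : 0 <= normn n x.
Proof.
  induction n; simpl; [lra|]. eapply Rle_trans; [exact IHn|apply Rmax_l].
Qed.

Lemma normn_coord n x i : (i < n)%nat -> Rabs (x i) <= normn n x.
Proof.
  induction n as [|n IH]; intros H; [lia|]. simpl.
  destruct (Nat.eq_dec i n) as [->|Hne]; [apply Rmax_r|].
  eapply Rle_trans; [apply IH; lia|apply Rmax_l].
Qed.

Lemma normn_lub n x r : 0 <= r -> (forall i, (i < n)%nat -> Rabs (x i) <= r) -> normn n x <= r.
Proof.
  intros Hr. induction n as [|n IH]; simpl; intros H; auto.
  apply Rmax_lub; [apply IH; intros; apply H; lia|apply H; lia].
Qed.

Lemma normn_lub_lt n x r : 0 < r -> (forall i, (i < n)%nat -> Rabs (x i) < r) -> normn n x < r.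
Proof.
  intros Hr. induction n as [|n IH]; simpl; intros H; auto.
  apply Rmax_lub_lt; [apply IH; intros; apply H; lia|apply H; lia].
Qed.

Lemma distn_nonneg n x y : 0 <= distn n x y.
Proof. apply normn_nonneg. Qed.

Lemma distn_coord n x y i : (i < n)%nat -> Rabs (x i - y i) <= distn n x y.
Proof. intros H. exact (normn_coord n (fun i => x i - y i) i H). Qed.

Lemma distn_lub n x y r : 0 <= r -> (forall i, (i < n)%nat -> Rabs (x i - y i) <= r) -> distn n x y <= r.
Proof. intros Hr H. apply normn_lub; auto. Qed.

Lemma distn_sym n x y : distn n x y = distn n y x.
Proof.
  apply Rle_antisym; apply distn_lub; try apply distn_nonneg;
    intros; rewrite Rabs_minus_sym; apply distn_coord; auto.
Qed.

Lemma distn_triang n x y z : distn n x z <= distn n x y + distn n y z.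
Proof.
  apply distn_lub.
  - assert (H := distn_nonneg n x y). assert (H1 := distn_nonneg n y z). lra.
  - intros i Hi. replace (x i - z i) with ((x i - y i) + (y i - z i)) by ring.
    eapply Rle_trans; [apply Rabs_triang|].
    apply Rplus_le_compat; apply distn_coord; auto.
Qed.

Lemma distn_refl n x : distn n x x = 0.
Proof.
  apply Rle_antisym; [|apply distn_nonneg].
  apply distn_lub; [lra|]. intros. rewrite Rminus_diag. rewrite Rabs_R0. lra.
Qed.

Lemma distn_0_eq n x y : in_Rn n x -> in_Rn n y -> distn n x y = 0 -> x = y.
Proof.
  intros Hx Hy H. extensionality i. destruct (Nat.lt_ge_cases i n) as [Hi|Hi].
  - assert (H1 := distn_coord n x y i Hi). rewrite H in H1.
    assert (H2 := Rabs_pos (x i - y i)).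
    assert (Rabs (x i - y i) = 0) by lra.
    destruct (Req_dec (x i - y i) 0) as [E|E]; [lra|]. apply Rabs_no_R0 in E. lra.
  - rewrite Hx, Hy by auto. auto.
Qed.

Lemma in_Rn_upd n x j v : (j < n)%nat -> in_Rn n x -> in_Rn n (upd x j v).
Proof.
  intros Hj Hx i Hi. unfold upd. destruct (Nat.eqb_spec i j); [lia|apply Hx; auto].
Qed.

Lemma in_Rn_upd_last n x v : in_Rn n x -> in_Rn (S n) (upd x n v).
Proof.
  intros Hx i Hi. unfold upd. destruct (Nat.eqb_spec i n); [lia|apply Hx; lia].
Qed.

Lemma upd_same x j : upd x j (x j) = x.
Proof. extensionality i. unfold upd. destruct (Nat.eqb_spec i j); subst; auto. Qed.

Lemma upd_eq x j v : upd x j v j = v.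
Proof. unfold upd. rewrite Nat.eqb_refl. auto. Qed.

Lemma upd_neq x j v i : i <> j -> upd x j v i = x i.
Proof. intros H. unfold upd. destruct (Nat.eqb_spec i j); congruence. Qed.

Lemma upd_upd x j v w : upd (upd x j v) j w = upd x j w.
Proof. extensionality i. unfold upd. destruct (Nat.eqb_spec i j); auto. Qed.

Lemma upd_comm x i j v w : i <> j -> upd (upd x i v) j w = upd (upd x j w) i v.
Proof.
  intros H. extensionality k. unfold upd.
  destruct (Nat.eqb_spec k i), (Nat.eqb_spec k j); subst; auto; congruence.
Qed.

Lemma has_partial_at f j x L t :
  has_partial f j (upd x j t) L -> derivable_pt_lim (fun s => f (upd x j s)) t L.
Proof.
  unfold has_partial. intros H eps Heps. destruct (H eps Heps) as [delta Hd].
  exists delta. intros h Hh Hlt. specialize (Hd h Hh Hlt).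
  rewrite upd_eq in Hd. rewrite !upd_upd in Hd.
  replace (t + (0 + h)) with (t + h) in Hd by ring. replace (t + 0) with t in Hd by ring. exact Hd.
Qed.

Lemma mvt_segment (f f' : R -> R) a b :
  (forall t, Rmin a b <= t <= Rmax a b -> derivable_pt_lim f t (f' t)) ->
  exists c, Rmin a b <= c <= Rmax a b /\ f b - f a = f' c * (b - a).
Proof.
  intros H. destruct (Rtotal_order a b) as [Hab|[->|Hab]].
  - rewrite Rmin_left, Rmax_right in * by lra.
    destruct (MVT_cor2 f f' a b Hab H) as [c [E Hc]]. exists c. split; [lra|exact E].
  - exists b. rewrite Rmin_left, Rmax_left by lra. split; [lra|ring].
  - rewrite Rmin_right, Rmax_left in * by lra.
    destruct (MVT_cor2 f f' b a Hab H) as [c [E Hc]]. exists c. split; [lra|]. lra.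
Qed.

(** Pass from [b] to [a] one coordinate at a time, with the one-variable mean value theorem on each
    edge. The comparison vector [c] is left free: the gradient at a fixed centre gives strict
    differentiability, the gradient at an endpoint gives a Taylor remainder. *)
Lemma mean_value_coordinates n f (Df : nat -> pt -> R) (c : nat -> R) e a b :
  in_Rn n a -> in_Rn n b ->
  (forall z j, (j < n)%nat -> in_Rn n z ->
     (forall i, Rmin (a i) (b i) <= z i <= Rmax (a i) (b i)) ->
     has_partial f j z (Df j z) /\ Rabs (Df j z - c j) <= e) ->
  Rabs (f a - f b - sumR n (fun j => c j * (a j - b j))) <= e * sumR n (fun j => Rabs (a j - b j)).
Proof.
  intros Ha Hb H.
  set (z := fun m i => if Nat.ltb i m then a i else b i).
  assert (Hz0 : z O = b) by (apply functional_extensionality; intros i; reflexivity).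
  assert (Hzn : z n = a).
  { apply functional_extensionality; intros i. unfold z. destruct (Nat.ltb_spec i n); auto. rewrite Ha, Hb by auto; auto. }
  assert (Hzm : forall m, (m <= n)%nat ->
    Rabs (f (z m) - f b - sumR m (fun j => c j * (a j - b j))) <= e * sumR m (fun j => Rabs (a j - b j))).
  { induction m as [|m IH]; intros Hm.
    - rewrite Hz0. simpl. replace (f b - f b - 0) with 0 by ring. rewrite Rabs_R0. lra.
    - specialize (IH ltac:(lia)).
      assert (Hu : forall t, z (S m) = upd (upd (z m) m t) m (a m)).
      { intros t. apply functional_extensionality; intros i. unfold upd, z.
        destruct (Nat.eqb_spec i m); [subst i|].
        - destruct (Nat.ltb_spec m (S m)); auto; lia.
        - destruct (Nat.ltb_spec i (S m)), (Nat.ltb_spec i m); auto; lia. }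
      assert (Hzmm : z m m = b m) by (unfold z; rewrite Nat.ltb_irrefl; auto).
      assert (Hpt : forall t, Rmin (b m) (a m) <= t <= Rmax (b m) (a m) ->
         in_Rn n (upd (z m) m t) /\
         forall i, Rmin (a i) (b i) <= upd (z m) m t i <= Rmax (a i) (b i)).
      { intros t Ht. split.
        - apply in_Rn_upd; [lia|]. intros i Hi. unfold z.
          destruct (Nat.ltb_spec i m); [apply Ha|apply Hb]; auto.
        - intros i. destruct (Nat.eq_dec i m) as [->|Hne].
          + rewrite upd_eq. rewrite Rmin_comm, Rmax_comm. auto.
          + rewrite upd_neq by auto. unfold z.
            destruct (Nat.ltb_spec i m); split; auto using Rmin_l, Rmin_r, Rmax_l, Rmax_r. }
      destruct (mvt_segment (fun t => f (upd (z m) m t)) (fun t => Df m (upd (z m) m t)) (b m) (a m))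
        as [t [Ht E]].
      { intros t Ht. apply has_partial_at. destruct (Hpt t Ht). apply H; auto; lia. }
      destruct (Hpt t Ht) as [Hin Hbt].
      destruct (H (upd (z m) m t) m ltac:(lia) Hin Hbt) as [_ Hd].
      assert (E1 : upd (z m) m (b m) = z m) by (rewrite <- Hzmm; apply upd_same).
      rewrite E1 in E.
      rewrite (Hu t), upd_upd. simpl.
      set (S1 := sumR m _) in *. set (S2 := sumR m _) in *.
      replace (f (upd (z m) m (a m)) - f b - (S1 + c m * (a m - b m)))
        with ((f (z m) - f b - S1) + (Df m (upd (z m) m t) - c m) * (a m - b m)).
      2:{ replace (f (upd (z m) m (a m))) with (f (z m) + Df m (upd (z m) m t) * (a m - b m)) by lra. ring. }
      eapply Rle_trans; [apply Rabs_triang|]. rewrite Rabs_mult, Rmult_plus_distr_l.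
      apply Rplus_le_compat; auto. apply Rmult_le_compat_r; auto using Rabs_pos. }
  specialize (Hzm n (Nat.le_refl n)). rewrite Hzn in Hzm. exact Hzm.
Qed.

(** A sup-norm ball containing [a] and [b] contains the whole box they span, hence every point of
    the coordinate path. *)
Lemma mean_value n f (Df : nat -> pt -> R) (c : nat -> R) e r p a b :
  in_Rn n a -> in_Rn n b -> distn n a p <= r -> distn n b p <= r ->
  (forall z j, (j < n)%nat -> in_Rn n z -> distn n z p <= r ->
     has_partial f j z (Df j z) /\ Rabs (Df j z - c j) <= e) ->
  0 <= e ->
  Rabs (f a - f b - sumR n (fun j => c j * (a j - b j))) <= INR n * e * distn n a b.
Proof.
  intros Ha Hb Hap Hbp H He.
  eapply Rle_trans.
  - apply (mean_value_coordinates n f Df c e a b Ha Hb).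
    intros z j Hj Hz Hbt. apply H; auto.
    apply distn_lub; [eapply Rle_trans; [apply distn_nonneg|exact Hap]|].
    intros i Hi. specialize (Hbt i).
    assert (H1 := distn_coord n a p i Hi). assert (H2 := distn_coord n b p i Hi).
    revert Hbt H1 H2. unfold Rmin, Rmax, Rabs.
    destruct (Rle_dec (a i) (b i)); repeat destruct Rcase_abs; lra.
  - rewrite (Rmult_comm (INR n)), Rmult_assoc. apply Rmult_le_compat_l; auto.
    rewrite <- sumR_const. apply sumR_le. intros; apply distn_coord; auto.
Qed.

(** * Compactness *)

(** Heine-Borel as an induction principle: [T] is an ideal of sets containing a neighbourhood of
    each point of the interval, and the supremum of the [s] with [a, s] in [T] has to be [b]. With
    [T] abstract, the same statement can be applied to slabs of a cube. *)
Lemma interval_ideal (a b : R) (T : (R -> Prop) -> Prop) :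
  a <= b ->
  (forall U V : R -> Prop, (forall x, U x -> V x) -> T V -> T U) ->
  (forall U V : R -> Prop, T U -> T V -> T (fun x => U x \/ V x)) ->
  (forall x, a <= x <= b -> exists delta, 0 < delta /\ T (fun y => Rabs (y - x) < delta)) ->
  T (fun y => a <= y <= b).
Proof.
  intros Hab Hsub Hun Hloc.
  set (E := fun s => a <= s <= b /\ T (fun y => a <= y <= s)).
  assert (Ea : E a).
  { split; [lra|]. destruct (Hloc a ltac:(lra)) as [delta [Hd HT]].
    eapply Hsub; [|exact HT]. intros y Hy. simpl.
    replace (y - a) with 0 by lra. rewrite Rabs_R0. auto. }
  destruct (completeness E) as [m [Hub Hlub]].
  { exists b. intros s [Hs _]. lra. }
  { exists a; auto. }
  assert (Ham : a <= m) by (apply Hub; auto).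
  assert (Hmb : m <= b) by (apply Hlub; intros s [Hs _]; lra).
  destruct (Hloc m ltac:(lra)) as [delta [Hd HT]].
  assert (exists s, E s /\ m - delta < s) as [s [[Hs HsT] Hsm]].
  { apply NNPP. intros Hno. assert (m <= m - delta); [|lra].
    apply Hlub. intros s Es. destruct (Rle_or_lt s (m - delta)); auto. exfalso; eauto. }
  assert (Hext : forall s', a <= s' <= b -> s' < m + delta -> E s').
  { intros s' H1 H2. split; auto.
    eapply Hsub; [|exact (Hun _ _ HsT HT)]. simpl. intros y Hy.
    destruct (Rle_or_lt y s); [left; lra|right]. apply Rabs_def1; lra. }
  destruct (Rlt_or_le b (m + delta)) as [H|H].
  - apply (Hext b); lra.
  - assert (E (m + delta / 2)) as HE by (apply Hext; lra).
    apply Hub in HE. lra.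
Qed.

Lemma cube_ideal n : forall (T : (pt -> Prop) -> Prop) c r,
  0 <= r ->
  (forall U V : pt -> Prop, (forall x, U x -> V x) -> T V -> T U) ->
  (forall U V : pt -> Prop, T U -> T V -> T (fun x => U x \/ V x)) ->
  (forall x, in_Rn n x -> distn n x c <= r ->
     exists delta, 0 < delta /\ T (fun y => in_Rn n y /\ distn n y x < delta)) ->
  T (fun y => in_Rn n y /\ distn n y c <= r).
Proof.
  induction n as [|n IH]; intros T c r Hr Hsub Hun Hloc.
  - destruct (Hloc (fun _ => 0)) as [delta [Hd HT]].
    + intros i _; auto.
    + unfold distn; simpl; auto.
    + eapply Hsub; [|exact HT]. simpl. intros y [Hy _]. split; auto.
  - set (cyl := fun (U : pt -> Prop) (V : R -> Prop) (y : pt) =>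
                  in_Rn (S n) y /\ U (upd y n 0) /\ V (y n)).
    assert (Hslab : T (cyl (fun y => in_Rn n y /\ distn n y c <= r) (fun t => c n - r <= t <= c n + r))).
    { apply (interval_ideal (c n - r) (c n + r)
         (fun V => T (cyl (fun y => in_Rn n y /\ distn n y c <= r) V))); [lra| | |].
      - intros U V HUV. apply Hsub. unfold cyl. intros y (H1 & H2 & H3). auto.
      - intros U V HU HV. eapply Hsub; [|exact (Hun _ _ HU HV)]. unfold cyl. intros y (H1 & H2 & [H3|H3]); auto.
      - intros t Ht.
        (* Tube lemma: the inductive hypothesis is applied to the ideal of base sets over which some
           cylinder of positive height around [t] belongs to [T]. *)
        apply (IH (fun U => exists delta, 0 < delta /\ T (cyl U (fun s => Rabs (s - t) < delta))) c r Hr).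
        + intros U V HUV [delta [Hd HT]]. exists delta. split; auto.
          eapply Hsub; [|exact HT]. unfold cyl. intros y (H1 & H2 & H3). auto.
        + intros U V [d1 [Hd1 HT1]] [d2 [Hd2 HT2]]. exists (Rmin d1 d2). split; [apply Rmin_pos; auto|].
          eapply Hsub; [|exact (Hun _ _ HT1 HT2)]. unfold cyl. intros y (H1 & H2 & H3).
          assert (H4 := Rmin_l d1 d2). assert (H5 := Rmin_r d1 d2).
          destruct H2; [left|right]; repeat split; auto; lra.
        + intros x Hx Hxc.
          destruct (Hloc (upd x n t)) as [delta [Hd HT]].
          * apply in_Rn_upd_last; auto.
          * apply distn_lub; auto. intros i Hi. destruct (Nat.eq_dec i n) as [->|Hne].
            -- rewrite upd_eq. apply Rabs_le. lra.
            -- rewrite upd_neq by auto. eapply Rle_trans; [apply distn_coord with (n := n); lia|auto].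
          * exists delta. split; auto. exists delta. split; auto.
            eapply Hsub; [|exact HT]. unfold cyl. intros y (H1 & (H2 & H3) & H4). split; auto.
            apply normn_lub_lt; auto. intros i Hi.
            destruct (Nat.eq_dec i n) as [->|Hne].
            -- rewrite upd_eq. auto.
            -- rewrite upd_neq by auto. eapply Rle_lt_trans; [|exact H3].
               assert (H5 := distn_coord n (upd y n 0) x i ltac:(lia)).
               rewrite upd_neq in H5 by auto. auto. }
    eapply Hsub; [|exact Hslab]. unfold cyl. intros y [Hy Hyc]. split; auto. split; [split|].
    + intros i Hi. destruct (Nat.eq_dec i n) as [->|Hne]; [apply upd_eq|].
      rewrite upd_neq by auto. apply Hy; lia.
    + apply distn_lub; auto. intros i Hi. rewrite upd_neq by lia.
      eapply Rle_trans; [apply distn_coord with (n := S n); lia|auto].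
    + assert (H := distn_coord (S n) y c n ltac:(lia)).
      assert (H1 : Rabs (y n - c n) <= r) by lra.
      revert H1. unfold Rabs. destruct Rcase_abs; lra.
Qed.

Lemma open_ball n c r : open_in n (fun y => in_Rn n y /\ distn n y c < r).
Proof.
  intros x [Hx Hxc]. split; auto. exists (r - distn n x c). split; [lra|].
  intros y Hy Hyx. split; auto. assert (H := distn_triang n y x c). rewrite (distn_sym n y x) in H. lra.
Qed.

Lemma compact_cube n c r : 0 <= r -> compact_in n (fun y => in_Rn n y /\ distn n y c <= r).
Proof.
  intros Hr. split; [tauto|]. intros I U HU Hcov.
  set (D := fun y => in_Rn n y /\ distn n y c <= r).
  (* The ideal of sets whose part inside the cube has a finite subcover. *)
  set (T := fun V : pt -> Prop => exists l : list I, forall x, V x -> D x -> exists i, In i l /\ U i x).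
  assert (HT : T D).
  { apply cube_ideal; auto.
    - intros V W HVW [l Hl]. exists l. auto.
    - intros V W [l1 H1] [l2 H2]. exists (l1 ++ l2). intros x [HV|HW] Hx.
      + destruct (H1 x HV Hx) as [i [Hi Hu]]. exists i. split; auto. apply in_or_app; auto.
      + destruct (H2 x HW Hx) as [i [Hi Hu]]. exists i. split; auto. apply in_or_app; auto.
    - intros x Hx Hxc. destruct (Hcov x (conj Hx Hxc)) as [i Hi].
      destruct (HU i x Hi) as [_ [delta [Hd Hball]]]. exists delta. split; auto.
      exists (i :: nil). intros y [Hy Hyx] _. exists i. split; [left; auto|].
      apply Hball; auto. rewrite distn_sym; auto. }
  destruct HT as [l Hl]. exists l. intros x Hx. apply Hl; auto.
Qed.

Lemma compact_union n K L : compact_in n K -> compact_in n L -> compact_in n (fun x => K x \/ L x).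
Proof.
  intros [HK HKc] [HL HLc]. split; [intros x [H|H]; auto|].
  intros I U HU Hcov.
  destruct (HKc I U HU) as [l1 H1]; [auto|]. destruct (HLc I U HU) as [l2 H2]; [auto|].
  exists (l1 ++ l2). intros x [H|H].
  - destruct (H1 x H) as [i [Hi Hu]]. exists i. split; auto. apply in_or_app; auto.
  - destruct (H2 x H) as [i [Hi Hu]]. exists i. split; auto. apply in_or_app; auto.
Qed.

(** One number [d] is both the radius of a neighbourhood and the parameter of [P]. By monotonicity
    the least radius of a finite subcover works everywhere. Bounds fit this scheme as [/ d],
    thresholds as [/ d <= INR N]. *)
Lemma compact_uniform n K (P : R -> pt -> Prop) :
  compact_in n K ->
  (forall d d' x, 0 < d' <= d -> P d x -> P d' x) ->
  (forall x, K x -> exists d, 0 < d /\ forall y, K y -> distn n y x < d -> P d y) ->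
  exists d, 0 < d /\ forall y, K y -> P d y.
Proof.
  intros [HKn HK] Hmono Hloc.
  (* The cover is indexed by all pairs of a centre and a radius; [good] makes the open set of an
     unsuitable pair empty. *)
  set (good := fun i : pt * R => 0 < snd i /\
     forall y, K y -> distn n y (fst i) < snd i -> P (snd i) y).
  destruct (HK (pt * R)%type
    (fun i y => good i /\ (in_Rn n y /\ distn n y (fst i) < snd i))) as [l Hl].
  - intros i x [Hg Hb]. destruct (open_ball n (fst i) (snd i) x Hb) as [H1 [r [Hr H2]]].
    split; auto. exists r. split; auto.
  - intros x Hx. destruct (Hloc x Hx) as [d [Hd H]]. exists (x, d). split; [split; auto|].
    simpl. split; auto. rewrite distn_refl; auto.
  - assert (Hmin : exists d, 0 < d /\ forall i, In i l -> 0 < snd i -> d <= snd i).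
    { clear Hl. induction l as [|i l [d [Hd H]]].
      - exists 1. split; [lra|]. intros i [].
      - destruct (Rlt_or_le 0 (snd i)) as [Hi|Hi].
        + exists (Rmin d (snd i)). split; [apply Rmin_pos; auto|].
          intros j [<-|Hj] Hs; [apply Rmin_r|]. eapply Rle_trans; [apply Rmin_l|]. auto.
        + exists d. split; auto. intros j [<-|Hj] Hs; [lra|auto]. }
    destruct Hmin as [d [Hd Hm]]. exists d. split; auto.
    intros y Hy. destruct (Hl y Hy) as [i [Hi [[Hg1 Hg2] [Hy1 Hy2]]]].
    apply Hmono with (d := snd i); auto.
Qed.

Lemma compact_separated n K y : compact_in n K -> in_Rn n y -> ~ K y ->
  exists d, 0 < d /\ forall x, K x -> d <= distn n x y.
Proof.
  intros HK Hy HnK.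
  apply (compact_uniform n K (fun d x => d <= distn n x y) HK).
  - intros; lra.
  - intros x Hx. exists (distn n x y / 2).
    assert (Hp : 0 < distn n x y).
    { assert (H := distn_nonneg n x y). destruct H as [H|H]; auto.
      exfalso. apply HnK. rewrite <- (distn_0_eq n x y); auto. apply (proj1 HK); auto. }
    split; [lra|]. intros z Hz Hzx. assert (H := distn_triang n x z y). rewrite (distn_sym n x z) in H. lra.
Qed.

Lemma compact_bounded n K : compact_in n K -> exists r, 0 < r /\ forall x, K x -> normn n x <= r.
Proof.
  intros HK.
  destruct (compact_uniform n K (fun d x => normn n x <= / d) HK) as [d [Hd H]].
  - intros d d' x Hd H. eapply Rle_trans; [exact H|]. apply Rinv_le_contravar; lra.
  - intros x Hx. assert (Hn := normn_nonneg n x). exists (/ (1 + normn n x)).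
    assert (Hp : 0 < / (1 + normn n x)) by (apply Rinv_0_lt_compat; lra).
    split; auto. intros y Hy Hyx. rewrite Rinv_inv.
    assert (H1 : / (1 + normn n x) <= 1) by (rewrite <- Rinv_1; apply Rinv_le_contravar; lra).
    apply normn_lub; [lra|]. intros i Hi.
    assert (H2 := distn_coord n y x i Hi). assert (H3 := normn_coord n x i Hi).
    replace (y i) with ((y i - x i) + x i) by ring.
    eapply Rle_trans; [apply Rabs_triang|]. lra.
  - exists (/ d). split; auto. apply Rinv_0_lt_compat; auto.
Qed.

(* The thickening is a finite union of cubes, so that Heine-Borel for cubes suffices. *)
Lemma compact_thickening n Q K : open_in n Q -> compact_in n K -> (forall x, K x -> Q x) ->
  exists K', compact_in n K' /\ (forall x, K' x -> Q x) /\
    exists d, 0 < d /\ forall x y, K x -> in_Rn n y -> distn n y x <= d -> K' y.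
Proof.
  intros HQ HK HKQ.
  set (good := fun (K' : pt -> Prop) => compact_in n K' /\ forall x, K' x -> Q x).
  destruct HK as [HKn HK].
  (* The doubled radius leaves room: a displacement of at most [snd i] from a point of the ball of
     radius [snd i] stays in the cube of radius [2 * snd i]. *)
  set (ok := fun i : pt * R => 0 < snd i /\
     forall y, in_Rn n y -> distn n y (fst i) <= 2 * snd i -> Q y).
  destruct (HK (pt * R)%type
    (fun i y => ok i /\ (in_Rn n y /\ distn n y (fst i) < snd i))) as [l Hl].
  - intros i x [Hg Hb]. destruct (open_ball n (fst i) (snd i) x Hb) as [H1 [r [Hr H2]]].
    split; auto. exists r. split; auto.
  - intros x Hx. destruct (HQ x (HKQ x Hx)) as [Hxn [r [Hr H]]].
    exists (x, r / 3). split; [split; simpl; [lra|]|].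
    + intros y Hy Hyx. apply H; auto. rewrite distn_sym. lra.
    + simpl. split; auto. rewrite distn_refl; lra.
  - assert (Hm : exists K', good K' /\ exists d, 0 < d /\ forall i, In i l -> ok i ->
        d <= snd i /\ forall y, in_Rn n y -> distn n y (fst i) <= 2 * snd i -> K' y).
    { clear Hl. induction l as [|i l [K' [HK' [d [Hd H]]]]].
      - exists (fun _ => False). split.
        + split; [|tauto]. split; [tauto|]. intros. exists nil. tauto.
        + exists 1. split; [lra|]. intros i [].
      - destruct (excluded_middle_informative (ok i)) as [Hi|Hi].
        + exists (fun y => K' y \/ (in_Rn n y /\ distn n y (fst i) <= 2 * snd i)).
          destruct HK' as [HK'1 HK'2]. destruct Hi as [Hi1 Hi2]. split.
          * split; [apply compact_union; auto; apply compact_cube; lra|].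
            intros x [Hx|[Hx1 Hx2]]; auto.
          * exists (Rmin d (snd i)). split; [apply Rmin_pos; auto|].
            intros j [<-|Hj] Hok.
            -- split; [apply Rmin_r|]. intros; right; auto.
            -- destruct (H j Hj Hok) as [H1 H2]. split; auto. eapply Rle_trans; [apply Rmin_l|auto].
        + exists K'. split; auto. exists d. split; auto. intros j [<-|Hj] Hok; [tauto|auto]. }
    destruct Hm as [K' [[HK'1 HK'2] [d [Hd H]]]]. exists K'. split; auto. split; auto.
    exists d. split; auto. intros x y Hx Hy Hyx.
    destruct (Hl x Hx) as [i [Hi [Hok [_ Hxi]]]]. destruct (H i Hi Hok) as [H1 H2].
    apply H2; auto. assert (H3 := distn_triang n y x (fst i)). lra.
Qed.

(** * Smooth bump functions *)

Fixpoint Ck (m : nat) (f : R -> R) : Prop :=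
  match m with
  | O => continuity f
  | S m' => exists f', (forall x, derivable_pt_lim f x (f' x)) /\ Ck m' f'
  end.

Lemma derivable_continuity f f' : (forall x, derivable_pt_lim f x (f' x)) -> continuity f.
Proof. intros H x. apply derivable_continuous_pt. exists (f' x). apply H. Qed.

Lemma Ck_continuity m f : Ck m f -> continuity f.
Proof. destruct m; simpl; auto. intros [f' [H _]]. exact (derivable_continuity f f' H). Qed.

Lemma Ck_pred m : forall f, Ck (S m) f -> Ck m f.
Proof.
  induction m as [|m IH]; intros f H.
  - exact (Ck_continuity 1 f H).
  - destruct H as [f' [H1 H2]]. exists f'. split; auto.
Qed.

Lemma Ck_const m : forall c, Ck m (fun _ => c).
Proof.
  induction m as [|m IH]; intros c; simpl.
  - apply continuity_const. intros x y; auto.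
  - exists (fun _ => 0). split; auto. intros x. apply (derivable_pt_lim_const c).
Qed.

Lemma Ck_plus m : forall f g, Ck m f -> Ck m g -> Ck m (fun x => f x + g x).
Proof.
  induction m as [|m IH]; intros f g; simpl.
  - apply continuity_plus.
  - intros [f' [Hf Hf']] [g' [Hg Hg']]. exists (fun x => f' x + g' x). split; auto.
    intros x. apply (derivable_pt_lim_plus f g); auto.
Qed.

Lemma Ck_mult m : forall f g, Ck m f -> Ck m g -> Ck m (fun x => f x * g x).
Proof.
  induction m as [|m IH]; intros f g Hf0 Hg0.
  - exact (continuity_mult f g Hf0 Hg0).
  - assert (Hf1 := Ck_pred m f Hf0). assert (Hg1 := Ck_pred m g Hg0).
    destruct Hf0 as [f' [Hf Hf']], Hg0 as [g' [Hg Hg']].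
    exists (fun x => f' x * g x + f x * g' x). split.
    + intros x. apply (derivable_pt_lim_mult f g); auto.
    + apply Ck_plus; auto.
Qed.

Lemma Ck_inv m : forall f, (forall x, f x <> 0) -> Ck m f -> Ck m (fun x => / f x).
Proof.
  induction m as [|m IH]; intros f Hne Hf0.
  - exact (continuity_inv f Hf0 Hne).
  - assert (Hf1 := IH f Hne (Ck_pred m f Hf0)).
    destruct Hf0 as [f' [Hf Hf']].
    exists (fun x => (-1 * f' x) * (/ f x * / f x)). split.
    + intros x. replace (-1 * f' x * (/ f x * / f x)) with ((0 * f x - f' x * 1) / Rsqr (f x)).
      2:{ unfold Rsqr. field. auto. }
      apply derivable_pt_lim_ext with (f := (fct_cte 1 / f)%F).
      * intros z. unfold div_fct, fct_cte. field; auto.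
      * apply derivable_pt_lim_div; auto. apply derivable_pt_lim_const.
    + repeat apply Ck_mult; auto using Ck_const.
Qed.

Lemma derivable_pt_lim_affine f x L a b :
  derivable_pt_lim f (a * x + b) L -> derivable_pt_lim (fun t => f (a * t + b)) x (a * L).
Proof.
  intros H. rewrite Rmult_comm.
  apply (derivable_pt_lim_comp (fun t => a * t + b) f); auto.
  assert (E : a * 1 + 0 = a) by ring. cut (derivable_pt_lim (fun t => a * t + b) x (a * 1 + 0)); [rewrite E; auto|].
  apply (derivable_pt_lim_plus (fun t => a * t) (fun _ => b)).
  - apply (derivable_pt_lim_scal id). apply derivable_pt_lim_id.
  - apply derivable_pt_lim_const.
Qed.

Lemma Ck_affine m : forall f a b, Ck m f -> Ck m (fun t => f (a * t + b)).
Proof.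
  induction m as [|m IH]; intros f a b Hf.
  - simpl in *. apply (continuity_comp (fun t => a * t + b) f); auto.
    apply (continuity_plus (fun t => a * t) (fun _ => b)).
    + apply continuity_scal. apply derivable_continuous, derivable_id.
    + apply continuity_const. intros x y; auto.
  - destruct Hf as [f' [Hf Hf']]. exists (fun t => a * f' (a * t + b)). split.
    + intros x. apply derivable_pt_lim_affine; auto.
    + apply Ck_mult; auto using Ck_const.
Qed.

Lemma derivable_pt_lim_near f g x L r : 0 < r ->
  (forall y, Rabs (y - x) < r -> f y = g y) -> derivable_pt_lim g x L -> derivable_pt_lim f x L.
Proof.
  intros Hr Hfg Hg eps Heps. destruct (Hg eps Heps) as [delta Hd].
  exists (mkposreal (Rmin delta r) (Rmin_pos _ _ (cond_pos delta) Hr)). simpl.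
  intros h Hh Hlt. rewrite !Hfg.
  - apply Hd; auto. eapply Rlt_le_trans; [exact Hlt|apply Rmin_l].
  - rewrite Rminus_diag, Rabs_R0. auto.
  - replace (x + h - x) with h by ring. eapply Rlt_le_trans; [exact Hlt|apply Rmin_r].
Qed.

(** Constancy on one side already determines the derivative; this settles the two ends of the
    transition interval of [step]. *)
Lemma derivable_pt_lim_eq0 f x L : derivable_pt_lim f x L ->
  (forall d, 0 < d -> exists h, h <> 0 /\ Rabs h < d /\ f (x + h) = f x) -> L = 0.
Proof.
  intros H Hc. apply NNPP. intros HL.
  destruct (H (Rabs L)) as [delta Hd]; [apply Rabs_pos_lt; auto|].
  destruct (Hc delta (cond_pos delta)) as [h [Hh [Hhd E]]].
  specialize (Hd h Hh Hhd). rewrite E in Hd.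
  replace ((f x - f x) / h - L) with (- L) in Hd by (field; auto). rewrite Rabs_Ropp in Hd. lra.
Qed.

(** The functions t^-k exp(-1/t), extended by zero, are closed under differentiation up to linear
    combinations. The index [k] lets smoothness of exp(-1/t) be proved by induction on the order for
    all [k] at once. *)
Definition flat (k : nat) (t : R) : R := if Rle_dec t 0 then 0 else (/ t) ^ k * exp (- / t).

Lemma flat_neg k t : t <= 0 -> flat k t = 0.
Proof. intros H. unfold flat. destruct (Rle_dec t 0); auto; lra. Qed.

Lemma flat_pos k t : 0 < t -> flat k t = (/ t) ^ k * exp (- / t).
Proof. intros H. unfold flat. destruct (Rle_dec t 0); auto; lra. Qed.

(** This is the [p]-th power of the inequality s/p <= exp(s/p). *)
Lemma pow_le_exp p s : (0 < p)%nat -> 0 < s -> s ^ p <= INR p ^ p * exp s.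
Proof.
  intros Hp Hs. assert (Hp' : 0 < INR p) by (apply lt_0_INR; auto).
  assert (H : forall m, exp (s / INR p) ^ m = exp (INR m * (s / INR p))).
  { induction m; [simpl; rewrite Rmult_0_l, exp_0; auto|].
    rewrite S_INR, Rmult_plus_distr_r, exp_plus, Rmult_1_l. simpl. rewrite IHm. ring. }
  specialize (H p). replace (INR p * (s / INR p)) with s in H by (field; lra).
  rewrite <- H, <- Rpow_mult_distr. apply pow_incr.
  assert (Hq : 0 < s / INR p) by (apply Rdiv_lt_0_compat; auto).
  split; [lra|]. assert (H1 := exp_ineq1 (s / INR p) ltac:(lra)).
  replace s with (INR p * (s / INR p)) at 1 by (field; lra).
  apply Rmult_le_compat_l; lra.
Qed.

Lemma flat_small k t : 0 < t -> flat k t <= INR (S k) ^ (S k) * t.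
Proof.
  intros Ht. rewrite flat_pos by auto.
  assert (Hi : 0 < / t) by (apply Rinv_0_lt_compat; auto).
  assert (H := pow_le_exp (S k) (/ t) ltac:(lia) Hi).
  rewrite exp_Ropp. assert (He := exp_pos (/ t)).
  apply Rmult_le_reg_r with (exp (/ t)); auto.
  apply Rmult_le_reg_l with (/ t); auto.
  replace (/ t * ((/ t) ^ k * / exp (/ t) * exp (/ t))) with ((/ t) ^ S k).
  - eapply Rle_trans; [exact H|]. right. field. lra.
  - simpl. field. split; lra.
Qed.

Lemma flat_derivable k x :
  derivable_pt_lim (flat k) x (- INR k * flat (S k) x + flat (S (S k)) x).
Proof.
  destruct (Rtotal_order x 0) as [Hx|[->|Hx]].
  - rewrite !flat_neg by lra. rewrite Rmult_0_r, Rplus_0_r.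
    apply derivable_pt_lim_near with (g := fun _ => 0) (r := - x); [lra| |apply (derivable_pt_lim_const 0)].
    intros y Hy. apply flat_neg. apply Rabs_def2 in Hy. lra.
  - rewrite !flat_neg by lra. rewrite Rmult_0_r, Rplus_0_r.
    intros eps Heps. set (C := INR (S (S k)) ^ S (S k)).
    assert (HC : 0 < C) by (apply pow_lt, lt_0_INR; lia).
    assert (Hd : 0 < eps / C) by (apply Rdiv_lt_0_compat; auto).
    exists (mkposreal _ Hd). simpl. intros h Hh Hlt.
    rewrite (flat_neg k 0), Rplus_0_l, !Rminus_0_r by lra.
    destruct (Rle_or_lt h 0) as [H|H].
    + rewrite flat_neg by auto. unfold Rdiv. rewrite Rmult_0_l, Rabs_R0. auto.
    (* The difference quotient of [flat k] at 0 is [flat (S k)], which [flat_small] bounds by a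
       multiple of [h]. *)
    + replace (flat k h / h) with (flat (S k) h).
      2:{ rewrite !flat_pos by auto. simpl. field. lra. }
      assert (H1 := flat_small (S k) h H). fold C in H1.
      rewrite Rabs_pos_eq in Hlt by lra.
      assert (0 <= flat (S k) h).
      { rewrite flat_pos by auto. apply Rmult_le_pos; [apply pow_le; left; apply Rinv_0_lt_compat; auto|].
        left; apply exp_pos. }
      rewrite Rabs_pos_eq by auto. eapply Rle_lt_trans; [exact H1|].
      apply Rmult_lt_compat_l with (r := C) in Hlt; auto.
      replace (C * (eps / C)) with eps in Hlt by (field; lra). exact Hlt.
  - rewrite !flat_pos by lra.
    apply derivable_pt_lim_near with (g := fun t => (/ t) ^ k * exp (- / t)) (r := x); auto.
    { intros y Hy. apply Rabs_def2 in Hy. apply flat_pos. lra. }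
    assert (Hi : derivable_pt_lim (fun t => / t) x (- / (x * x))).
    { replace (- / (x * x)) with ((0 * x - 1 * 1) / Rsqr x) by (unfold Rsqr; field; lra).
      apply derivable_pt_lim_ext with (f := (fct_cte 1 / id)%F).
      - intros z. unfold div_fct, fct_cte, id, Rdiv. apply Rmult_1_l.
      - apply derivable_pt_lim_div; [apply derivable_pt_lim_const|apply derivable_pt_lim_id|unfold id; lra]. }
    replace (- INR k * ((/ x) ^ S k * exp (- / x)) + (/ x) ^ S (S k) * exp (- / x)) with
      ((INR k * (/ x) ^ pred k * - / (x * x)) * exp (- / x)
        + (/ x) ^ k * (exp (- / x) * - - / (x * x))).
    + apply (derivable_pt_lim_mult (fun t => (/ t) ^ k) (fun t => exp (- / t))).
      * apply (derivable_pt_lim_comp (fun t => / t) (fun s => s ^ k)); auto. apply derivable_pt_lim_pow.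
      * apply (derivable_pt_lim_comp (fun t => - / t) exp); [|apply derivable_pt_lim_exp].
        apply (derivable_pt_lim_opp (fun t => / t)); auto.
    + destruct k; simpl pred; [simpl; field; lra|]. simpl pow. field. lra.
Qed.

Lemma Ck_flat m : forall k, Ck m (flat k).
Proof.
  induction m as [|m IH]; intros k.
  - exact (derivable_continuity _ _ (flat_derivable k)).
  - eexists. split; [exact (flat_derivable k)|].
    apply Ck_plus; auto. apply Ck_mult; auto using Ck_const.
Qed.

(** The classical smooth transition from 0 to 1 across [0, 1]; the denominator is positive because t
    and 1 - t are never both nonpositive. *)
Definition step (t : R) : R := flat 0 t * / (flat 0 t + flat 0 (-1 * t + 1)).

Lemma flat0_range t : 0 <= flat 0 t /\ (0 < t -> 0 < flat 0 t).
Proof.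
  destruct (Rle_or_lt t 0).
  - rewrite flat_neg by auto. lra.
  - rewrite flat_pos by auto. assert (H1 := exp_pos (- / t)). simpl. lra.
Qed.

Lemma step_denominator t : 0 < flat 0 t + flat 0 (-1 * t + 1).
Proof.
  destruct (flat0_range t) as [H1 H2]. destruct (flat0_range (-1 * t + 1)) as [H3 H4].
  destruct (Rle_or_lt t 0); [specialize (H4 ltac:(lra))|specialize (H2 ltac:(lra))]; lra.
Qed.

Lemma Ck_step m : Ck m step.
Proof.
  apply Ck_mult; [apply Ck_flat|]. apply Ck_inv.
  - intros x. assert (H := step_denominator x). lra.
  - apply Ck_plus; [apply Ck_flat|]. apply Ck_affine. apply Ck_flat.
Qed.

Lemma step_left t : t <= 0 -> step t = 0.
Proof. intros H. unfold step. rewrite flat_neg by auto. ring. Qed.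

Lemma step_right t : 1 <= t -> step t = 1.
Proof.
  intros H. unfold step. rewrite (flat_neg 0 (-1 * t + 1)) by lra.
  destruct (flat0_range t) as [_ H1]. specialize (H1 ltac:(lra)). field. lra.
Qed.

Lemma step_range t : 0 <= step t <= 1.
Proof.
  unfold step. assert (H := step_denominator t).
  destruct (flat0_range t) as [H1 _]. destruct (flat0_range (-1 * t + 1)) as [H3 _].
  split.
  - apply Rmult_le_pos; auto. left; apply Rinv_0_lt_compat; auto.
  - apply Rmult_le_reg_r with (flat 0 t + flat 0 (-1 * t + 1)); auto.
    rewrite Rmult_assoc, Rinv_l by lra. lra.
Qed.

Definition smooth (f : R -> R) : Prop := forall m, Ck m f.

(** Each order of smoothness comes with its own witness for the first derivative; uniqueness of
    derivatives identifies them all. *)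
Lemma smooth_derivative f : smooth f ->
  exists f', (forall x, derivable_pt_lim f x (f' x)) /\ smooth f'.
Proof.
  intros H. destruct (H 1%nat) as [f' [H1 _]]. exists f'. split; auto.
  intros m. destruct (H (S m)) as [g [Hg1 Hg2]].
  replace f' with g; auto. extensionality x. eapply uniqueness_limite; eauto.
Qed.

Lemma smooth_affine f a b : smooth f -> smooth (fun t => f (a * t + b)).
Proof. intros H m. apply Ck_affine; auto. Qed.

Lemma smooth_scal f a : smooth f -> smooth (fun t => a * f t).
Proof. intros H m. apply Ck_mult; auto using Ck_const. Qed.

Definition node (N a : nat) : R := (INR a - INR (N * N)) / INR N.

(** With mesh 1/(P r), moving by [r] nodes moves [INR P * (node - t)] by exactly 1. The summand is
    therefore [h (a + r) - h a], and the sum telescopes to the [r] values just past the grid minus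
    the first [r]. The bound on [t] puts the former where [g] equals [c] and the latter where [g]
    vanishes. The cases of use are the step, with [c] equal to 1, and its derivative, with [c] equal
    to 0. *)
Lemma telescoping_partition (g : R -> R) c (P r : nat) t :
  (0 < P)%nat -> (0 < r)%nat ->
  (forall s, s <= 0 -> g s = 0) -> (forall s, 1 <= s -> g s = c) ->
  Rabs t <= INR (P * r) - 1 ->
  sumR (2 * (P * r) * (P * r))
    (fun a => g (INR P * (node (P * r) a - t) + 1) - g (INR P * (node (P * r) a - t))) = INR r * c.
Proof.
  intros HP Hr Hg0 Hg1 Ht.
  set (N := (P * r)%nat) in *.
  assert (HP' : 1 <= INR P) by (apply (le_INR 1); lia).
  assert (Hr' : 1 <= INR r) by (apply (le_INR 1); lia).
  assert (EN : INR N = INR P * INR r) by apply mult_INR.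
  assert (HN : 1 <= INR N) by nra.
  set (h := fun a => g (INR P * (node N a - t))).
  rewrite sumR_ext with (g := fun a => h (a + r)%nat - h a).
  2:{ intros a _. unfold h. f_equal. f_equal. unfold node. rewrite plus_INR, EN. field. split; lra. }
  rewrite sumR_minus, sumR_shift.
  replace (sumR (2 * N * N + r) h) with (sumR (2 * N * N) h + INR r * c).
  - rewrite (sumR_0 r); [ring|]. intros a Ha. apply Hg0.
    assert (H1 : INR a + 1 <= INR r) by (rewrite <- S_INR; apply le_INR; lia).
    assert (H2 : node N a <= - INR N + / INR P).
    { unfold node. rewrite mult_INR. apply Rmult_le_reg_r with (INR N); [lra|].
      replace ((INR a - INR N * INR N) / INR N * INR N) with (INR a - INR N * INR N) by (field; lra).
      rewrite Rmult_plus_distr_r. replace (/ INR P * INR N) with (INR r) by (rewrite EN; field; lra). lra. }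
    assert (H3 : / INR P <= 1) by (rewrite <- Rinv_1; apply Rinv_le_contravar; lra).
    assert (H4 : -t <= Rabs t) by (rewrite <- Rabs_Ropp; apply Rle_abs).
    assert (node N a - t <= 0) by lra. nra.
  - rewrite (Nat.add_comm (2 * N * N)).
    assert (E := sumR_shift (2 * N * N) r h).
    assert (E2 : sumR (r + 2 * N * N) h = sumR (2 * N * N) h + sumR r (fun a => h (a + 2 * N * N)%nat)).
    { rewrite sumR_shift. lra. }
    rewrite E2. f_equal. rewrite <- sumR_const. apply sumR_ext. intros a _. symmetry. apply Hg1.
    assert (H2 : INR N <= node N (a + 2 * N * N)).
    { unfold node. rewrite plus_INR, !mult_INR. simpl (INR 2). assert (Ha := pos_INR a).
      apply Rmult_le_reg_r with (INR N); [lra|].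
      replace ((INR a + (1 + 1) * INR N * INR N - INR N * INR N) / INR N * INR N)
        with (INR a + INR N * INR N) by (field; lra). lra. }
    assert (H4 := Rle_abs t). assert (1 <= node N (a + 2 * N * N) - t) by lra. nra.
Qed.

(** The last clause is the discrete form, without error, of unit mass and of a derivative with zero
    mass. The value [INR r] arises because the rescaled weight of one node is P times the mesh 1/(P
    r), that is 1/r. *)
Definition is_bump (eta eta' : R -> R) (C : R) : Prop :=
  smooth eta /\ smooth eta' /\ (forall t, derivable_pt_lim eta t (eta' t)) /\
  (forall t, 0 <= eta t) /\ (forall t, 1 <= Rabs t -> eta t = 0 /\ eta' t = 0) /\
  1 <= C /\ (forall t, Rabs (eta t) <= C /\ Rabs (eta' t) <= C) /\
  forall P r t, (0 < P)%nat -> (0 < r)%nat -> Rabs t <= INR (P * r) - 1 ->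
    sumR (2 * (P * r) * (P * r)) (fun a => eta (INR P * (node (P * r) a - t))) = INR r /\
    sumR (2 * (P * r) * (P * r)) (fun a => eta' (INR P * (node (P * r) a - t))) = 0.

Lemma smooth_partition_of_unity : exists eta eta' C, is_bump eta eta' C.
Proof.
  destruct (smooth_derivative step Ck_step) as [step' [Hd Hs']].
  assert (Hl : forall t, t <= 0 -> step' t = 0).
  { intros t Ht. apply (derivable_pt_lim_eq0 step t); auto.
    intros d Hdp. exists (- (d / 2)). repeat split; [lra| |].
    - rewrite Rabs_Ropp, Rabs_pos_eq; lra.
    - rewrite !step_left; lra. }
  assert (Hr : forall t, 1 <= t -> step' t = 0).
  { intros t Ht. apply (derivable_pt_lim_eq0 step t); auto.
    intros d Hdp. exists (d / 2). repeat split; [lra| |].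
    - rewrite Rabs_pos_eq; lra.
    - rewrite !step_right; lra. }
  (* A difference of two shifted steps, so that integer translates telescope. It is nonnegative
     because for every [t] either [step t] is 0 or [step (t + 1)] is 1. *)
  set (eta := fun t => step (t + 1) - step t).
  set (eta' := fun t => step' (t + 1) - step' t).
  assert (Hsh : forall f, smooth f -> smooth (fun t => f (t + 1) - f t)).
  { intros f Hf m. replace (fun t => f (t + 1) - f t) with (fun t => f (1 * t + 1) + (-1) * f t).
    - apply Ck_plus; [apply Ck_affine; auto|apply Ck_mult; auto using Ck_const].
    - extensionality t. rewrite Rmult_1_l. ring. }
  assert (Hder : forall t, derivable_pt_lim eta t (eta' t)).
  { intros t. apply (derivable_pt_lim_minus (fun t => step (t + 1)) step); auto.
    apply derivable_pt_lim_ext with (f := fun t => step (1 * t + 1)); [intros; rewrite Rmult_1_l; auto|].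
    rewrite <- (Rmult_1_l (step' (t + 1))). apply derivable_pt_lim_affine. rewrite Rmult_1_l. auto. }
  assert (Hsupp : forall t, 1 <= Rabs t -> eta t = 0 /\ eta' t = 0).
  { intros t Ht. unfold eta, eta'. unfold Rabs in Ht. destruct (Rcase_abs t).
    - rewrite !step_left, !Hl by lra. lra.
    - rewrite !step_right, !Hr by lra. lra. }
  assert (Hse' : smooth eta') by (apply Hsh; auto).
  assert (Hc : continuity (fun t => Rabs (eta' t))).
  { apply (continuity_comp eta' Rabs); [exact (Hse' O)|exact Rcontinuity_abs]. }
  destruct (continuity_ab_maj (fun t => Rabs (eta' t)) (-1) 1) as [M [HM _]]; [lra|intros; apply Hc|].
  assert (Hstep := step_range).
  exists eta, eta', (Rmax 1 (Rabs (eta' M))).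
  split; [apply Hsh; exact Ck_step|]. split; auto. split; auto.
  split; [|split; [|split; [|split]]]; auto.
  - intros t. unfold eta. assert (H1 := Hstep (t + 1)). assert (H2 := Hstep t).
    destruct (Rle_or_lt t 0); [rewrite (step_left t) by auto; lra|rewrite (step_right (t + 1)); lra].
  - apply Rmax_l.
  - intros t. split.
    + eapply Rle_trans; [|apply Rmax_l]. unfold eta.
      assert (H1 := Hstep (t + 1)). assert (H2 := Hstep t). apply Rabs_le. lra.
    + destruct (Rle_or_lt 1 (Rabs t)) as [H|H].
      * rewrite (proj2 (Hsupp t H)), Rabs_R0. eapply Rle_trans; [|apply Rmax_l]. lra.
      * eapply Rle_trans; [|apply Rmax_r]. apply HM. apply Rabs_def2 in H. lra.
  - intros P r t HP Hr0 Ht. split.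
    + rewrite <- (Rmult_1_r (INR r)). apply (telescoping_partition step 1); auto using step_left, step_right.
    + rewrite <- (Rmult_0_r (INR r)). apply (telescoping_partition step' 0); auto.
Qed.

(** * Tensor products of one-variable functions *)

Fixpoint prodR (m : nat) (g : nat -> R) : R :=
  match m with O => 1 | S m' => prodR m' g * g m' end.

Lemma prodR_ext m f g : (forall i, (i < m)%nat -> f i = g i) -> prodR m f = prodR m g.
Proof.
  induction m as [|m IH]; simpl; intros H; auto.
  rewrite IH by (intros; apply H; lia). rewrite H by lia. auto.
Qed.

Lemma prodR_0 m g i : (i < m)%nat -> g i = 0 -> prodR m g = 0.
Proof.
  induction m as [|m IH]; intros Hi H; [lia|]. simpl.
  destruct (Nat.eq_dec i m) as [->|Hne]; [rewrite H; ring|]. rewrite IH by (auto; lia). ring.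
Qed.

Lemma prodR_bound m g c : 0 <= c -> (forall i, (i < m)%nat -> Rabs (g i) <= c) -> Rabs (prodR m g) <= c ^ m.
Proof.
  intros Hc. induction m as [|m IH]; intros H; simpl; [rewrite Rabs_R1; lra|].
  rewrite Rabs_mult, Rmult_comm. apply Rmult_le_compat; auto using Rabs_pos.
Qed.

Lemma prodR_nonneg m g : (forall i, (i < m)%nat -> 0 <= g i) -> 0 <= prodR m g.
Proof.
  induction m as [|m IH]; simpl; intros H; [lra|]. apply Rmult_le_pos; [apply IH; intros; apply H|apply H]; lia.
Qed.

Lemma prodR_update m (f : nat -> R) j v : (j < m)%nat ->
  prodR m (fun i => if Nat.eqb i j then v else f i) = v * prodR m (fun i => if Nat.eqb i j then 1 else f i).
Proof.
  induction m as [|m IH]; intros Hj; [lia|]. simpl.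
  destruct (Nat.eqb_spec m j) as [->|Hne].
  - rewrite (prodR_ext j (fun i => if Nat.eqb i j then v else f i) (fun i => if Nat.eqb i j then 1 else f i)).
    + ring.
    + intros i Hi. destruct (Nat.eqb_spec i j); [lia|auto].
  - rewrite IH by lia. ring.
Qed.

Definition tensor (n : nat) (g : nat -> R -> R) (x : pt) : R := prodR n (fun i => g i (x i)).

Lemma tensor_cont n g : (forall i, (i < n)%nat -> continuity (g i)) -> cont_on n (in_Rn n) (tensor n g).
Proof.
  intros Hg.
  assert (Hm : forall m, (m <= n)%nat -> cont_on n (in_Rn n) (tensor m g)).
  { induction m as [|m IH]; intros Hm x Hx eps Heps.
    - exists 1. split; [lra|]. intros. unfold tensor; simpl. rewrite Rminus_diag, Rabs_R0. auto.
    - set (a := tensor m g x). set (b := g m (x m)).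
      set (e := Rmin 1 (eps / (2 * (1 + Rabs a + Rabs b)))).
      assert (Ha := Rabs_pos a). assert (Hb := Rabs_pos b).
      assert (He : 0 < e).
      { apply Rmin_pos; [lra|]. apply Rdiv_lt_0_compat; lra. }
      assert (He1 : e <= 1) by apply Rmin_l.
      assert (He2 : e * (1 + Rabs a + Rabs b) <= eps / 2).
      { assert (H := Rmin_r 1 (eps / (2 * (1 + Rabs a + Rabs b)))). fold e in H.
        apply Rmult_le_compat_r with (r := 1 + Rabs a + Rabs b) in H; [|lra].
        eapply Rle_trans; [exact H|]. right. field. lra. }
      destruct (IH ltac:(lia) x Hx e He) as [d1 [Hd1 H1]].
      destruct (Hg m ltac:(lia) (x m) e He) as [d2 [Hd2 H2]].
      exists (Rmin d1 d2). split; [apply Rmin_pos; auto|].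
      intros y Hy Hyx. unfold tensor; simpl. fold (tensor m g y). fold (tensor m g x). fold a b.
      specialize (H1 y Hy (Rlt_le_trans _ _ _ Hyx (Rmin_l d1 d2))). fold a in H1.
      assert (H3 : Rabs (g m (y m) - b) < e).
      { destruct (Req_dec (y m) (x m)) as [E|E].
        - rewrite E. unfold b. rewrite Rminus_diag, Rabs_R0. auto.
        - apply H2. split; [split; [exact I|auto]|]. simpl. unfold Rdist.
          eapply Rle_lt_trans; [apply (distn_coord n y x m); lia|].
          rewrite distn_sym. eapply Rlt_le_trans; [exact Hyx|apply Rmin_r]. }
      replace (tensor m g y * g m (y m) - a * b) with
        ((tensor m g y - a) * (g m (y m) - b) + (a * (g m (y m) - b) + b * (tensor m g y - a))) by ring.
      eapply Rle_lt_trans; [apply Rabs_triang|].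
      eapply Rle_lt_trans; [apply Rplus_le_compat_l, Rabs_triang|]. rewrite !Rabs_mult.
      assert (H4 := Rabs_pos (tensor m g y - a)). assert (H5 := Rabs_pos (g m (y m) - b)).
      nra. }
  apply Hm; auto.
Qed.

Definition replace_factor (g : nat -> R -> R) (j : nat) (f : R -> R) (i : nat) : R -> R :=
  if Nat.eqb i j then f else g i.

Lemma tensor_partial n g g' j x : (j < n)%nat ->
  derivable_pt_lim (g j) (x j) (g' (x j)) ->
  has_partial (tensor n g) j x (tensor n (replace_factor g j g') x).
Proof.
  intros Hj Hd. unfold has_partial, tensor.
  set (c := prodR n (fun i => if Nat.eqb i j then 1 else g i (x i))).
  replace (fun t => prodR n (fun i => g i (upd x j (x j + t) i))) with (fun t => c * g j (1 * t + x j)).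
  - replace (prodR n (fun i => replace_factor g j g' i (x i))) with (c * (1 * g' (x j))).
    + apply (derivable_pt_lim_scal (fun t => g j (1 * t + x j))).
      apply derivable_pt_lim_affine. replace (1 * 0 + x j) with (x j) by ring. auto.
    + rewrite Rmult_1_l, Rmult_comm. unfold c. rewrite <- prodR_update by auto.
      apply prodR_ext. intros i Hi. unfold replace_factor. destruct (Nat.eqb_spec i j); subst; auto.
  - extensionality t. rewrite Rmult_comm. unfold c. rewrite <- prodR_update by auto.
    apply prodR_ext. intros i Hi. unfold upd. destruct (Nat.eqb_spec i j); subst; auto. f_equal. ring.
Qed.

(** A partial derivative of a tensor product is again a tensor product, with one factor
    differentiated; the induction on the order therefore ranges over all families of smooth
    factors. *)
Lemma tensor_Cinf n g : (forall i, (i < n)%nat -> smooth (g i)) -> Cinf n (in_Rn n) (tensor n g).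
Proof.
  intros Hg m. revert g Hg. induction m as [|m IH]; intros g Hg.
  - apply tensor_cont. intros i Hi. exact (Hg i Hi O).
  - split; [apply tensor_cont; intros i Hi; exact (Hg i Hi O)|].
    assert (Hex : forall j, exists g', (j < n)%nat -> (forall x, derivable_pt_lim (g j) x (g' x)) /\ smooth g').
    { intros j. destruct (Nat.lt_ge_cases j n) as [H|H].
      - destruct (smooth_derivative (g j) (Hg j H)) as [g' H']. exists g'; auto.
      - exists (fun _ => 0). lia. }
    set (g' := fun j => proj1_sig (constructive_indefinite_description _ (Hex j))).
    assert (Hg' : forall j, (j < n)%nat -> (forall x, derivable_pt_lim (g j) x (g' j x)) /\ smooth (g' j)).
    { intros j. exact (proj2_sig (constructive_indefinite_description _ (Hex j))). }
    exists (fun j => tensor n (replace_factor g j (g' j))). intros j Hj.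
    destruct (Hg' j Hj) as [H1 H2]. split.
    + intros x _. apply tensor_partial; auto.
    + apply IH. intros i Hi. unfold replace_factor. destruct (Nat.eqb_spec i j); auto.
Qed.

(** * Riemann sums *)

Lemma gsum_S n N f :
  gsum (S n) N f = sumR (2 * N * N) (fun a => gsum n N (fun x => f (upd x n (node N a)))).
Proof. reflexivity. Qed.

Lemma gsum_ext n N : forall f g, (forall x, in_Rn n x -> f x = g x) -> gsum n N f = gsum n N g.
Proof.
  induction n as [|n IH]; intros f g H.
  - simpl. apply H. intros i _; auto.
  - rewrite !gsum_S. apply sumR_ext. intros a _. apply IH. intros x Hx.
    apply H. apply in_Rn_upd_last; auto.
Qed.

Lemma gsum_plus n N : forall f g, gsum n N (fun x => f x + g x) = gsum n N f + gsum n N g.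
Proof.
  induction n as [|n IH]; intros f g; [reflexivity|].
  rewrite !gsum_S, <- sumR_plus. apply sumR_ext. intros a _. apply IH.
Qed.

Lemma gsum_scal n N c : forall f, gsum n N (fun x => c * f x) = c * gsum n N f.
Proof.
  induction n as [|n IH]; intros f; [reflexivity|].
  rewrite !gsum_S, <- sumR_scal. apply sumR_ext. intros a _.
  apply (IH (fun x => f (upd x n (node N a)))).
Qed.

Lemma gsum_le n N : forall f g, (forall x, in_Rn n x -> f x <= g x) -> gsum n N f <= gsum n N g.
Proof.
  induction n as [|n IH]; intros f g H.
  - simpl. apply H. intros i _; auto.
  - rewrite !gsum_S. apply sumR_le. intros a _. apply IH. intros x Hx.
    apply H. apply in_Rn_upd_last; auto.
Qed.

Lemma gsum_zero n N : gsum n N (fun _ => 0) = 0.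
Proof.
  rewrite (gsum_ext n N _ (fun _ => 0 * 0)) by (intros; ring).
  rewrite (gsum_scal n N 0 (fun _ => 0)). ring.
Qed.

Lemma gsum_sumR n N m : forall f : nat -> pt -> R,
  gsum n N (fun x => sumR m (fun j => f j x)) = sumR m (fun j => gsum n N (f j)).
Proof.
  intros f. induction m; simpl; [apply gsum_zero|].
  rewrite gsum_plus, IHm. auto.
Qed.

Lemma gsum_Rabs n N : forall f, Rabs (gsum n N f) <= gsum n N (fun x => Rabs (f x)).
Proof.
  induction n as [|n IH]; intros f; [simpl; lra|].
  rewrite !gsum_S. eapply Rle_trans; [apply sumR_Rabs|]. apply sumR_le. intros a _.
  apply (IH (fun x => f (upd x n (node N a)))).
Qed.

Lemma gsum_tensor n N : forall g,
  gsum n N (tensor n g) = prodR n (fun i => sumR (2 * N * N) (fun a => g i (node N a))).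
Proof.
  induction n as [|n IH]; intros g; [reflexivity|].
  rewrite gsum_S. simpl prodR. rewrite <- IH, <- sumR_scal. apply sumR_ext. intros a _.
  rewrite Rmult_comm, <- gsum_scal. apply gsum_ext. intros x _.
  unfold tensor. simpl. rewrite upd_eq, Rmult_comm. f_equal.
  apply prodR_ext. intros i Hi. rewrite upd_neq by lia. auto.
Qed.

Lemma sumR_window m g c r b : 0 <= r -> 0 <= b ->
  (forall a, (a < m)%nat -> Rabs (g a) <= b) ->
  (forall a, (a < m)%nat -> r < Rabs (INR a - c) -> g a = 0) ->
  Rabs (sumR m g) <= (2 * r + 1) * b.
Proof.
  intros Hr Hb Hg H0.
  set (h := fun a => if Rle_dec (Rabs (INR a - c)) r then 1 else 0).
  (* Two bounds on the count are carried together: when the index [k] itself is counted,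
     [INR k <= c + r] turns the first bound at [k] into the bound [2 * r + 1] at the next index. *)
  assert (Hh : forall k, sumR k h <= Rmax 0 (INR k - (c - r)) /\ sumR k h <= 2 * r + 1).
  { induction k as [|k [IH1 IH2]].
    - simpl. split; [apply Rmax_l|lra].
    - rewrite S_INR. simpl. unfold h at 2 4. destruct (Rle_dec (Rabs (INR k - c)) r) as [Hk|Hk].
      + assert (H1 : c - r <= INR k <= c + r).
        { revert Hk. unfold Rabs. destruct Rcase_abs; lra. }
        rewrite Rmax_right in IH1 by lra. rewrite Rmax_right by lra. lra.
      + rewrite Rplus_0_r. split; auto. eapply Rle_trans; [exact IH1|].
        unfold Rmax. repeat destruct Rle_dec; lra. }
  eapply Rle_trans; [apply sumR_Rabs|].
  eapply Rle_trans; [|apply Rmult_le_compat_r; [exact Hb|apply (Hh m)]].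
  rewrite Rmult_comm, <- sumR_scal. apply sumR_le. intros a Ha. unfold h.
  destruct (Rle_dec (Rabs (INR a - c)) r) as [Hk|Hk].
  - rewrite Rmult_1_r. auto.
  - rewrite H0 by (auto; lra). rewrite Rabs_R0. lra.
Qed.

(** In each coordinate at most [2 * (r * INR N) + 1] nodes lie within [r] of the centre; the bound
    iterates over the coordinates. *)
Lemma gsum_bound n N y r b : 0 <= r -> 0 <= b -> (0 < N)%nat -> forall f,
  (forall x, in_Rn n x -> Rabs (f x) <= b) ->
  (forall x, in_Rn n x -> r < distn n x y -> f x = 0) ->
  Rabs (gsum n N f) <= (2 * (r * INR N) + 1) ^ n * b.
Proof.
  intros Hr Hb HN. assert (HN' : 0 < INR N) by (apply lt_0_INR; auto).
  assert (HrN : 0 <= r * INR N) by (apply Rmult_le_pos; lra).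
  induction n as [|n IH]; intros f Hf H0.
  - simpl. rewrite Rmult_1_l. apply Hf. intros i _; auto.
  - rewrite gsum_S. simpl pow. rewrite Rmult_assoc.
    apply (sumR_window _ _ (INR (N * N) + y n * INR N) (r * INR N)); auto.
    + apply Rmult_le_pos; auto. apply pow_le. lra.
    + intros a Ha. apply IH.
      * intros x Hx. apply Hf. apply in_Rn_upd_last; auto.
      * intros x Hx Hd. apply H0; [apply in_Rn_upd_last; auto|].
        eapply Rlt_le_trans; [exact Hd|]. apply distn_lub; [apply distn_nonneg|].
        intros i Hi. assert (H1 := distn_coord (S n) (upd x n (node N a)) y i ltac:(lia)).
        rewrite upd_neq in H1 by lia. auto.
    + intros a Ha Hfar. rewrite <- (gsum_zero n N). apply gsum_ext. intros x Hx.
      apply H0; [apply in_Rn_upd_last; auto|].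
      eapply Rlt_le_trans; [|apply (distn_coord (S n) _ y n); lia]. rewrite upd_eq.
      apply Rmult_lt_reg_r with (INR N); auto.
      replace (Rabs (node N a - y n) * INR N) with (Rabs (INR a - (INR (N * N) + y n * INR N))); auto.
      transitivity (Rabs (node N a - y n) * Rabs (INR N)); [|rewrite (Rabs_pos_eq (INR N)); lra].
      rewrite <- Rabs_mult. f_equal. unfold node. field. lra.
Qed.

Lemma riemann_bound n N y r b f : 0 <= r -> 0 <= b -> (0 < N)%nat ->
  (forall x, in_Rn n x -> Rabs (f x) <= b) ->
  (forall x, in_Rn n x -> r < distn n x y -> f x = 0) ->
  Rabs (riemann n f N) <= (2 * r + / INR N) ^ n * b.
Proof.
  intros Hr Hb HN Hf H0. assert (HN' : 0 < INR N) by (apply lt_0_INR; auto).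
  unfold riemann. rewrite Rabs_mult, (Rabs_pos_eq ((/ INR N) ^ n)).
  2:{ apply pow_le. left. apply Rinv_0_lt_compat; auto. }
  replace ((2 * r + / INR N) ^ n * b) with ((2 * (r * INR N) + 1) ^ n * b * (/ INR N) ^ n).
  - apply Rmult_le_compat_r; [apply pow_le; left; apply Rinv_0_lt_compat; auto|].
    apply (gsum_bound n N y); auto.
  - replace (2 * r + / INR N) with ((2 * (r * INR N) + 1) * / INR N) by (field; lra).
    rewrite Rpow_mult_distr. ring.
Qed.

Lemma Rinv_INR_le1 N : (0 < N)%nat -> / INR N <= 1.
Proof.
  intros HN. rewrite <- Rinv_1. apply Rinv_le_contravar; [lra|]. apply (le_INR 1); lia.
Qed.

Lemma riemann_bound_unif n N y r b f : 0 <= r -> 0 <= b -> (0 < N)%nat ->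
  (forall x, in_Rn n x -> Rabs (f x) <= b) ->
  (forall x, in_Rn n x -> r < distn n x y -> f x = 0) ->
  Rabs (riemann n f N) <= (2 * r + 1) ^ n * b.
Proof.
  intros Hr Hb HN Hf H0. eapply Rle_trans; [apply (riemann_bound n N y r b); auto|].
  apply Rmult_le_compat_r; auto. apply pow_incr. assert (H := Rinv_INR_le1 N HN).
  assert (0 < / INR N) by (apply Rinv_0_lt_compat, lt_0_INR; auto). lra.
Qed.

(** A shift by one node trades the layer at -N for the layer at N, and both lie outside the support
    of [F]. *)
Lemma gsum_shift n N i r : (i < n)%nat -> r + 1 < INR N -> forall F,
  (forall x, in_Rn n x -> r < normn n x -> F x = 0) ->
  gsum n N (fun x => F (upd x i (x i + / INR N))) = gsum n N F.
Proof.
  intros Hi HrN.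
  destruct (Nat.eq_0_gt_0_cases N) as [->|HNp].
  { destruct n; [lia|]. reflexivity. }
  assert (HN : 0 < INR N) by (apply lt_0_INR; auto).
  revert Hi. induction n as [|n IH]; intros Hi F H0; [lia|].
  rewrite !gsum_S.
  destruct (Nat.eq_dec i n) as [->|Hne].
  - rewrite sumR_ext with (g := fun a => gsum n N (fun x => F (upd x n (node N (a + 1))))).
    + rewrite (sumR_shift 1 _ (fun a => gsum n N (fun x => F (upd x n (node N a))))).
      rewrite Nat.add_1_r. change (sumR 1 ?f) with (0 + f 0%nat).
      set (m := (2 * N * N)%nat). change (sumR (S m) ?f) with (sumR m f + f m). cbv beta.
      assert (Hz : forall a, r < Rabs (node N a) -> gsum n N (fun x => F (upd x n (node N a))) = 0).
      { intros a Ha. rewrite <- (gsum_zero n N). apply gsum_ext. intros x Hx.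
        apply H0; [apply in_Rn_upd_last; auto|]. eapply Rlt_le_trans; [exact Ha|].
        rewrite <- (upd_eq x n (node N a)) at 1. apply normn_coord. lia. }
      rewrite (Hz 0%nat), (Hz m).
      * ring.
      * replace (node N m) with (INR N).
        -- rewrite Rabs_pos_eq; lra.
        -- unfold node, m. rewrite !mult_INR. simpl (INR 2). field. lra.
      * replace (node N 0) with (- INR N).
        -- rewrite Rabs_Ropp, Rabs_pos_eq; lra.
        -- unfold node. rewrite mult_INR. simpl (INR 0). field. lra.
    + intros a _. apply gsum_ext. intros x Hx. rewrite upd_eq, upd_upd. f_equal. f_equal.
      unfold node. rewrite plus_INR. simpl (INR 1). field. lra.
  - apply sumR_ext. intros a _.
    rewrite <- (IH ltac:(lia) (fun x => F (upd x n (node N a)))).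
    + apply gsum_ext. intros x Hx. rewrite upd_neq by auto. f_equal. apply upd_comm. auto.
    + intros x Hx Hr. apply H0; [apply in_Rn_upd_last; auto|].
      eapply Rlt_le_trans; [exact Hr|]. apply normn_lub; [apply normn_nonneg|].
      intros j Hj. assert (H1 := normn_coord (S n) (upd x n (node N a)) j ltac:(lia)).
      rewrite upd_neq in H1 by lia. auto.
Qed.

Lemma riemann_plus n N f g : riemann n (fun x => f x + g x) N = riemann n f N + riemann n g N.
Proof. unfold riemann. rewrite gsum_plus. ring. Qed.

Lemma riemann_scal n N c f : riemann n (fun x => c * f x) N = c * riemann n f N.
Proof. unfold riemann. rewrite gsum_scal. ring. Qed.

Lemma riemann_ext n N f g : (forall x, in_Rn n x -> f x = g x) -> riemann n f N = riemann n g N.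
Proof. intros H. unfold riemann. rewrite (gsum_ext n N f g); auto. Qed.

Lemma riemann_sumR n N m (f : nat -> pt -> R) :
  riemann n (fun x => sumR m (fun j => f j x)) N = sumR m (fun j => riemann n (f j) N).
Proof.
  unfold riemann. rewrite gsum_sumR, Rmult_comm, <- sumR_scal. apply sumR_ext. intros; ring.
Qed.

Lemma exists_INR_gt x : exists m, forall k, (m <= k)%nat -> x < INR k.
Proof.
  destruct (archimed (Rmax 0 x)) as [H _]. set (z := up (Rmax 0 x)) in *.
  assert (Hz : (0 <= z)%Z).
  { apply le_IZR. assert (H1 := Rmax_l 0 x). lra. }
  exists (Z.to_nat z). intros k Hk. apply le_INR in Hk.
  rewrite INR_IZR_INZ, Z2Nat.id in Hk by auto. assert (H1 := Rmax_r 0 x). lra.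
Qed.

(* Summation by parts on the grid: the forward difference of a compactly supported function has
   vanishing sum. *)
Lemma riemann_derivative_cv n i r F D : (i < n)%nat -> 0 <= r ->
  (forall x, in_Rn n x -> r < normn n x -> F x = 0 /\ D x = 0) ->
  (forall eps, 0 < eps -> exists d, 0 < d /\ forall x h, in_Rn n x -> Rabs h < d ->
     Rabs (F (upd x i (x i + h)) - F x - h * D x) <= eps * Rabs h) ->
  integral_is n D 0.
Proof.
  intros Hi Hr H0 Hd eps Heps.
  (* Radius [r + 1] because the function is also evaluated after a shift by the mesh, which is at
     most 1. *)
  set (c := (2 * (r + 1) + 1) ^ n).
  assert (Hc : 0 < c) by (apply pow_lt; lra).
  destruct (Hd (eps / (2 * c))) as [d [Hdp Hq]]; [apply Rdiv_lt_0_compat; lra|].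
  destruct (exists_INR_gt (Rmax (r + 1) (/ d))) as [m Hm].
  exists m. intros k Hk. unfold Rdist. rewrite Rminus_0_r.
  set (N := S k). assert (HN := Hm N ltac:(unfold N; lia)).
  assert (HNp : (0 < N)%nat) by (unfold N; lia).
  assert (HN' : 0 < INR N) by (apply lt_0_INR; auto).
  assert (HN1 := Rmax_l (r + 1) (/ d)). assert (HN2 := Rmax_r (r + 1) (/ d)).
  assert (Hsd : / INR N < d).
  { rewrite <- (Rinv_inv d). apply Rinv_lt_contravar; [|lra].
    apply Rmult_lt_0_compat; auto. apply Rinv_0_lt_compat; auto. }
  assert (Hsp : 0 < / INR N) by (apply Rinv_0_lt_compat; auto).
  (* [E] is the first-order remainder. The forward differences of [F] sum to zero, so the sum of [D]
     is -N times the sum of [E]; the factor N is absorbed since [E] is small relative to 1/N. *)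
  set (E := fun x => F (upd x i (x i + / INR N)) - F x - / INR N * D x).
  assert (HE : riemann n D N = - INR N * riemann n E N).
  { unfold E. transitivity (- INR N * (riemann n (fun x => F (upd x i (x i + / INR N))) N
       + (-1) * riemann n F N + (- / INR N) * riemann n D N)).
    - unfold riemann. rewrite (gsum_shift n N i r); [field; lra|auto|lra|].
      intros x Hx Hxr. apply (H0 x Hx Hxr).
    - rewrite <- !riemann_scal, <- !riemann_plus, <- !riemann_scal. apply riemann_ext. intros; ring. }
  rewrite HE, Rabs_mult, Rabs_Ropp, Rabs_pos_eq by lra.
  assert (HB : Rabs (riemann n E N) <= c * (eps / (2 * c) * / INR N)).
  { apply (riemann_bound_unif n N (fun _ => 0)); auto; try lra.
    - apply Rmult_le_pos; [|lra]. left. apply Rdiv_lt_0_compat; lra.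
    - intros x Hx. assert (Ha : Rabs (/ INR N) = / INR N) by (apply Rabs_pos_eq; lra).
      rewrite <- Ha. apply Hq; auto. lra.
    - intros x Hx Hxr.
      assert (Ex : distn n x (fun _ => 0) = normn n x).
      { unfold distn. f_equal. extensionality j. ring. }
      rewrite Ex in Hxr. destruct (H0 x Hx) as [E1 E2]; [lra|].
      destruct (H0 (upd x i (x i + / INR N))) as [E3 _].
      + apply in_Rn_upd; auto.
      + assert (H1 := distn_triang n x (upd x i (x i + / INR N)) (fun _ => 0)).
        assert (H2 : distn n x (upd x i (x i + / INR N)) <= / INR N).
        { apply distn_lub; [lra|]. intros j Hj. destruct (Nat.eq_dec j i) as [->|Hji].
          - rewrite upd_eq. replace (x i - (x i + / INR N)) with (- / INR N) by ring.
            rewrite Rabs_Ropp, Rabs_pos_eq; lra.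
          - rewrite upd_neq by auto. rewrite Rminus_diag, Rabs_R0. lra. }
        assert (H3 := Rinv_INR_le1 N HNp).
        rewrite Ex in H1. unfold distn at 2 in H1.
        replace (fun i0 => upd x i (x i + / INR N) i0 - 0) with (upd x i (x i + / INR N)) in H1
          by (extensionality j; ring).
        lra.
      + unfold E. rewrite E1, E2, E3. ring. }
  apply Rmult_le_compat_l with (r := INR N) in HB; [|lra].
  eapply Rle_lt_trans; [exact HB|].
  replace (INR N * (c * (eps / (2 * c) * / INR N))) with (eps / 2) by (field; lra). lra.
Qed.

(** * Strict differentiability *)

(* Strict Frechet differentiability: both points may move, which makes uniformity on compact sets
   immediate and spares any continuity statement for the derivative. *)
Definition sdiff (n : nat) (f : pt -> R) (x : pt) (L : nat -> R) : Prop :=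
  forall eps, 0 < eps -> exists d, 0 < d /\
    forall a b, in_Rn n a -> in_Rn n b -> distn n a x < d -> distn n b x < d ->
      Rabs (f a - f b - sumR n (fun i => L i * (a i - b i))) <= eps * distn n a b.

Lemma sdiff_const n x c : sdiff n (fun _ => c) x (fun _ => 0).
Proof.
  intros eps Heps. exists 1. split; [lra|]. intros a b _ _ _ _.
  rewrite sumR_0 by (intros; ring). replace (c - c - 0) with 0 by ring. rewrite Rabs_R0.
  apply Rmult_le_pos; [lra|apply distn_nonneg].
Qed.

Lemma sdiff_near n f g x L r : 0 < r ->
  (forall y, in_Rn n y -> distn n y x < r -> f y = g y) -> sdiff n g x L -> sdiff n f x L.
Proof.
  intros Hr Hfg Hg eps Heps. destruct (Hg eps Heps) as [d [Hd H]].
  exists (Rmin d r). split; [apply Rmin_pos; auto|]. intros a b Ha Hb Hax Hbx.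
  assert (H1 := Rmin_l d r). assert (H2 := Rmin_r d r).
  rewrite !Hfg by (auto; lra). apply H; auto; lra.
Qed.

Lemma sdiff_eq n f x L L' : (forall i, (i < n)%nat -> L i = L' i) -> sdiff n f x L -> sdiff n f x L'.
Proof.
  intros HL H eps Heps. destruct (H eps Heps) as [d [Hd H1]]. exists d. split; auto.
  intros a b Ha Hb Hax Hbx. rewrite <- (sumR_ext n (fun i => L i * (a i - b i))); auto.
  intros i Hi. rewrite HL; auto.
Qed.

Lemma sdiff_plus n f g x L M : sdiff n f x L -> sdiff n g x M ->
  sdiff n (fun y => f y + g y) x (fun i => L i + M i).
Proof.
  intros Hf Hg eps Heps.
  destruct (Hf (eps / 2) ltac:(lra)) as [d1 [Hd1 H1]].
  destruct (Hg (eps / 2) ltac:(lra)) as [d2 [Hd2 H2]].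
  exists (Rmin d1 d2). split; [apply Rmin_pos; auto|]. intros a b Ha Hb Hax Hbx.
  assert (H3 := Rmin_l d1 d2). assert (H4 := Rmin_r d1 d2).
  specialize (H1 a b Ha Hb ltac:(lra) ltac:(lra)). specialize (H2 a b Ha Hb ltac:(lra) ltac:(lra)).
  rewrite (sumR_ext n _ (fun i => L i * (a i - b i) + M i * (a i - b i))) by (intros; ring).
  rewrite sumR_plus. set (s1 := sumR n (fun i => L i * _)) in *. set (s2 := sumR n (fun i => M i * _)) in *.
  replace (f a + g a - (f b + g b) - (s1 + s2)) with ((f a - f b - s1) + (g a - g b - s2)) by ring.
  eapply Rle_trans; [apply Rabs_triang|]. lra.
Qed.

Lemma sdiff_scal n f x L c : sdiff n f x L -> sdiff n (fun y => c * f y) x (fun i => c * L i).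
Proof.
  intros Hf eps Heps. assert (Hc := Rabs_pos c).
  destruct (Hf (eps / (1 + Rabs c))) as [d [Hd H]]; [apply Rdiv_lt_0_compat; lra|].
  exists d. split; auto. intros a b Ha Hb Hax Hbx. specialize (H a b Ha Hb Hax Hbx).
  rewrite (sumR_ext n _ (fun i => c * (L i * (a i - b i)))) by (intros; ring). rewrite sumR_scal.
  set (s := sumR n _) in *.
  replace (c * f a - c * f b - c * s) with (c * (f a - f b - s)) by ring. rewrite Rabs_mult.
  eapply Rle_trans; [apply Rmult_le_compat_l; [auto|exact H]|].
  rewrite <- Rmult_assoc. apply Rmult_le_compat_r; [apply distn_nonneg|].
  replace eps with ((1 + Rabs c) * (eps / (1 + Rabs c))) at 2 by (field; lra).
  apply Rmult_le_compat_r; [|lra]. left. apply Rdiv_lt_0_compat; lra.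
Qed.

Lemma sdiff_sumR n m (f : nat -> pt -> R) x (L : nat -> nat -> R) :
  (forall j, (j < m)%nat -> sdiff n (f j) x (L j)) ->
  sdiff n (fun y => sumR m (fun j => f j y)) x (fun i => sumR m (fun j => L j i)).
Proof.
  induction m as [|m IH]; intros H; simpl; [apply sdiff_const|].
  apply sdiff_plus; [apply IH; intros; apply H|apply H]; lia.
Qed.

Lemma sdiff_lipschitz n f x L : sdiff n f x L -> exists C d, 0 <= C /\ 0 < d /\
  forall a b, in_Rn n a -> in_Rn n b -> distn n a x < d -> distn n b x < d ->
    Rabs (f a - f b) <= C * distn n a b.
Proof.
  intros Hf. destruct (Hf 1 ltac:(lra)) as [d [Hd H]].
  assert (HS : 0 <= sumR n (fun i => Rabs (L i))).
  { rewrite <- (sumR_0 n (fun _ => 0)) by auto. apply sumR_le. intros; apply Rabs_pos. }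
  exists (1 + sumR n (fun i => Rabs (L i))), d.
  split; [lra|]. split; auto. intros a b Ha Hb Hax Hbx. specialize (H a b Ha Hb Hax Hbx).
  set (s := sumR n _) in H. replace (f a - f b) with ((f a - f b - s) + s) by ring.
  eapply Rle_trans; [apply Rabs_triang|]. rewrite Rmult_plus_distr_r.
  apply Rplus_le_compat; auto. eapply Rle_trans; [apply sumR_Rabs|].
  rewrite Rmult_comm, <- sumR_scal. apply sumR_le. intros i Hi. rewrite Rabs_mult, Rmult_comm.
  apply Rmult_le_compat_r; [apply Rabs_pos|]. apply distn_coord; auto.
Qed.

Lemma sdiff_mult n f g x L M : in_Rn n x -> sdiff n f x L -> sdiff n g x M ->
  sdiff n (fun y => f y * g y) x (fun i => f x * M i + g x * L i).
Proof.
  intros Hx Hf Hg eps Heps.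
  destruct (sdiff_lipschitz n f x L Hf) as (C1 & e1 & HC1 & He1 & Hl1).
  destruct (sdiff_lipschitz n g x M Hg) as (C2 & e2 & HC2 & He2 & Hl2).
  assert (Hfx := Rabs_pos (f x)). assert (Hgx := Rabs_pos (g x)).
  assert (HCC : 0 <= C1 * C2) by (apply Rmult_le_pos; auto).
  set (K := 1 + Rabs (f x) + Rabs (g x) + 2 * (C1 * C2)).
  assert (HK : 0 < K) by (unfold K; lra).
  assert (HeK : 0 < eps / K) by (apply Rdiv_lt_0_compat; auto).
  destruct (Hf (eps / K) HeK) as [d1 [Hd1 H1]].
  destruct (Hg (eps / K) HeK) as [d2 [Hd2 H2]].
  set (d := Rmin (Rmin d1 d2) (Rmin (Rmin e1 e2) (eps / K))).
  assert (Hd : 0 < d) by (repeat apply Rmin_pos; auto).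
  assert (Hdd : d <= d1 /\ d <= d2 /\ d <= e1 /\ d <= e2 /\ d <= eps / K).
  { unfold d. assert (A1 := Rmin_l (Rmin d1 d2) (Rmin (Rmin e1 e2) (eps / K))).
    assert (A2 := Rmin_r (Rmin d1 d2) (Rmin (Rmin e1 e2) (eps / K))).
    assert (A3 := Rmin_l d1 d2). assert (A4 := Rmin_r d1 d2).
    assert (A5 := Rmin_l (Rmin e1 e2) (eps / K)). assert (A6 := Rmin_r (Rmin e1 e2) (eps / K)).
    assert (A7 := Rmin_l e1 e2). assert (A8 := Rmin_r e1 e2). lra. }
  exists d. split; auto. intros a b Ha Hb Hax Hbx.
  specialize (H1 a b Ha Hb ltac:(lra) ltac:(lra)). specialize (H2 a b Ha Hb ltac:(lra) ltac:(lra)).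
  assert (Hxx := distn_refl n x).
  assert (B1 := Hl1 a x Ha Hx ltac:(lra) ltac:(lra)).
  assert (B2 := Hl2 b x Hb Hx ltac:(lra) ltac:(lra)).
  assert (B3 := Hl1 a b Ha Hb ltac:(lra) ltac:(lra)).
  assert (B4 := Hl2 a b Ha Hb ltac:(lra) ltac:(lra)).
  rewrite (sumR_ext n _ (fun i => f x * (M i * (a i - b i)) + g x * (L i * (a i - b i)))) by (intros; ring).
  rewrite sumR_plus, !sumR_scal. set (s1 := sumR n (fun i => L i * _)) in *. set (s2 := sumR n (fun i => M i * _)) in *.
  replace (f a * g a - f b * g b - (f x * s2 + g x * s1)) with
    ((f x * (g a - g b - s2) + g x * (f a - f b - s1)) +
     ((f a - f x) * (g a - g b) + (g b - g x) * (f a - f b))) by ring.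
  set (D := distn n a b) in *. assert (HD : 0 <= D) by apply distn_nonneg.
  assert (T1 : Rabs (f x * (g a - g b - s2)) <= Rabs (f x) * (eps / K * D)).
  { rewrite Rabs_mult. apply Rmult_le_compat_l; auto. }
  assert (T2 : Rabs (g x * (f a - f b - s1)) <= Rabs (g x) * (eps / K * D)).
  { rewrite Rabs_mult. apply Rmult_le_compat_l; auto. }
  assert (T3 : Rabs ((f a - f x) * (g a - g b)) <= (C1 * (eps / K)) * (C2 * D)).
  { rewrite Rabs_mult. apply Rmult_le_compat; auto using Rabs_pos.
    eapply Rle_trans; [exact B1|]. apply Rmult_le_compat_l; lra. }
  assert (T4 : Rabs ((g b - g x) * (f a - f b)) <= (C2 * (eps / K)) * (C1 * D)).
  { rewrite Rabs_mult. apply Rmult_le_compat; auto using Rabs_pos.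
    eapply Rle_trans; [exact B2|]. apply Rmult_le_compat_l; lra. }
  eapply Rle_trans; [apply Rabs_triang|].
  eapply Rle_trans; [apply Rplus_le_compat; apply Rabs_triang|].
  apply Rle_trans with ((K - 1) * (eps / K * D)); [unfold K at 1; lra|].
  assert (HeD : 0 <= eps / K * D) by (apply Rmult_le_pos; lra).
  apply Rle_trans with (K * (eps / K * D)); [lra|]. right. field. lra.
Qed.

Lemma sdiff_comp n k f (v : pt -> pt) x L (M : nat -> nat -> R) r :
  in_Rn n x -> 0 < r -> (forall y, in_Rn n y -> distn n y x < r -> in_Rn k (v y)) ->
  sdiff k f (v x) L -> (forall j, (j < k)%nat -> sdiff n (fun y => v y j) x (M j)) ->
  sdiff n (fun y => f (v y)) x (fun i => sumR k (fun j => L j * M j i)).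
Proof.
  intros Hx Hr Hv Hf HM.
  assert (Hlip : exists C e, 0 <= C /\ 0 < e /\
    forall a b, in_Rn n a -> in_Rn n b -> distn n a x < e -> distn n b x < e ->
      distn k (v a) (v b) <= C * distn n a b).
  { clear Hv Hf. induction k as [|k IH].
    - exists 0, 1. split; [lra|]. split; [lra|]. intros. unfold distn at 1. simpl. lra.
    - destruct IH as (C & e & HC & He & H); [intros; apply HM; lia|].
      destruct (sdiff_lipschitz n _ x _ (HM k ltac:(lia))) as (C' & e' & HC' & He' & H').
      exists (C + C'), (Rmin e e'). split; [lra|]. split; [apply Rmin_pos; auto|].
      intros a b Ha Hb Hax Hbx. assert (A1 := Rmin_l e e'). assert (A2 := Rmin_r e e').
      specialize (H a b Ha Hb ltac:(lra) ltac:(lra)). specialize (H' a b Ha Hb ltac:(lra) ltac:(lra)).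
      assert (P1 : 0 <= C * distn n a b) by (apply Rmult_le_pos; auto using distn_nonneg).
      assert (P2 : 0 <= C' * distn n a b) by (apply Rmult_le_pos; auto using distn_nonneg).
      unfold distn at 1. simpl. apply Rmax_lub; [unfold distn in H at 1|]; lra. }
  destruct Hlip as (C & e & HC & He & Hlip).
  intros eps Heps.
  destruct (Hf (eps / (2 * (1 + C)))) as [d1 [Hd1 H1]]; [apply Rdiv_lt_0_compat; lra|].
  (* The linear part of [f] composed with [v] falls under the rules for sums and multiples; what
     remains is the remainder of [f] at [v x], controlled by the Lipschitz bound on [v]. *)
  assert (Hs : sdiff n (fun y => sumR k (fun j => L j * v y j)) x (fun i => sumR k (fun j => L j * M j i))).
  { apply (sdiff_sumR n k (fun j y => L j * v y j) x (fun j i => L j * M j i)).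
    intros j Hj. apply sdiff_scal. auto. }
  destruct (Hs (eps / 2) ltac:(lra)) as [d2 [Hd2 H2]].
  assert (Hdp : 0 < d1 / (1 + C)) by (apply Rdiv_lt_0_compat; lra).
  set (d := Rmin (Rmin d2 r) (Rmin e (d1 / (1 + C)))).
  assert (Hd : 0 < d) by (repeat apply Rmin_pos; auto).
  assert (Hdd : d <= d2 /\ d <= r /\ d <= e /\ d <= d1 / (1 + C)).
  { unfold d. assert (A1 := Rmin_l (Rmin d2 r) (Rmin e (d1 / (1 + C)))).
    assert (A2 := Rmin_r (Rmin d2 r) (Rmin e (d1 / (1 + C)))).
    assert (A3 := Rmin_l d2 r). assert (A4 := Rmin_r d2 r).
    assert (A5 := Rmin_l e (d1 / (1 + C))). assert (A6 := Rmin_r e (d1 / (1 + C))). lra. }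
  exists d. split; auto. intros a b Ha Hb Hax Hbx.
  specialize (H2 a b Ha Hb ltac:(lra) ltac:(lra)).
  assert (Hxx := distn_refl n x).
  assert (Hnear : forall y, in_Rn n y -> distn n y x < d -> distn k (v y) (v x) < d1).
  { intros y Hy Hyx. eapply Rle_lt_trans; [apply (Hlip y x); auto; lra|].
    apply Rle_lt_trans with (C * (d1 / (1 + C))); [apply Rmult_le_compat_l; lra|].
    apply Rmult_lt_reg_r with (1 + C); [lra|].
    replace (C * (d1 / (1 + C)) * (1 + C)) with (C * d1) by (field; lra). nra. }
  assert (H3 : Rabs (f (v a) - f (v b) - sumR k (fun j => L j * (v a j - v b j)))
    <= eps / (2 * (1 + C)) * distn k (v a) (v b)).
  { apply H1; auto; apply Hv; auto; lra. }
  assert (H4 := Hlip a b Ha Hb ltac:(lra) ltac:(lra)).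
  rewrite (sumR_ext k (fun j => L j * (v a j - v b j)) (fun j => L j * v a j - L j * v b j)) in H3
    by (intros; ring).
  rewrite sumR_minus in H3.
  set (s1 := sumR k (fun j => L j * v a j)) in *. set (s2 := sumR k (fun j => L j * v b j)) in *.
  set (s3 := sumR n _) in *.
  replace (f (v a) - f (v b) - s3) with ((f (v a) - f (v b) - (s1 - s2)) + (s1 - s2 - s3)) by ring.
  eapply Rle_trans; [apply Rabs_triang|].
  assert (HD := distn_nonneg n a b).
  assert (H5 : eps / (2 * (1 + C)) * distn k (v a) (v b) <= eps / 2 * distn n a b); [|lra].
  apply Rle_trans with (eps / (2 * (1 + C)) * (C * distn n a b)).
  - apply Rmult_le_compat_l; auto. left. apply Rdiv_lt_0_compat; lra.
  - apply Rle_trans with (eps / (2 * (1 + C)) * ((1 + C) * distn n a b)).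
    + apply Rmult_le_compat_l; [left; apply Rdiv_lt_0_compat; lra|]. nra.
    + right. field. lra.
Qed.

(* Unspecified where [f] has no partial derivative. *)
Definition pd (f : pt -> R) (j : nat) (x : pt) : R := epsilon (inhabits 0) (has_partial f j x).

Lemma has_partial_unique f j x L M : has_partial f j x L -> has_partial f j x M -> L = M.
Proof. apply uniqueness_limite. Qed.

Lemma pd_eq f j x L : has_partial f j x L -> pd f j x = L.
Proof.
  intros H. apply (has_partial_unique f j x); auto.
  unfold pd. apply epsilon_spec. exists L; auto.
Qed.

(** The derivatives in [Cm] are existential witnesses; uniqueness identifies them with [pd] on [D],
    which provides one canonical gradient to compute with. *)
Lemma Cm1_partial n D f : Cm n D 1 f -> forall j, (j < n)%nat ->
  (forall x, D x -> has_partial f j x (pd f j x)) /\ cont_on n D (pd f j).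
Proof.
  intros [_ [Df H]] j Hj. destruct (H j Hj) as [H1 H2].
  assert (E : forall x, D x -> pd f j x = Df j x) by (intros; apply pd_eq; auto).
  split.
  - intros x Hx. rewrite E; auto.
  - intros x Hx eps Heps. destruct (H2 x Hx eps Heps) as [d [Hd H3]]. exists d. split; auto.
    intros y Hy Hyx. rewrite !E; auto.
Qed.

Lemma Cm_pred n D m : forall f, Cm n D (S m) f -> Cm n D m f.
Proof.
  induction m as [|m IH]; intros f [Hc [Df H]]; simpl; auto.
  split; auto. exists Df. intros j Hj. destruct (H j Hj). split; auto.
Qed.

Lemma finite_radius m (P : nat -> R -> Prop) :
  (forall j d d', 0 < d' <= d -> P j d -> P j d') ->
  (forall j, (j < m)%nat -> exists d, 0 < d /\ P j d) ->
  exists d, 0 < d /\ forall j, (j < m)%nat -> P j d.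
Proof.
  intros Hmono. induction m as [|m IH]; intros H.
  - exists 1. split; [lra|]. intros; lia.
  - destruct IH as [d [Hd Hj]]; [intros; apply H; lia|].
    destruct (H m ltac:(lia)) as [d' [Hd' Hm]]. exists (Rmin d d'). split; [apply Rmin_pos; auto|].
    assert (A1 := Rmin_l d d'). assert (A2 := Rmin_r d d'). assert (A3 := Rmin_pos d d' Hd Hd').
    intros j Hjm. destruct (Nat.eq_dec j m) as [->|Hne].
    + apply Hmono with d'; auto.
    + apply Hmono with d; auto. apply Hj. lia.
Qed.

Lemma sdiff_of_C1 n D f x : open_in n D -> D x -> Cm n D 1 f -> sdiff n f x (fun j => pd f j x).
Proof.
  intros HD Hx Hf eps Heps.
  assert (Hn : 0 < INR n + 1) by (assert (H := pos_INR n); lra).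
  set (e := eps / (INR n + 1)). assert (He : 0 < e) by (apply Rdiv_lt_0_compat; auto).
  destruct (HD x Hx) as [Hxn [r [Hr Hball]]].
  destruct (finite_radius n (fun j d => forall z, D z -> distn n x z < d -> Rabs (pd f j z - pd f j x) < e))
    as [d [Hd H]].
  - intros j d d' Hd H z Hz Hzx. apply H; auto; lra.
  - intros j Hj. destruct (Cm1_partial n D f Hf j Hj) as [_ Hc]. apply (Hc x Hx e He).
  - set (rho := Rmin (d / 2) (r / 2)). assert (Hrho : 0 < rho) by (apply Rmin_pos; lra).
    assert (A1 := Rmin_l (d / 2) (r / 2)). assert (A2 := Rmin_r (d / 2) (r / 2)). fold rho in A1, A2.
    exists rho. split; auto. intros a b Ha Hb Hax Hbx.
    eapply Rle_trans.
    + apply (mean_value n f (pd f) (fun j => pd f j x) e rho x a b); auto; try lra.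
      intros z j Hj Hz Hzx. rewrite distn_sym in Hzx.
      assert (HDz : D z) by (apply Hball; auto; lra).
      split; [apply (Cm1_partial n D f Hf j Hj); auto|]. left. apply H; auto. lra.
    + apply Rmult_le_compat_r; [apply distn_nonneg|]. unfold e.
      apply Rmult_le_reg_r with (INR n + 1); auto.
      replace (INR n * (eps / (INR n + 1)) * (INR n + 1)) with (INR n * eps) by (field; lra). nra.
Qed.

Lemma distn_upd n x i h : distn n (upd x i (x i + h)) x <= Rabs h.
Proof.
  apply distn_lub; [apply Rabs_pos|]. intros j Hj. destruct (Nat.eq_dec j i) as [->|Hne].
  - rewrite upd_eq. replace (x i + h - x i) with h by ring. lra.
  - rewrite upd_neq by auto. rewrite Rminus_diag, Rabs_R0. apply Rabs_pos.
Qed.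

Lemma sumR_upd n L x i h : (i < n)%nat ->
  sumR n (fun j => L j * (upd x i (x i + h) j - x j)) = h * L i.
Proof.
  intros Hi. rewrite (sumR_single n i); auto.
  - rewrite upd_eq. ring.
  - intros j _ Hne. rewrite upd_neq by auto. ring.
Qed.

Lemma sdiff_partial n f x L i eps : sdiff n f x L -> (i < n)%nat -> in_Rn n x -> 0 < eps ->
  exists d, 0 < d /\ forall y h, in_Rn n y -> distn n y x < d -> Rabs h < d ->
    Rabs (f (upd y i (y i + h)) - f y - h * L i) <= eps * Rabs h.
Proof.
  intros Hf Hi Hx Heps. destruct (Hf eps Heps) as [d [Hd H]].
  exists (d / 2). split; [lra|]. intros y h Hy Hyx Hh.
  assert (H1 := distn_upd n y i h).
  assert (H2 := distn_triang n (upd y i (y i + h)) y x).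
  specialize (H (upd y i (y i + h)) y (in_Rn_upd n y i _ Hi Hy) Hy ltac:(lra) ltac:(lra)).
  rewrite sumR_upd in H by auto. eapply Rle_trans; [exact H|]. apply Rmult_le_compat_l; lra.
Qed.

(** Strict differentiability at every point makes the derivative continuous, so by compactness the
    pointwise expansion becomes the uniform one required by [riemann_derivative_cv]. Outside the
    cube of radius [r + 1] all terms of the expansion vanish. *)
Lemma riemann_divergence_cv n i r F (L : pt -> nat -> R) : (i < n)%nat -> 0 <= r ->
  (forall x, in_Rn n x -> r < normn n x -> F x = 0 /\ L x i = 0) ->
  (forall x, in_Rn n x -> sdiff n F x (L x)) ->
  integral_is n (fun x => L x i) 0.
Proof.
  intros Hi Hr H0 HF. apply (riemann_derivative_cv n i r F); auto.
  intros eps Heps.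
  destruct (compact_uniform n _ (fun d x => forall h, Rabs h < d ->
      Rabs (F (upd x i (x i + h)) - F x - h * L x i) <= eps * Rabs h)
    (compact_cube n (fun _ => 0) (r + 1) ltac:(lra))) as [d [Hd H]].
  - intros d d' x Hd H h Hh. apply H. lra.
  - intros x [Hx _].
    destruct (sdiff_partial n F x (L x) i (eps / 4) (HF x Hx) Hi Hx ltac:(lra)) as [d [Hd H]].
    exists d. split; auto. intros y [Hy _] Hyx.
    (* The increment of [F] at [y] along one small step [h] is expanded once with the derivative at
       [x] and once with that at [y]; subtracting compares the two derivatives. *)
    assert (HL : Rabs (L x i - L y i) <= eps / 2).
    { destruct (sdiff_partial n F y (L y) i (eps / 4) (HF y Hy) Hi Hy ltac:(lra)) as [d' [Hd' H']].
      set (h := Rmin d d' / 2).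
      assert (Hh : 0 < h) by (unfold h; assert (0 < Rmin d d') by (apply Rmin_pos; auto); lra).
      assert (A1 := Rmin_l d d'). assert (A2 := Rmin_r d d').
      assert (Hah : Rabs h = h) by (apply Rabs_pos_eq; lra).
      specialize (H y h Hy Hyx ltac:(rewrite Hah; unfold h in *; lra)).
      specialize (H' y h Hy ltac:(rewrite distn_refl; auto) ltac:(rewrite Hah; unfold h in *; lra)).
      rewrite Hah in *. apply Rmult_le_reg_l with h; auto.
      rewrite <- Hah at 1. rewrite <- Rabs_mult.
      replace (h * (L x i - L y i)) with
        ((F (upd y i (y i + h)) - F y - h * L y i) - (F (upd y i (y i + h)) - F y - h * L x i)) by ring.
      eapply Rle_trans; [apply Rabs_triang|]. rewrite Rabs_Ropp. lra. }
    intros h Hh. specialize (H y h Hy Hyx Hh).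
    replace (F (upd y i (y i + h)) - F y - h * L y i) with
      ((F (upd y i (y i + h)) - F y - h * L x i) + h * (L x i - L y i)) by ring.
    eapply Rle_trans; [apply Rabs_triang|]. rewrite Rabs_mult.
    assert (H1 := Rabs_pos h). nra.
  - exists (Rmin d 1). split; [apply Rmin_pos; lra|]. intros x h Hx Hh.
    assert (A1 := Rmin_l d 1). assert (A2 := Rmin_r d 1).
    assert (Hn : forall z, distn n z (fun _ => 0) = normn n z).
    { intros z. unfold distn. f_equal. extensionality j. ring. }
    destruct (Rle_or_lt (normn n x) (r + 1)) as [Hxr|Hxr].
    + apply H; [|lra]. split; auto. rewrite Hn. auto.
    + destruct (H0 x Hx ltac:(lra)) as [E1 E2].
      destruct (H0 (upd x i (x i + h))) as [E3 _].
      * apply in_Rn_upd; auto.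
      * assert (H1 := distn_upd n x i h). rewrite distn_sym in H1.
        assert (H2 := distn_triang n x (upd x i (x i + h)) (fun _ => 0)). rewrite !Hn in H2. lra.
      * rewrite E1, E2, E3. replace (0 - 0 - h * 0) with 0 by ring. rewrite Rabs_R0.
        apply Rmult_le_pos; [lra|apply Rabs_pos].
Qed.

Lemma sdiff_has_partial n f x L i : sdiff n f x L -> (i < n)%nat -> in_Rn n x -> has_partial f i x (L i).
Proof.
  intros Hf Hi Hx eps Heps.
  destruct (sdiff_partial n f x L i (eps / 2) Hf Hi Hx ltac:(lra)) as [d [Hd H]].
  exists (mkposreal d Hd). simpl. intros h Hh Hlt.
  specialize (H x h Hx ltac:(rewrite distn_refl; auto) Hlt).
  replace (x i + (0 + h)) with (x i + h) by ring. rewrite (Rplus_0_r (x i)), upd_same.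
  assert (Hp : 0 < Rabs h) by (apply Rabs_pos_lt; auto).
  apply Rle_lt_trans with (eps / 2); [|lra]. apply Rmult_le_reg_r with (Rabs h); auto.
  rewrite <- Rabs_mult.
  replace (((f (upd x i (x i + h)) - f x) / h - L i) * h) with (f (upd x i (x i + h)) - f x - h * L i)
    by (field; auto). exact H.
Qed.

(** * Discrete mollification *)

(** The centre is [y]. The kernel is not normalised: the factor [INR P ^ n] is supplied by [mol]. *)
Definition ker n (eta : R -> R) (P : nat) (y x : pt) : R :=
  tensor n (fun _ t => eta (INR P * t)) (fun i => x i - y i).

Definition dker n (eta eta' : R -> R) (P i : nat) (y x : pt) : R :=
  tensor n (replace_factor (fun _ t => eta (INR P * t)) i (fun t => INR P * eta' (INR P * t)))
    (fun j => x j - y j).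

Lemma dker_tensor n eta eta' P i y x : dker n eta eta' P i y x =
  tensor n (replace_factor (fun j t => eta (INR P * (t - y j))) i (fun t => INR P * eta' (INR P * (t - y i)))) x.
Proof.
  apply prodR_ext. intros j Hj. unfold replace_factor. destruct (Nat.eqb_spec j i); subst; auto.
Qed.

Lemma smooth_rescaled f a b : smooth f -> smooth (fun t => f (a * (t - b))).
Proof.
  intros H. replace (fun t => f (a * (t - b))) with (fun t => f (a * t + - (a * b))).
  - apply smooth_affine; auto.
  - extensionality t. f_equal. ring.
Qed.

Lemma smooth_reflected f a b : smooth f -> smooth (fun t => f (a * (b - t))).
Proof.
  intros H. replace (fun t => f (a * (b - t))) with (fun t => f ((- a) * t + a * b)).
  - apply smooth_affine; auto.
  - extensionality t. f_equal. ring.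
Qed.

Lemma ker_Cinf n eta P y : smooth eta -> Cinf n (in_Rn n) (ker n eta P y).
Proof.
  intros H. apply (tensor_Cinf n (fun i t => eta (INR P * (t - y i)))).
  intros i _. apply smooth_rescaled; auto.
Qed.

Lemma ker_partial n eta eta' P i y x : (forall t, derivable_pt_lim eta t (eta' t)) -> (i < n)%nat ->
  has_partial (ker n eta P y) i x (dker n eta eta' P i y x).
Proof.
  intros Hd Hi. rewrite dker_tensor.
  apply (tensor_partial n (fun j t => eta (INR P * (t - y j))) (fun t => INR P * eta' (INR P * (t - y i)))); auto.
  apply derivable_pt_lim_ext with (f := fun t => eta (INR P * t + - (INR P * y i))).
  { intros z. f_equal. ring. }
  apply derivable_pt_lim_affine.
  replace (INR P * (x i - y i)) with (INR P * x i + - (INR P * y i)) by ring. auto.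
Qed.

Lemma open_Rn n : open_in n (in_Rn n).
Proof. intros x Hx. split; auto. exists 1. split; [lra|]. auto. Qed.

(** The kernel depends only on x - y, so the derivative in the centre is the opposite of [dker]. *)
Lemma ker_sdiff n eta eta' P x y : smooth eta -> (forall t, derivable_pt_lim eta t (eta' t)) -> in_Rn n y ->
  sdiff n (fun y => ker n eta P y x) y (fun i => - dker n eta eta' P i y x).
Proof.
  intros Hs Hd Hy.
  apply sdiff_eq with (L := fun i => pd (fun y => ker n eta P y x) i y).
  - intros i Hi. apply pd_eq.
    replace (- dker n eta eta' P i y x) with
      (tensor n (replace_factor (fun j t => eta (INR P * (x j - t))) i (fun t => - INR P * eta' (INR P * (x i - t)))) y).
    + apply (tensor_partial n (fun j t => eta (INR P * (x j - t))) (fun t => - INR P * eta' (INR P * (x i - t)))); auto.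
      apply derivable_pt_lim_ext with (f := fun t => eta ((- INR P) * t + INR P * x i)).
      { intros z. f_equal. ring. }
      apply derivable_pt_lim_affine.
      replace (INR P * (x i - y i)) with (- INR P * y i + INR P * x i) by ring. auto.
    + unfold dker, tensor, replace_factor.
      rewrite (prodR_ext n _ (fun j => if Nat.eqb j i then - INR P * eta' (INR P * (x i - y i))
         else eta (INR P * (x j - y j)))).
      2:{ intros j Hj. destruct (Nat.eqb_spec j i); subst; auto. }
      rewrite (prodR_ext n (fun j => (if Nat.eqb j i then _ else _) _)
        (fun j => if Nat.eqb j i then INR P * eta' (INR P * (x i - y i))
         else eta (INR P * (x j - y j)))).
      2:{ intros j Hj. destruct (Nat.eqb_spec j i); subst; auto. }
      rewrite (prodR_update n (fun j => eta (INR P * (x j - y j))) i (- INR P * _)) by auto.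
      rewrite (prodR_update n (fun j => eta (INR P * (x j - y j))) i (INR P * _)) by auto. ring.
  - apply (sdiff_of_C1 n (in_Rn n)); auto; [apply open_Rn|].
    apply (tensor_Cinf n (fun i t => eta (INR P * (x i - t)))).
    intros i _. apply smooth_reflected; auto.
Qed.

Lemma distn_gt n x y r : 0 <= r -> r < distn n x y -> exists i, (i < n)%nat /\ r < Rabs (x i - y i).
Proof.
  intros Hr H. apply NNPP. intros Hno. apply (Rlt_not_le _ _ H). apply distn_lub; auto.
  intros i Hi. apply Rnot_lt_le. intros Hl. apply Hno. exists i; auto.
Qed.

Lemma ker_support n eta eta' C P y x : is_bump eta eta' C -> (0 < P)%nat -> / INR P < distn n x y ->
  ker n eta P y x = 0 /\ forall i, dker n eta eta' P i y x = 0.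
Proof.
  intros (_ & _ & _ & _ & Hsupp & _) HP Hxy.
  assert (HP' : 0 < INR P) by (apply lt_0_INR; auto).
  destruct (distn_gt n x y (/ INR P)) as [j [Hj Hd]]; auto.
  { left. apply Rinv_0_lt_compat; auto. }
  assert (H1 : 1 <= Rabs (INR P * (x j - y j))).
  { rewrite Rabs_mult, (Rabs_pos_eq (INR P)) by lra.
    apply Rmult_lt_compat_l with (r := INR P) in Hd; auto. rewrite Rinv_r in Hd by lra. lra. }
  destruct (Hsupp _ H1) as [E1 E2]. split.
  - apply (prodR_0 n _ j); auto.
  - intros i. apply (prodR_0 n _ j); auto. unfold replace_factor.
    destruct (Nat.eqb_spec j i); auto. rewrite E2. ring.
Qed.

Lemma ker_nonneg n eta P y x : (forall t, 0 <= eta t) -> 0 <= ker n eta P y x.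
Proof. intros H. apply prodR_nonneg. auto. Qed.

Lemma dker_bound n eta eta' C P i y x : is_bump eta eta' C -> (i < n)%nat ->
  Rabs (dker n eta eta' P i y x) <= INR P * C ^ S n.
Proof.
  intros (_ & _ & _ & _ & _ & HC & Hb & _) Hi. unfold dker, tensor, replace_factor.
  rewrite (prodR_ext n _ (fun j => if Nat.eqb j i then INR P * eta' (INR P * (x i - y i))
         else eta (INR P * (x j - y j)))).
  2:{ intros j Hj. destruct (Nat.eqb_spec j i); subst; auto. }
  (* The exponent [S n] counts one [C] for the differentiated factor and [n] for the remaining
     product, whose [i]-th factor has become 1. *)
  rewrite (prodR_update n (fun j => eta (INR P * (x j - y j))) i) by auto.
  rewrite !Rabs_mult, (Rabs_pos_eq (INR P)) by apply pos_INR. simpl. rewrite Rmult_assoc.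
  apply Rmult_le_compat_l; [apply pos_INR|]. apply Rmult_le_compat; auto using Rabs_pos.
  - apply Hb.
  - apply prodR_bound; [lra|]. intros j _. destruct (Nat.eqb j i); [rewrite Rabs_R1; lra|apply Hb].
Qed.

Lemma prodR_const m c : prodR m (fun _ => c) = c ^ m.
Proof. induction m; simpl; auto. rewrite IHm. ring. Qed.

Lemma ker_riemann n eta eta' C P r y : is_bump eta eta' C -> (0 < P)%nat -> (0 < r)%nat ->
  normn n y <= INR (P * r) - 1 ->
  INR P ^ n * riemann n (ker n eta P y) (P * r) = 1 /\
  forall i, (i < n)%nat -> riemann n (dker n eta eta' P i y) (P * r) = 0.
Proof.
  intros (_ & _ & _ & _ & _ & _ & _ & Hsum) HP Hr Hy. unfold riemann.
  assert (HP' : 0 < INR P) by (apply lt_0_INR; auto).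
  assert (Hr' : 0 < INR r) by (apply lt_0_INR; auto).
  assert (Hyi : forall i, (i < n)%nat -> Rabs (y i) <= INR (P * r) - 1).
  { intros i Hi. eapply Rle_trans; [apply normn_coord; exact Hi|auto]. }
  split.
  - change (ker n eta P y) with (tensor n (fun i t => eta (INR P * (t - y i)))). rewrite gsum_tensor.
    rewrite (prodR_ext n _ (fun _ => INR r)).
    2:{ intros i Hi. apply Hsum; auto. }
    rewrite prodR_const, <- !Rpow_mult_distr, mult_INR.
    replace (INR P * (INR r * / (INR P * INR r))) with 1 by (field; lra). apply pow1.
  - intros i Hi. rewrite (gsum_ext n _ _ _ (fun x _ => dker_tensor n eta eta' P i y x)).
    rewrite gsum_tensor. rewrite (prodR_0 n _ i); auto; [ring|].
    unfold replace_factor. rewrite Nat.eqb_refl. rewrite sumR_scal.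
    rewrite (proj2 (Hsum P r (y i) HP Hr (Hyi i Hi))). ring.
Qed.

(** * Averages, their gradients, and uniformity in the centre *)

Definition mol n eta P r (f : pt -> R) (y : pt) : R :=
  INR P ^ n * riemann n (fun x => ker n eta P y x * f x) (P * r).

Definition dmol n eta eta' P r (f : pt -> R) (y : pt) (i : nat) : R :=
  - INR P ^ n * riemann n (fun x => dker n eta eta' P i y x * f x) (P * r).

Lemma gsum_sdiff m N n y : forall (F : pt -> pt -> R) (L : pt -> nat -> R),
  (forall x, sdiff n (F x) y (L x)) ->
  sdiff n (fun y => gsum m N (fun x => F x y)) y (fun i => gsum m N (fun x => L x i)).
Proof.
  induction m as [|m IH]; intros F L H; simpl; auto.
  apply (sdiff_sumR n (2 * N * N) (fun a y => gsum m N (fun x => F (upd x m (node N a)) y)) y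
    (fun a i => gsum m N (fun x => L (upd x m (node N a)) i))).
  intros a _. apply (IH (fun x => F (upd x m (node N a))) (fun x => L (upd x m (node N a)))). auto.
Qed.

Lemma mol_sdiff n eta eta' C P r f y : is_bump eta eta' C -> in_Rn n y ->
  sdiff n (mol n eta P r f) y (dmol n eta eta' P r f y).
Proof.
  intros (Hs & _ & Hd & _) Hy. unfold mol, riemann.
  assert (H : sdiff n (fun y => gsum n (P * r) (fun x => f x * ker n eta P y x)) y
     (fun i => gsum n (P * r) (fun x => f x * - dker n eta eta' P i y x))).
  { apply gsum_sdiff with (F := fun x y => f x * ker n eta P y x)
      (L := fun x i => f x * - dker n eta eta' P i y x).
    intros x. apply sdiff_scal. apply ker_sdiff; auto. }
  apply (sdiff_scal n _ y _ (INR P ^ n * (/ INR (P * r)) ^ n)) in H.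
  apply sdiff_near with (r := 1) (g := fun y => INR P ^ n * (/ INR (P * r)) ^ n *
       gsum n (P * r) (fun x => f x * ker n eta P y x)); [lra| |].
  - intros z _ _. rewrite (gsum_ext n _ (fun x => ker n eta P z x * f x) (fun x => f x * ker n eta P z x)).
    + ring.
    + intros; ring.
  - revert H. apply sdiff_eq. intros i Hi. unfold dmol, riemann.
    rewrite (gsum_ext n _ (fun x => f x * _) (fun x => (-1) * (dker n eta eta' P i y x * f x))) by (intros; ring).
    rewrite gsum_scal. ring.
Qed.

Lemma mol_plus n eta P r f g y : mol n eta P r (fun x => f x + g x) y = mol n eta P r f y + mol n eta P r g y.
Proof.
  unfold mol. rewrite <- Rmult_plus_distr_l, <- riemann_plus. f_equal. apply riemann_ext. intros; ring.
Qed.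

Lemma mol_scal n eta P r c f y : mol n eta P r (fun x => c * f x) y = c * mol n eta P r f y.
Proof.
  unfold mol. rewrite (riemann_ext n _ _ (fun x => c * (ker n eta P y x * f x))) by (intros; ring).
  rewrite riemann_scal. ring.
Qed.

Lemma mol_sumR n eta P r m (f : nat -> pt -> R) y :
  mol n eta P r (fun x => sumR m (fun j => f j x)) y = sumR m (fun j => mol n eta P r (f j) y).
Proof.
  unfold mol. rewrite sumR_scal, <- riemann_sumR. f_equal. apply riemann_ext. intros x _.
  rewrite sumR_scal. auto.
Qed.

(** The derivative kernel annihilates constants, so the gradient of an average sees only the
    oscillation of [f]. Subtracting the value at the centre improves its bound from order P to order
    P s. *)
Lemma dmol_shift n eta eta' P r f c y i :
  riemann n (dker n eta eta' P i y) (P * r) = 0 ->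
  dmol n eta eta' P r (fun x => f x - c) y i = dmol n eta eta' P r f y i.
Proof.
  intros H. unfold dmol. f_equal.
  rewrite (riemann_ext n _ _ (fun x => dker n eta eta' P i y x * f x + (- c) * dker n eta eta' P i y x))
    by (intros; ring).
  rewrite riemann_plus, riemann_scal. rewrite H. ring.
Qed.

Lemma riemann_le n N f g : (forall x, in_Rn n x -> f x <= g x) -> riemann n f N <= riemann n g N.
Proof.
  intros H. unfold riemann. apply Rmult_le_compat_r; [|apply gsum_le; auto].
  apply pow_le. destruct N; [change (INR 0) with 0; rewrite Rinv_0; lra|]. left. apply Rinv_0_lt_compat, lt_0_INR. lia.
Qed.

Lemma riemann_Rabs n N f : Rabs (riemann n f N) <= riemann n (fun x => Rabs (f x)) N.
Proof.
  unfold riemann. rewrite Rabs_mult.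
  rewrite (Rabs_pos_eq ((/ INR N) ^ n)).
  2:{ apply pow_le. destruct N; [change (INR 0) with 0; rewrite Rinv_0; lra|]. left. apply Rinv_0_lt_compat, lt_0_INR. lia. }
  apply Rmult_le_compat_r; [|apply gsum_Rabs].
  apply pow_le. destruct N; [change (INR 0) with 0; rewrite Rinv_0; lra|]. left. apply Rinv_0_lt_compat, lt_0_INR. lia.
Qed.

Lemma mol_const n eta eta' C P r c y : is_bump eta eta' C -> (0 < P)%nat -> (0 < r)%nat ->
  normn n y <= INR (P * r) - 1 -> mol n eta P r (fun _ => c) y = c.
Proof.
  intros Hb HP Hr Hy. destruct (ker_riemann n eta eta' C P r y Hb HP Hr Hy) as [H _].
  unfold mol. rewrite (riemann_ext n _ _ (fun x => c * ker n eta P y x)) by (intros; ring).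
  rewrite riemann_scal.
  transitivity (c * (INR P ^ n * riemann n (ker n eta P y) (P * r))); [ring|]. rewrite H. ring.
Qed.

(** The kernel is a probability weight on the nodes within 1/P of [y]. *)
Lemma mol_bound n eta eta' C P r f b y : is_bump eta eta' C -> (0 < P)%nat -> (0 < r)%nat ->
  normn n y <= INR (P * r) - 1 ->
  (forall x, in_Rn n x -> distn n x y <= / INR P -> Rabs (f x) <= b) ->
  Rabs (mol n eta P r f y) <= b.
Proof.
  intros Hb HP Hr Hy Hf. rewrite <- (mol_const n eta eta' C P r b y) at 1 by auto. unfold mol.
  assert (Hp : 0 <= INR P ^ n) by (apply pow_le, pos_INR).
  rewrite Rabs_mult, (Rabs_pos_eq (INR P ^ n)) by auto. apply Rmult_le_compat_l; auto.
  eapply Rle_trans; [apply riemann_Rabs|]. apply riemann_le. intros x Hx.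
  destruct (Rle_or_lt (distn n x y) (/ INR P)) as [Hxy|Hxy].
  - assert (Hk : 0 <= ker n eta P y x) by (apply ker_nonneg; apply Hb).
    rewrite Rabs_mult, (Rabs_pos_eq (ker n eta P y x)) by auto. apply Rmult_le_compat_l; auto.
  - destruct (ker_support n eta eta' C P y x Hb HP Hxy) as [E _]. rewrite E, !Rmult_0_l, Rabs_R0. lra.
Qed.

(** At most 2 r + 1 nodes per direction meet the support, each with weight 1/r per direction after
    the normalisation by P^n; as r >= 1 this gives the factor 3^n. The factor P comes from
    differentiating the rescaled bump. *)
Lemma dmol_bound n eta eta' C P r f b y i : is_bump eta eta' C -> (0 < P)%nat -> (0 < r)%nat ->
  0 <= b -> (i < n)%nat ->
  (forall x, in_Rn n x -> distn n x y <= / INR P -> Rabs (f x) <= b) ->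
  Rabs (dmol n eta eta' P r f y i) <= 3 ^ n * C ^ S n * (INR P * b).
Proof.
  intros Hb HP Hr Hb0 Hi Hf.
  assert (HP' : 0 < INR P) by (apply lt_0_INR; auto).
  assert (Hr' : 1 <= INR r) by (apply (le_INR 1); lia).
  assert (HC : 1 <= C) by apply Hb.
  assert (HCp : 0 < C ^ S n) by (apply pow_lt; lra).
  unfold dmol. rewrite Rabs_mult, Rabs_Ropp, (Rabs_pos_eq (INR P ^ n)) by (apply pow_le; lra).
  assert (HR : Rabs (riemann n (fun x => dker n eta eta' P i y x * f x) (P * r))
     <= (2 * / INR P + / INR (P * r)) ^ n * (INR P * C ^ S n * b)).
  { apply (riemann_bound n (P * r) y).
    - left; apply Rinv_0_lt_compat; auto.
    - apply Rmult_le_pos; auto. apply Rmult_le_pos; lra.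
    - lia.
    - intros x Hx. destruct (Rle_or_lt (distn n x y) (/ INR P)) as [Hxy|Hxy].
      + rewrite Rabs_mult. apply Rmult_le_compat; auto using Rabs_pos. apply dker_bound; auto.
      + destruct (ker_support n eta eta' C P y x Hb HP Hxy) as [_ E]. rewrite E, Rmult_0_l, Rabs_R0.
        apply Rmult_le_pos; auto. apply Rmult_le_pos; lra.
    - intros x Hx Hxy. destruct (ker_support n eta eta' C P y x Hb HP Hxy) as [_ E]. rewrite E. ring. }
  apply Rmult_le_compat_l with (r := INR P ^ n) in HR; [|apply pow_le; lra].
  eapply Rle_trans; [exact HR|]. rewrite <- Rmult_assoc, <- Rpow_mult_distr.
  replace (3 ^ n * C ^ S n * (INR P * b)) with (3 ^ n * (INR P * C ^ S n * b)) by ring.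
  apply Rmult_le_compat_r.
  { apply Rmult_le_pos; auto. apply Rmult_le_pos; lra. }
  apply pow_incr. rewrite mult_INR.
  assert (Hir : 0 < / INR r <= 1).
  { split; [apply Rinv_0_lt_compat; lra|]. rewrite <- Rinv_1. apply Rinv_le_contravar; lra. }
  replace (INR P * (2 * / INR P + / (INR P * INR r))) with (2 + / INR r) by (field; lra). lra.
Qed.

Lemma cont_uniform n V R0 e : cont_on n (in_Rn n) V -> 0 <= R0 -> 0 < e ->
  exists d, 0 < d /\ forall z z', in_Rn n z -> in_Rn n z' -> distn n z (fun _ => 0) <= R0 ->
    distn n z' z < d -> Rabs (V z' - V z) <= e.
Proof.
  intros HV HR He.
  destruct (compact_uniform n _ (fun d z => forall z', in_Rn n z' -> distn n z' z < d -> Rabs (V z' - V z) <= e)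
    (compact_cube n (fun _ => 0) R0 HR)) as [d [Hd H]].
  - intros d d' x Hd H z' Hz' Hlt. apply H; auto; lra.
  - intros x [Hx _]. destruct (HV x Hx (e / 2) ltac:(lra)) as [d [Hd H]].
    exists (d / 2). split; [lra|]. intros z [Hz _] Hzx z' Hz' Hlt.
    assert (H1 := distn_triang n z' z x).
    assert (H2 := H z Hz ltac:(rewrite distn_sym; lra)).
    assert (H3 := H z' Hz' ltac:(rewrite distn_sym; lra)).
    replace (V z' - V z) with ((V z' - V x) - (V z - V x)) by ring.
    eapply Rle_trans; [apply Rabs_triang|]. rewrite Rabs_Ropp. lra.
  - exists d. split; auto.
Qed.

(** Everything depends on x - y, so this is uniform continuity of one function on the cube of radius
    2. *)
Lemma dker_equicontinuous n eta eta' C P i e : is_bump eta eta' C -> (0 < P)%nat -> 0 < e ->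
  exists d, 0 < d /\ forall x y y', in_Rn n x -> in_Rn n y -> in_Rn n y' -> distn n x y <= 2 ->
    distn n y' y < d -> Rabs (dker n eta eta' P i y' x - dker n eta eta' P i y x) <= e.
Proof.
  intros (Hs & Hs' & _) HP He.
  set (V := tensor n (replace_factor (fun _ t => eta (INR P * t)) i (fun t => INR P * eta' (INR P * t)))).
  assert (Hlin : forall f, smooth f -> smooth (fun t => f (INR P * t))).
  { intros f Hf. replace (fun t => f (INR P * t)) with (fun t => f (INR P * t + 0)).
    - apply smooth_affine; auto.
    - extensionality t. f_equal. ring. }
  destruct (cont_uniform n V 2 e) as [d [Hd H]]; auto; [|lra|].
  - apply tensor_cont. intros j _. unfold replace_factor. destruct (Nat.eqb j i).
    + exact (smooth_scal _ (INR P) (Hlin eta' Hs') O).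
    + exact (Hlin eta Hs O).
  - exists d. split; auto. intros x y y' Hx Hy Hy' Hxy Hlt.
    apply H.
    + intros j Hj. rewrite Hx, Hy by auto. ring.
    + intros j Hj. rewrite Hx, Hy' by auto. ring.
    + apply distn_lub; [lra|]. intros j Hj.
      replace (x j - y j - 0) with (x j - y j) by ring.
      eapply Rle_trans; [apply distn_coord with (n := n); auto|auto].
    + apply normn_lub_lt; auto. intros j Hj.
      replace (x j - y' j - (x j - y j)) with (- (y' j - y j)) by ring. rewrite Rabs_Ropp.
      eapply Rle_lt_trans; [apply distn_coord with (n := n); auto|auto].
Qed.

(** Kernels with nearby centres differ uniformly little, so the threshold obtained at a centre [y0]
    serves a whole neighbourhood of [y0]; compactness of [K] then leaves a single threshold. *)
Lemma riemann_dker_uniform n eta eta' C P K (f : nat -> pt -> R) b :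
  is_bump eta eta' C -> (0 < P)%nat -> compact_in n K -> 0 <= b ->
  (forall i x y, (i < n)%nat -> K y -> in_Rn n x -> distn n x y <= 2 * / INR P -> Rabs (f i x) <= b) ->
  (forall y, K y -> integral_is n (fun x => sumR n (fun i => dker n eta eta' P i y x * f i x)) 0) ->
  forall e, 0 < e -> exists N0, forall N y, (N0 <= N)%nat -> K y ->
    Rabs (riemann n (fun x => sumR n (fun i => dker n eta eta' P i y x * f i x)) N) <= e.
Proof.
  intros Hb HP HK Hb0 Hf Hw e He.
  assert (HP' : 0 < INR P) by (apply lt_0_INR; auto).
  assert (HiP : 0 < / INR P) by (apply Rinv_0_lt_compat; auto).
  assert (HiP1 := Rinv_INR_le1 P HP).
  set (T := fun y x => sumR n (fun i => dker n eta eta' P i y x * f i x)).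
  (* The parameter [d] is the size of the neighbourhood and, through [/ d <= INR N], also encodes
     the threshold on [N]. *)
  destruct (compact_uniform n K (fun d y => forall N, (0 < N)%nat -> / d <= INR N -> Rabs (riemann n (T y) N) <= e) HK)
    as [d [Hd H]].
  - intros d d' x Hd H N HN HdN. apply H; auto. eapply Rle_trans; [|exact HdN].
    apply Rinv_le_contravar; lra.
  - intros y0 Hy0. assert (Hy0n : in_Rn n y0) by (apply (proj1 HK); auto).
    (* Here 5 is 2 * 2 + 1: both kernels live within 2/P <= 2 of [y0]. The added 1 keeps [c]
       positive when [b] is zero. *)
    set (c := 5 ^ n * (INR n * b) + 1).
    assert (Hc0 : 0 <= 5 ^ n * (INR n * b)).
    { apply Rmult_le_pos; [apply pow_le; lra|]. apply Rmult_le_pos; auto. apply pos_INR. }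
    assert (Hc : 0 < c) by (unfold c; lra).
    set (e1 := e / (2 * c)). assert (He1 : 0 < e1) by (apply Rdiv_lt_0_compat; lra).
    destruct (finite_radius n (fun i d => forall x y y', in_Rn n x -> in_Rn n y -> in_Rn n y' ->
       distn n x y <= 2 -> distn n y' y < d ->
       Rabs (dker n eta eta' P i y' x - dker n eta eta' P i y x) <= e1)) as [d1 [Hd1 Hq]].
    { intros i d d' Hd H x y y' Hx Hy Hy' Hxy Hlt. apply (H x y y'); auto; lra. }
    { intros i _. apply (dker_equicontinuous n eta eta' C P i e1); auto. }
    destruct (Hw y0 Hy0 (e / 2)) as [m Hm]; [lra|].
    set (d := Rmin (Rmin d1 (/ INR P)) (/ INR (S m))).
    assert (Hm' : 0 < / INR (S m)) by (apply Rinv_0_lt_compat, lt_0_INR; lia).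
    assert (Hd : 0 < d) by (repeat apply Rmin_pos; auto).
    assert (Hdd : d <= d1 /\ d <= / INR P /\ d <= / INR (S m)).
    { unfold d. assert (A1 := Rmin_l (Rmin d1 (/ INR P)) (/ INR (S m))).
      assert (A2 := Rmin_r (Rmin d1 (/ INR P)) (/ INR (S m))).
      assert (A3 := Rmin_l d1 (/ INR P)). assert (A4 := Rmin_r d1 (/ INR P)). lra. }
    exists d. split; auto. intros y Hy Hyy N HN HdN.
    assert (Hyn : in_Rn n y) by (apply (proj1 HK); auto).
    assert (HmN : (S m <= N)%nat).
    { apply INR_le. eapply Rle_trans; [|exact HdN]. rewrite <- (Rinv_inv (INR (S m))).
      apply Rinv_le_contravar; lra. }
    assert (H0 : Rabs (riemann n (T y0) N) < e / 2).
    { specialize (Hm (pred N) ltac:(lia)). unfold Rdist in Hm. rewrite Rminus_0_r in Hm.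
      replace (S (pred N)) with N in Hm by lia. exact Hm. }
    assert (H1 : Rabs (riemann n (fun x => T y x + (-1) * T y0 x) N) <= 5 ^ n * (INR n * (e1 * b))).
    { replace (5 ^ n) with ((2 * 2 + 1) ^ n) by (f_equal; ring).
      assert (Hz : forall x, 2 * / INR P < distn n x y0 -> forall i,
         dker n eta eta' P i y x = 0 /\ dker n eta eta' P i y0 x = 0).
      { intros x Hx i.
        assert (A1 := distn_triang n x y y0).
        split; [apply (ker_support n eta eta' C P y x)|apply (ker_support n eta eta' C P y0 x)]; auto; lra. }
      apply (riemann_bound_unif n N y0); auto; try lra.
      - apply Rmult_le_pos; [apply pos_INR|]. apply Rmult_le_pos; lra.
      - intros x Hx. unfold T. rewrite <- sumR_scal, <- sumR_plus. apply sumR_Rabs_le.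
        intros i Hi.
        replace (dker n eta eta' P i y x * f i x + -1 * (dker n eta eta' P i y0 x * f i x))
          with ((dker n eta eta' P i y x - dker n eta eta' P i y0 x) * f i x) by ring.
        destruct (Rle_or_lt (distn n x y0) (2 * / INR P)) as [Hxy|Hxy].
        + rewrite Rabs_mult. apply Rmult_le_compat; auto using Rabs_pos.
          * apply (Hq i Hi); auto; lra.
          * apply (Hf i x y0); auto.
        + destruct (Hz x Hxy i) as [E1 E2]. rewrite E1, E2.
          replace ((0 - 0) * f i x) with 0 by ring. rewrite Rabs_R0. apply Rmult_le_pos; lra.
      - intros x Hx Hxy. unfold T. rewrite <- sumR_scal, <- sumR_plus. apply sumR_0.
        intros i Hi. destruct (Hz x ltac:(lra) i) as [E1 E2]. rewrite E1, E2. ring. }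
    assert (H2 : 5 ^ n * (INR n * (e1 * b)) <= e / 2).
    { replace (5 ^ n * (INR n * (e1 * b))) with (e1 * (5 ^ n * (INR n * b))) by ring.
      apply Rle_trans with (e1 * c); [apply Rmult_le_compat_l; unfold c; lra|].
      right. unfold e1. field. lra. }
    rewrite riemann_plus, riemann_scal in H1.
    replace (riemann n (T y) N) with
      ((riemann n (T y) N + -1 * riemann n (T y0) N) + riemann n (T y0) N) by ring.
    eapply Rle_trans; [apply Rabs_triang|]. lra.
  - destruct (exists_INR_gt (/ d)) as [m Hm]. exists (S m). intros N y HN Hy.
    apply H; auto; [lia|]. left. apply Hm. lia.
Qed.

(** * Local estimates and Hoelder moduli *)

(** The parameter [d] serves as a radius and, through [/ d], as a bound. Monotonicity in [d] allows
    such statements to be conjoined, so that one [d] can provide all local constants of the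
    nonlinearities. *)
Definition locally_uniform (k : nat) (M : pt -> Prop) (P : R -> pt -> Prop) : Prop :=
  (forall d d' p, 0 < d' <= d -> P d p -> P d' p) /\
  forall p0, M p0 -> exists d, 0 < d /\ forall p, M p -> distn k p p0 < d -> P d p.

Lemma locally_uniform_and k M P P' : locally_uniform k M P -> locally_uniform k M P' ->
  locally_uniform k M (fun d p => P d p /\ P' d p).
Proof.
  intros [H1 H2] [H3 H4]. split.
  - intros d d' p Hd [A B]. split; eauto.
  - intros p0 Hp0. destruct (H2 p0 Hp0) as [d1 [Hd1 A]]. destruct (H4 p0 Hp0) as [d2 [Hd2 B]].
    exists (Rmin d1 d2). assert (Hm := Rmin_pos d1 d2 Hd1 Hd2).
    assert (A1 := Rmin_l d1 d2). assert (A2 := Rmin_r d1 d2). split; auto.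
    intros p Hp Hpp. split; [apply H1 with d1|apply H3 with d2]; auto; [apply A|apply B]; auto; lra.
Qed.

Lemma locally_uniform_forall k M m (P : nat -> R -> pt -> Prop) :
  (forall j, (j < m)%nat -> locally_uniform k M (P j)) ->
  locally_uniform k M (fun d p => forall j, (j < m)%nat -> P j d p).
Proof.
  intros H. split.
  - intros d d' p Hd A j Hj. apply (proj1 (H j Hj)) with d; auto.
  - intros p0 Hp0.
    induction m as [|m IH].
    + exists 1. split; [lra|]. intros; lia.
    + destruct IH as [d1 [Hd1 A]]; [intros; apply H; lia|].
      destruct (proj2 (H m ltac:(lia)) p0 Hp0) as [d2 [Hd2 B]].
      exists (Rmin d1 d2). assert (Hm := Rmin_pos d1 d2 Hd1 Hd2).
      assert (A1 := Rmin_l d1 d2). assert (A2 := Rmin_r d1 d2). split; auto.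
      intros p Hp Hpp j Hj. destruct (Nat.eq_dec j m) as [->|Hne].
      * apply (proj1 (H m ltac:(lia))) with d2; auto. apply B; auto; lra.
      * apply (proj1 (H j ltac:(lia))) with d1; auto. apply A; auto; [lra|lia].
Qed.

Lemma locally_uniform_open k M : open_in k M ->
  locally_uniform k M (fun d p => forall z, in_Rn k z -> distn k z p <= d -> M z).
Proof.
  intros HM. split.
  - intros d d' p Hd H z Hz Hzp. apply H; auto; lra.
  - intros p0 Hp0. destruct (HM p0 Hp0) as [_ [r [Hr H]]]. exists (r / 3). split; [lra|].
    intros p Hp Hpp z Hz Hzp. apply H; auto. rewrite distn_sym.
    assert (A := distn_triang k z p p0). lra.
Qed.

Lemma locally_uniform_bounded k M f : cont_on k M f ->
  locally_uniform k M (fun d p => forall z, M z -> distn k z p <= d -> Rabs (f z) <= / d).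
Proof.
  intros Hf. split.
  - intros d d' p Hd H z Hz Hzp. eapply Rle_trans; [apply H; auto; lra|]. apply Rinv_le_contravar; lra.
  - intros p0 Hp0. destruct (Hf p0 Hp0 1 ltac:(lra)) as [r [Hr H]].
    assert (Hc : 0 < 1 + Rabs (f p0)) by (assert (A := Rabs_pos (f p0)); lra).
    assert (Hi := Rinv_0_lt_compat _ Hc).
    exists (Rmin (r / 3) (/ (1 + Rabs (f p0)))).
    assert (Hm : 0 < Rmin (r / 3) (/ (1 + Rabs (f p0)))) by (apply Rmin_pos; lra).
    assert (A1 := Rmin_l (r / 3) (/ (1 + Rabs (f p0)))). assert (A2 := Rmin_r (r / 3) (/ (1 + Rabs (f p0)))).
    split; auto. intros p Hp Hpp z Hz Hzp.
    assert (A := distn_triang k z p p0).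
    specialize (H z Hz ltac:(rewrite distn_sym; lra)).
    apply Rle_trans with (1 + Rabs (f p0)).
    + replace (f z) with ((f z - f p0) + f p0) by ring. eapply Rle_trans; [apply Rabs_triang|]. lra.
    + rewrite <- (Rinv_inv (1 + Rabs (f p0))) at 1. apply Rinv_le_contravar; auto.
Qed.

Lemma locally_uniform_lipschitz k M f : open_in k M -> Cm k M 1 f ->
  locally_uniform k M (fun d p => forall z z', M z -> M z' -> distn k z p <= d -> distn k z' p <= d ->
    Rabs (f z' - f z) <= / d * distn k z' z).
Proof.
  intros HM Hf. split.
  - intros d d' p Hd H z z' Hz Hz' Hzp Hzp'. eapply Rle_trans; [apply H; auto; lra|].
    apply Rmult_le_compat_r; [apply distn_nonneg|]. apply Rinv_le_contravar; lra.
  - intros p0 Hp0.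
    destruct (sdiff_lipschitz k f p0 _ (sdiff_of_C1 k M f p0 HM Hp0 Hf)) as (C & r & HC & Hr & H).
    assert (Hi : 0 < / (1 + C)) by (apply Rinv_0_lt_compat; lra).
    exists (Rmin (r / 3) (/ (1 + C))).
    assert (Hm : 0 < Rmin (r / 3) (/ (1 + C))) by (apply Rmin_pos; lra).
    assert (A1 := Rmin_l (r / 3) (/ (1 + C))). assert (A2 := Rmin_r (r / 3) (/ (1 + C))).
    split; auto. intros p Hp Hpp z z' Hz Hz' Hzp Hzp'.
    assert (A := distn_triang k z p p0). assert (A' := distn_triang k z' p p0).
    assert (Hzn := proj1 (HM z Hz)). assert (Hzn' := proj1 (HM z' Hz')).
    eapply Rle_trans; [apply (H z' z); auto; lra|].
    apply Rmult_le_compat_r; [apply distn_nonneg|].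
    apply Rle_trans with (1 + C); [lra|].
    rewrite <- (Rinv_inv (1 + C)) at 1. apply Rinv_le_contravar; auto.
Qed.

(** The first derivatives are locally Lipschitz, hence near [z] the gradient deviates from its value
    at [z] by a multiple of the distance; [mean_value] with that gradient as comparison vector gives
    a quadratic remainder. *)
Lemma locally_uniform_taylor k M f : open_in k M -> Cm k M 2 f ->
  locally_uniform k M (fun d p => forall z z', M z -> M z' -> distn k z p <= d -> distn k z' p <= d ->
    Rabs (f z' - f z - sumR k (fun j => pd f j z * (z' j - z j))) <= / d * (distn k z' z) ^ 2).
Proof.
  intros HM Hf. split.
  - intros d d' p Hd H z z' Hz Hz' Hzp Hzp'. eapply Rle_trans; [apply H; auto; lra|].
    apply Rmult_le_compat_r; [apply pow2_ge_0|]. apply Rinv_le_contravar; lra.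
  - intros p0 Hp0.
    assert (HL : locally_uniform k M (fun d p => forall j, (j < k)%nat -> forall z z', M z -> M z' ->
       distn k z p <= d -> distn k z' p <= d -> Rabs (pd f j z' - pd f j z) <= / d * distn k z' z)).
    { apply (locally_uniform_forall k M k). intros j Hj. destruct Hf as [_ [Df HDf]].
      destruct (HDf j Hj) as [HD HD1]. destruct (locally_uniform_lipschitz k M (Df j) HM HD1) as [B1 B2].
      assert (E : forall z, M z -> pd f j z = Df j z) by (intros z Hz; apply pd_eq; auto).
      split.
      - intros d d' p Hd H z z' Hz Hz' Hzp Hzp'. eapply Rle_trans; [apply H; auto; lra|].
        apply Rmult_le_compat_r; [apply distn_nonneg|]. apply Rinv_le_contravar; lra.
      - intros q Hq. destruct (B2 q Hq) as [d [Hd H]]. exists d. split; auto.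
        intros p Hp Hpq z z' Hz Hz' Hzp Hzp'. rewrite !E by auto. apply (H p); auto. }
    destruct (proj2 HL p0 Hp0) as [d1 [Hd1 H1]].
    specialize (H1 p0 Hp0 ltac:(rewrite distn_refl; auto)).
    destruct (HM p0 Hp0) as [_ [r [Hr Hball]]].
    assert (Hk : 0 < / ((1 + INR k) * / d1)).
    { apply Rinv_0_lt_compat, Rmult_lt_0_compat; [|apply Rinv_0_lt_compat; auto].
      assert (A := pos_INR k). lra. }
    (* The points used by [mean_value] lie within 4 d of [p0], so a seventh of each radius is
       enough; the last entry makes [/ d] dominate the constant (1 + k)/d1. *)
    set (d := Rmin (Rmin (d1 / 7) (r / 7)) (/ ((1 + INR k) * / d1))).
    assert (Hd : 0 < d) by (repeat apply Rmin_pos; lra).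
    assert (Hdd : d <= d1 / 7 /\ d <= r / 7 /\ d <= / ((1 + INR k) * / d1)).
    { unfold d. set (w := / ((1 + INR k) * / d1)).
      assert (A1 := Rmin_l (Rmin (d1 / 7) (r / 7)) w). assert (A2 := Rmin_r (Rmin (d1 / 7) (r / 7)) w).
      assert (A3 := Rmin_l (d1 / 7) (r / 7)). assert (A4 := Rmin_r (d1 / 7) (r / 7)). lra. }
    exists d. split; auto. intros p Hp Hpp z z' Hz Hz' Hzp Hzp'.
    assert (Hzn := proj1 (HM z Hz)). assert (Hzn' := proj1 (HM z' Hz')).
    assert (A := distn_triang k z p p0).
    assert (A' := distn_triang k z' p z). rewrite (distn_sym k p z) in A'.
    set (s := distn k z' z) in *. assert (Hs : 0 <= s) by apply distn_nonneg.
    assert (Hd1i : 0 < / d1) by (apply Rinv_0_lt_compat; auto).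
    eapply Rle_trans.
    + apply (mean_value k f (pd f) (fun j => pd f j z) (/ d1 * s) s z z' z); auto.
      * unfold s; lra.
      * rewrite distn_refl; auto.
      * intros w j Hj Hw Hwz.
        assert (A2 := distn_triang k w z p0).
        assert (HMw : M w) by (apply Hball; auto; rewrite distn_sym; lra).
        split; [apply (Cm1_partial k M f (Cm_pred k M 1 f Hf) j Hj); auto|].
        eapply Rle_trans; [apply (H1 j Hj z w); auto; lra|]. apply Rmult_le_compat_l; lra.
      * apply Rmult_le_pos; lra.
    + fold s. replace (INR k * (/ d1 * s) * s) with (INR k * / d1 * s ^ 2) by ring.
      apply Rmult_le_compat_r; [apply pow2_ge_0|].
      apply Rle_trans with ((1 + INR k) * / d1); [apply Rmult_le_compat_r; lra|].
      rewrite <- (Rinv_inv ((1 + INR k) * / d1)) at 1. apply Rinv_le_contravar; lra.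
Qed.

(** Neighbourhoods in [M] are pulled back through the continuity of [u], and compactness is applied
    in [K]. *)
Lemma locally_uniform_on_compact n k M K (u : pt -> pt) P :
  compact_in n K -> (forall x, K x -> M (u x)) ->
  (forall x e, K x -> 0 < e -> exists d, 0 < d /\ forall y, K y -> distn n y x < d -> distn k (u y) (u x) < e) ->
  locally_uniform k M P -> exists d, 0 < d /\ forall y, K y -> P d (u y).
Proof.
  intros HK HuM Hu [H1 H2].
  apply (compact_uniform n K (fun d y => P d (u y)) HK).
  - intros d d' x Hd. apply H1; auto.
  - intros x Hx. destruct (H2 (u x) (HuM x Hx)) as [d [Hd H]].
    destruct (Hu x d Hx Hd) as [d' [Hd' H']]. exists (Rmin d d').
    assert (Hm := Rmin_pos d d' Hd Hd'). assert (A1 := Rmin_l d d'). assert (A2 := Rmin_r d d').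
    split; auto. intros y Hy Hyx. apply H1 with d; auto. apply H; auto. apply H'; auto. lra.
Qed.

(** * Powers, Hoelder continuity and the choice of scale *)

Lemma Rpower_small a e : 0 < a -> 0 < e -> exists d, 0 < d /\ forall t, 0 < t <= d -> Rpower t a <= e.
Proof.
  intros Ha He. exists (Rpower e (/ a)). split; [apply exp_pos|].
  intros t Ht. apply Rle_trans with (Rpower (Rpower e (/ a)) a).
  - apply Rle_Rpower_l; lra.
  - rewrite Rpower_mult, Rinv_l, Rpower_1 by lra. lra.
Qed.

Lemma holder_modulus n k K a u : (forall x, K x -> in_Rn n x) -> 0 < a -> holder_on n k K a u ->
  exists C, 0 <= C /\ forall t x y, 0 < t -> K x -> K y -> distn n x y <= t ->
    distn k (u x) (u y) <= C * Rpower t a.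
Proof.
  intros HK Ha [C HC]. exists (Rmax 0 C). assert (HC0 := Rmax_l 0 C). assert (HC1 := Rmax_r 0 C).
  split; auto. intros t x y Ht Hx Hy Hxy.
  assert (Hp : 0 < Rpower t a) by apply exp_pos.
  destruct (distn_nonneg n x y) as [H|H].
  - eapply Rle_trans; [apply (HC x y Hx Hy H)|].
    assert (H1 : 0 < Rpower (distn n x y) a) by apply exp_pos.
    apply Rle_trans with (Rmax 0 C * Rpower (distn n x y) a).
    + apply Rmult_le_compat_r; lra.
    + apply Rmult_le_compat_l; auto. apply Rle_Rpower_l; lra.
  (* [holder_on] speaks only of positive distances; at distance 0 the two points coincide. *)
  - rewrite (distn_0_eq n x y) by auto. rewrite distn_refl. apply Rmult_le_pos; lra.
Qed.

Lemma holder_continuous n k K a u : (forall x, K x -> in_Rn n x) -> 0 < a -> holder_on n k K a u ->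
  forall x e, K x -> 0 < e -> exists d, 0 < d /\ forall y, K y -> distn n y x < d -> distn k (u y) (u x) < e.
Proof.
  intros HK Ha Hu x e Hx He. destruct (holder_modulus n k K a u HK Ha Hu) as (C & HC & H).
  destruct (Rpower_small a (e / (2 * (1 + C)))) as [d [Hd Hp]]; auto.
  { apply Rdiv_lt_0_compat; lra. }
  exists d. split; auto. intros y Hy Hyx. specialize (H d y x Hd Hy Hx ltac:(lra)).
  specialize (Hp d ltac:(lra)).
  eapply Rle_lt_trans; [exact H|].
  apply Rle_lt_trans with (C * (e / (2 * (1 + C)))); [apply Rmult_le_compat_l; auto|].
  apply Rle_lt_trans with ((1 + C) * (e / (2 * (1 + C)))).
  - apply Rmult_le_compat_r; [|lra]. left. apply Rdiv_lt_0_compat; lra.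
  - replace ((1 + C) * (e / (2 * (1 + C)))) with (e / 2) by (field; lra). lra.
Qed.

(** With s = P^-a, the product P s^3 equals P^(1 - 3a): this is where the exponent 1/3 enters. *)
Lemma scales_vanish a e : 1/3 < a -> 0 < e -> exists P0, forall P, (P0 <= P)%nat ->
  Rpower (/ INR P) a + INR P * Rpower (/ INR P) a ^ 3 <= e /\ / INR P <= e /\ Rpower (/ INR P) a <= 1.
Proof.
  intros Ha He.
  destruct (Rpower_small a (Rmin 1 (e / 2))) as [d1 [Hd1 H1]]; [lra|apply Rmin_pos; lra|].
  destruct (Rpower_small (3 * a - 1) (e / 2)) as [d2 [Hd2 H2]]; [lra|lra|].
  assert (Hm : 0 < Rmin (Rmin d1 d2) e) by (repeat apply Rmin_pos; auto).
  assert (A1 := Rmin_l (Rmin d1 d2) e). assert (A2 := Rmin_r (Rmin d1 d2) e).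
  assert (A3 := Rmin_l d1 d2). assert (A4 := Rmin_r d1 d2).
  destruct (exists_INR_gt (/ Rmin (Rmin d1 d2) e)) as [m Hm']. exists m. intros P HP.
  specialize (Hm' P HP). assert (Hi := Rinv_0_lt_compat _ Hm).
  assert (HPp : 0 < INR P) by lra.
  assert (Hip : 0 < / INR P) by (apply Rinv_0_lt_compat; auto).
  assert (Hle : / INR P <= Rmin (Rmin d1 d2) e).
  { rewrite <- (Rinv_inv (Rmin (Rmin d1 d2) e)). apply Rinv_le_contravar; lra. }
  specialize (H1 (/ INR P) ltac:(lra)). specialize (H2 (/ INR P) ltac:(lra)).
  assert (A5 := Rmin_l 1 (e / 2)). assert (A6 := Rmin_r 1 (e / 2)).
  replace (INR P * Rpower (/ INR P) a ^ 3) with (Rpower (/ INR P) (3 * a - 1)).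
  - lra.
  - replace (3 * a - 1) with (a + a + a + - (1)) by ring. rewrite !Rpower_plus, Rpower_Ropp, Rpower_1 by auto.
    rewrite Rinv_inv. ring.
Qed.

(** * The entropy equality *)

Lemma integral_is_sumR n m (f : nat -> pt -> R) :
  (forall j, (j < m)%nat -> integral_is n (f j) 0) ->
  integral_is n (fun x => sumR m (fun j => f j x)) 0.
Proof.
  induction m as [|m IH]; intros H eps Heps.
  - exists O. intros N _. rewrite riemann_sumR. simpl. unfold Rdist. rewrite Rminus_0_r, Rabs_R0. auto.
  - destruct (IH (fun j hj => H j ltac:(lia)) (eps / 2) ltac:(lra)) as [N1 H1].
    destruct (H m ltac:(lia) (eps / 2) ltac:(lra)) as [N2 H2].
    exists (max N1 N2). intros N HN. specialize (H1 N ltac:(lia)). specialize (H2 N ltac:(lia)).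
    unfold Rdist in *. rewrite Rminus_0_r in *. simpl sumR. rewrite riemann_plus.
    eapply Rle_lt_trans; [apply Rabs_triang|]. lra.
Qed.

Lemma Cm_zero n D m : Cm n D m (fun _ => 0).
Proof.
  assert (Hc : cont_on n D (fun _ => 0)).
  { intros x _ eps Heps. exists 1. split; [lra|]. intros. rewrite Rminus_diag, Rabs_R0. auto. }
  induction m as [|m IH]; simpl; auto. split; auto. exists (fun _ _ => 0). intros j _. split; auto.
  intros x _. apply (derivable_pt_lim_const 0).
Qed.

Lemma mol_minus_const n eta eta' C P r f c y : is_bump eta eta' C -> (0 < P)%nat -> (0 < r)%nat ->
  normn n y <= INR (P * r) - 1 ->
  mol n eta P r (fun x => f x - c) y = mol n eta P r f y - c.
Proof.
  intros Hb HP Hr Hy.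
  assert (H : mol n eta P r (fun x => f x - c) y = mol n eta P r f y + mol n eta P r (fun _ => - c) y)
    by (rewrite <- mol_plus; auto).
  rewrite H, (mol_const n eta eta' C P r _ y) by auto. ring.
Qed.

(** Truncation to [k] coordinates, because points of R^k are encoded as sequences that vanish from
    index [k] on. *)
Definition vec (k : nat) (g : nat -> R) : pt := fun b => if Nat.ltb b k then g b else 0.

Lemma vec_in k g : in_Rn k (vec k g).
Proof. intros i Hi. unfold vec. destruct (Nat.ltb_spec i k); auto; lia. Qed.

Lemma vec_lt k g i : (i < k)%nat -> vec k g i = g i.
Proof. intros Hi. unfold vec. destruct (Nat.ltb_spec i k); auto; lia. Qed.

Definition mol_vec n k eta P r (u : pt -> pt) (y : pt) : pt :=
  vec k (fun b => mol n eta P r (fun x => u x b) y).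

Lemma mol_vec_near n k eta eta' C P r u y t : is_bump eta eta' C -> (0 < P)%nat -> (0 < r)%nat ->
  normn n y <= INR (P * r) - 1 -> 0 <= t ->
  (forall x, in_Rn n x -> distn n x y <= / INR P -> distn k (u x) (u y) <= t) ->
  distn k (mol_vec n k eta P r u y) (u y) <= t.
Proof.
  intros Hb HP Hr Hy Ht Hu. apply distn_lub; auto. intros b Hbk. unfold mol_vec. rewrite vec_lt by auto.
  rewrite <- (mol_minus_const n eta eta' C) by auto.
  apply (mol_bound n eta eta' C); auto. intros x Hx Hxy.
  eapply Rle_trans; [apply (distn_coord k); auto|auto].
Qed.

(* The first-order Taylor term averages to zero around the mollified value, so that the commutator of
   mollification and composition is of second order. *)
Lemma mol_commutator n k eta eta' C P r u y f c e : is_bump eta eta' C -> (0 < P)%nat -> (0 < r)%nat ->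
  normn n y <= INR (P * r) - 1 ->
  (forall x, in_Rn n x -> distn n x y <= / INR P ->
    Rabs (f (u x) - f (mol_vec n k eta P r u y)
      - sumR k (fun b => c b * (u x b - mol_vec n k eta P r u y b))) <= e) ->
  Rabs (mol n eta P r (fun x => f (u x)) y - f (mol_vec n k eta P r u y)) <= e.
Proof.
  intros Hb HP Hr Hy Hf. set (p := mol_vec n k eta P r u y) in *.
  replace (mol n eta P r (fun x => f (u x)) y - f p) with
    (mol n eta P r (fun x => f (u x) - f p + (-1) * sumR k (fun b => c b * (u x b - p b))) y).
  - apply (mol_bound n eta eta' C); auto. intros x Hx Hxy.
    replace (f (u x) - f p + -1 * sumR k (fun b => c b * (u x b - p b)))
      with (f (u x) - f p - sumR k (fun b => c b * (u x b - p b))) by ring. auto.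
  - rewrite mol_plus, mol_scal, (mol_minus_const n eta eta' C), mol_sumR by auto.
    rewrite sumR_0; [ring|]. intros b Hbk.
    rewrite mol_scal, (mol_minus_const n eta eta' C) by auto.
    unfold p, mol_vec. rewrite vec_lt by auto. ring.
Qed.

(** The divergence of the field minus the target integrand at one point, with all values abstracted:
    [b] is B(v), [R0] is G - A(v), [db], [dA] and [dq] are derivatives at v, [dv] is the gradient of
    v, [qu] is q(u). The entropy identity turns [dq . dv] into [b . dA . dv], which cancels the
    derivative of A(v) inside the commutator. The gradient of v then survives only multiplied by
    [R0], and [dG] only through its divergence. *)
Lemma entropy_algebra n l k (dphi : nat -> R) ph (b : nat -> R) (R0 : nat -> nat -> R)
  (db : nat -> nat -> R) (dv : nat -> nat -> R) (dA : nat -> nat -> nat -> R) (dG : nat -> nat -> R)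
  (q qu : nat -> R) (dq : nat -> nat -> R) :
  (forall i c, (i < n)%nat -> (c < k)%nat -> sumR l (fun j => b j * dA i j c) = dq i c) ->
  sumR n (fun i =>
    (ph * (sumR l (fun j => b j * (dG i j - sumR k (fun c => dA i j c * dv c i))
                            + R0 i j * sumR k (fun c => db j c * dv c i))
           + sumR k (fun c => dq i c * dv c i))
     + (sumR l (fun j => b j * R0 i j) + q i) * dphi i) - dphi i * qu i)
  = sumR n (fun i => dphi i * (sumR l (fun j => b j * R0 i j) + (q i - qu i))
      + ph * sumR l (fun j => R0 i j * sumR k (fun c => db j c * dv c i)))
    + ph * sumR l (fun j => b j * sumR n (fun i => dG i j)).
Proof.
  intros H.
  replace (sumR l (fun j => b j * sumR n (fun i => dG i j)))
    with (sumR n (fun i => sumR l (fun j => b j * dG i j))).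
  2:{ rewrite sumR_swap. apply sumR_ext. intros j _. rewrite sumR_scal. auto. }
  rewrite <- sumR_scal, <- sumR_plus. apply sumR_ext. intros i Hi.
  assert (E : sumR k (fun c => dq i c * dv c i)
    = sumR l (fun j => b j * sumR k (fun c => dA i j c * dv c i))).
  { rewrite (sumR_ext l _ (fun j => sumR k (fun c => b j * (dA i j c * dv c i)))).
    2:{ intros j _. rewrite sumR_scal. auto. }
    rewrite sumR_swap. apply sumR_ext. intros c Hc. rewrite <- (H i c Hi Hc).
    rewrite Rmult_comm, <- sumR_scal. apply sumR_ext. intros; ring. }
  rewrite E, sumR_plus.
  rewrite (sumR_ext l (fun j => b j * (dG i j - sumR k (fun c => dA i j c * dv c i)))
    (fun j => b j * dG i j - b j * sumR k (fun c => dA i j c * dv c i))) by (intros; ring).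
  rewrite sumR_minus. ring.
Qed.

Lemma Rabs_mult_le a b c d : Rabs a <= c -> Rabs b <= d -> Rabs (a * b) <= c * d.
Proof. intros H1 H2. rewrite Rabs_mult. apply Rmult_le_compat; auto using Rabs_pos. Qed.

Lemma Rabs_plus_le a b c d : Rabs a <= c -> Rabs b <= d -> Rabs (a + b) <= c + d.
Proof. intros H1 H2. eapply Rle_trans; [apply Rabs_triang|lra]. Qed.

Lemma entropy_bound n l k (dphi : nat -> R) ph (b : nat -> R) (R0 : nat -> nat -> R)
  (db : nat -> nat -> R) (dv : nat -> nat -> R) (dG : nat -> nat -> R) (dqu : nat -> R)
  Cphi Bb Br Bdb Bdv Bq Bg :
  (forall i, (i < n)%nat -> Rabs (dphi i) <= Cphi) -> Rabs ph <= Cphi ->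
  (forall j, (j < l)%nat -> Rabs (b j) <= Bb) ->
  (forall i j, (i < n)%nat -> (j < l)%nat -> Rabs (R0 i j) <= Br) ->
  (forall j c, (j < l)%nat -> (c < k)%nat -> Rabs (db j c) <= Bdb) ->
  (forall c i, (c < k)%nat -> (i < n)%nat -> Rabs (dv c i) <= Bdv) ->
  (forall i, (i < n)%nat -> Rabs (dqu i) <= Bq) ->
  (forall j, (j < l)%nat -> Rabs (sumR n (fun i => dG i j)) <= Bg) ->
  Rabs (sumR n (fun i => dphi i * (sumR l (fun j => b j * R0 i j) + dqu i)
      + ph * sumR l (fun j => R0 i j * sumR k (fun c => db j c * dv c i)))
    + ph * sumR l (fun j => b j * sumR n (fun i => dG i j)))
  <= INR n * (Cphi * (INR l * (Bb * Br) + Bq) + Cphi * (INR l * (Br * (INR k * (Bdb * Bdv)))))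
     + Cphi * (INR l * (Bb * Bg)).
Proof.
  intros. apply Rabs_plus_le.
  - apply sumR_Rabs_le. intros i Hi. apply Rabs_plus_le; apply Rabs_mult_le; auto.
    + apply Rabs_plus_le; auto. apply sumR_Rabs_le. intros j Hj. apply Rabs_mult_le; auto.
    + apply sumR_Rabs_le. intros j Hj. apply Rabs_mult_le; auto.
      apply sumR_Rabs_le. intros c Hc. apply Rabs_mult_le; auto.
  - apply Rabs_mult_le; auto. apply sumR_Rabs_le. intros j Hj. apply Rabs_mult_le; auto.
Qed.

Lemma finite_threshold m (P : nat -> nat -> Prop) :
  (forall j N N', (N <= N')%nat -> P j N -> P j N') ->
  (forall j, (j < m)%nat -> exists N, P j N) -> exists N, forall j, (j < m)%nat -> P j N.
Proof.
  intros Hmono. induction m as [|m IH]; intros H.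
  - exists O. intros; lia.
  - destruct IH as [N HN]; [intros; apply H; lia|]. destruct (H m ltac:(lia)) as [N' HN'].
    exists (max N N'). intros j Hj. destruct (Nat.eq_dec j m) as [->|Hne].
    + apply Hmono with N'; auto; lia.
    + apply Hmono with N; [lia|apply HN; lia].
Qed.

Lemma distn_origin n x : distn n x (fun _ => 0) = normn n x.
Proof. unfold distn. f_equal. extensionality j. ring. Qed.

Theorem theorem1
  (d k l : nat) (Q M : pt -> Prop)
  (A : nat -> pt -> nat -> R)      (* A i v j = j-th component of A_i(v) *)
  (B : pt -> nat -> R)              (* B v j = b_j(v) *)
  (q : nat -> pt -> R)              (* q i = q_i *)
  (u : pt -> pt)
  (HQ : open_in (S d) Q)
  (HMopen : open_in k M) (HMbd : bounded_in k M) (HMcvx : convex M)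
  (HA : forall i j, (i <= d)%nat -> (j < l)%nat -> Cm k M 2 (fun v => A i v j))
  (HuM : forall x, Q x -> M (u x))
  (Hweak : forall psi : nat -> pt -> R,
      (forall j, (j < l)%nat -> test_fn (S d) Q (psi j)) ->
      forall Dpsi : nat -> nat -> pt -> R,
        (forall i j x, (i <= d)%nat -> (j < l)%nat -> in_Rn (S d) x ->
           has_partial (psi j) i x (Dpsi i j x)) ->
        integral_is (S d)
          (fun x => sumR (S d) (fun i => sumR l (fun j => Dpsi i j x * A i (u x) j))) 0)
  (HB : forall j, (j < l)%nat -> Cm k M 1 (fun v => B v j))
  (Hq : forall i, (i <= d)%nat -> Cm k M 2 (q i))
  (Hentropy : forall i beta v, (i <= d)%nat -> (beta < k)%nat -> M v ->
      forall (DA : nat -> R) (Dq : R),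
        (forall j, (j < l)%nat -> has_partial (fun w => A i w j) beta v (DA j)) ->
        has_partial (q i) beta v Dq ->
        sumR l (fun j => B v j * DA j) = Dq)
  (Hholder : forall K, compact_in (S d) K -> (forall x, K x -> Q x) ->
      exists alpha, 1/3 < alpha <= 1 /\ holder_on (S d) k K alpha u) :
  forall phi : pt -> R, test_fn (S d) Q phi ->
  forall Dphi : nat -> pt -> R,
    (forall i x, (i <= d)%nat -> in_Rn (S d) x -> has_partial phi i x (Dphi i x)) ->
    integral_is (S d) (fun x => sumR (S d) (fun i => Dphi i x * q i (u x))) 0.
Proof.
  intros phi [Hphi [K [HK [HKQ Hphi0]]]] Dphi HDphi.
  set (n := S d) in *.
  (* The averages at points of [K] use values of [u] around [K], so the Hoelder exponent is taken on
     the thickening [K']. *)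
  destruct (compact_thickening n Q K HQ HK HKQ) as [K' [HK' [HK'Q [d0 [Hd0 Hthick]]]]].
  assert (HKn : forall x, K x -> in_Rn n x) by apply HK.
  assert (HKK' : forall x, K x -> K' x).
  { intros x Hx. apply (Hthick x x); auto. rewrite distn_refl; lra. }
  assert (HuK' : forall x, K' x -> M (u x)) by auto.
  destruct (compact_bounded n K HK) as [rad [Hrad Hbound]].
  destruct (Hholder K' HK' HK'Q) as [alpha [[Ha _] Hh]].
  assert (Ha0 : 0 < alpha) by lra.
  destruct (holder_modulus n k K' alpha u (proj1 HK') Ha0 Hh) as (H & HH & Hmod).
  assert (Hucont := holder_continuous n k K' alpha u (proj1 HK') Ha0 Hh).
  assert (HBpd : forall j c, (j < l)%nat -> (c < k)%nat -> cont_on k M (pd (fun v => B v j) c)).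
  { intros j c Hj Hc. apply (Cm1_partial k M _ (HB j Hj) c Hc). }
  (* A single [del] near the values of [u] on [K']: the [del]-ball stays in [M], and [/ del] bounds
     B, its derivatives, the Lipschitz constants of q, the Taylor remainders of A and A itself. *)
  destruct (locally_uniform_on_compact n k M K' u _ HK' HuK' Hucont
    (locally_uniform_and _ _ _ _ (locally_uniform_open k M HMopen)
    (locally_uniform_and _ _ _ _
      (locally_uniform_forall k M l _ (fun j hj =>
         locally_uniform_bounded k M (fun v => B v j) (proj1 (HB j hj))))
    (locally_uniform_and _ _ _ _
      (locally_uniform_forall k M l _ (fun j hj => locally_uniform_forall k M k _ (fun c hc =>
         locally_uniform_bounded k M (pd (fun v => B v j) c) (HBpd j c hj hc))))
    (locally_uniform_and _ _ _ _
      (locally_uniform_forall k M n _ (fun i hi =>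
         locally_uniform_lipschitz k M (q i) HMopen (Cm_pred k M 1 _ (Hq i (proj1 (Nat.lt_succ_r i d) hi)))))
    (locally_uniform_and _ _ _ _
      (locally_uniform_forall k M n _ (fun i hi => locally_uniform_forall k M l _ (fun j hj =>
         locally_uniform_taylor k M (fun v => A i v j) HMopen (HA i j (proj1 (Nat.lt_succ_r i d) hi) hj))))
      (locally_uniform_forall k M n _ (fun i hi => locally_uniform_forall k M l _ (fun j hj =>
         locally_uniform_bounded k M (fun v => A i v j)
           (proj1 (HA i j (proj1 (Nat.lt_succ_r i d) hi) hj))))))))))) as [del [Hdel Hloc]].
  cbv beta in Hloc.
  set (Bc := / del) in *.
  assert (HBc : 0 < Bc) by (apply Rinv_0_lt_compat; auto).
  assert (Hphi1 : Cm n (in_Rn n) 1 phi) by apply Hphi.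
  assert (HDpd : forall i x, (i < n)%nat -> in_Rn n x -> pd phi i x = Dphi i x).
  { intros i x Hi Hx. apply pd_eq. apply HDphi; auto. unfold n in Hi; lia. }
  (* The same device, with the identity in place of [u], bounds [phi] and its gradient on [K]. *)
  destruct (locally_uniform_on_compact n n (in_Rn n) K (fun x => x) _ HK HKn
    (fun x e _ He => ex_intro _ e (conj He (fun y _ Hy => Hy)))
    (locally_uniform_and _ _ _ _
      (locally_uniform_bounded n (in_Rn n) phi (proj1 Hphi1))
      (locally_uniform_forall n (in_Rn n) n _ (fun i hi =>
         locally_uniform_bounded n (in_Rn n) (pd phi i) (proj2 (Cm1_partial n _ phi Hphi1 i hi))))))
    as [delp [Hdelp Hlocp]].
  cbv beta in Hlocp.
  set (Cphi := / delp) in *.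
  assert (HCphi : 0 < Cphi) by (apply Rinv_0_lt_compat; auto).
  destruct smooth_partition_of_unity as (eta & eta' & C & Hbump).
  assert (HC : 1 <= C) by apply Hbump.
  set (C0 := 3 ^ n * C ^ S n).
  assert (HC0 : 0 < C0) by (apply Rmult_lt_0_compat; apply pow_lt; lra).
  (* [c1] to [c4] are the coefficients of s^2, s, P s^3 and [e1] produced by [entropy_bound]. The
     factor [4 * H ^ 2] is the square of 2 H: both u(x) and v(y) lie within H s of u(y). *)
  set (c1 := INR n * Cphi * INR l * (Bc * (Bc * (4 * H ^ 2)))).
  set (c2 := INR n * Cphi * (Bc * H)).
  set (c3 := INR n * Cphi * INR l * (Bc * (4 * H ^ 2) * (INR k * (Bc * (C0 * H))))).
  set (c4 := Cphi * (INR l * Bc)).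
  assert (Hn0 := pos_INR n). assert (Hl0 := pos_INR l). assert (Hk0 := pos_INR k).
  assert (HH2 : 0 <= H ^ 2) by apply pow2_ge_0.
  assert (Hc1 : 0 <= c1) by (unfold c1; repeat (apply Rmult_le_pos; try lra)).
  assert (Hc2 : 0 <= c2) by (unfold c2; repeat (apply Rmult_le_pos; try lra)).
  assert (Hc3 : 0 <= c3) by (unfold c3; repeat (apply Rmult_le_pos; try lra)).
  assert (Hc4 : 0 <= c4) by (unfold c4; repeat (apply Rmult_le_pos; try lra)).
  set (C1 := 1 + c1 + c2 + c3 + c4).
  set (vol := (2 * rad + 1) ^ n).
  assert (Hvol : 0 < vol) by (apply pow_lt; lra).
  intros eps Heps.
  (* Chosen so that [vol * (C1 * (e1 + e1))] is [eps / 2]. *)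
  set (e1 := eps / (4 * (vol * C1))).
  assert (HvC : 0 < vol * C1) by (apply Rmult_lt_0_compat; unfold C1; lra).
  assert (He1 : 0 < e1) by (apply Rdiv_lt_0_compat; lra).
  assert (HdH : 0 < del / (1 + H)) by (apply Rdiv_lt_0_compat; lra).
  (* The bound by [d0] keeps kernels of doubled width inside [K'], the bound by [del] keeps v(y) in
     [M], and the remaining two make the error terms small. *)
  assert (HexP : exists P, (0 < P)%nat /\ 2 * / INR P <= d0 /\ H * Rpower (/ INR P) alpha <= del
     /\ Rpower (/ INR P) alpha + INR P * Rpower (/ INR P) alpha ^ 3 <= e1
     /\ Rpower (/ INR P) alpha <= 1).
  { destruct (scales_vanish alpha (Rmin e1 (Rmin (d0 / 2) (del / (1 + H)))) Ha) as [P0 HP0].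
    { repeat apply Rmin_pos; lra. }
    exists (S P0). destruct (HP0 (S P0) ltac:(lia)) as (A1 & A2 & A3).
    assert (A4 := Rmin_l e1 (Rmin (d0 / 2) (del / (1 + H)))).
    assert (A5 := Rmin_r e1 (Rmin (d0 / 2) (del / (1 + H)))).
    assert (A6 := Rmin_l (d0 / 2) (del / (1 + H))). assert (A7 := Rmin_r (d0 / 2) (del / (1 + H))).
    set (s := Rpower (/ INR (S P0)) alpha) in *.
    assert (Hs : 0 < s) by apply exp_pos.
    assert (Hs3 : 0 <= INR (S P0) * s ^ 3) by (apply Rmult_le_pos; [apply pos_INR|apply pow_le; lra]).
    repeat split; try lia; try lra.
    apply Rle_trans with ((1 + H) * (del / (1 + H))).
    - apply Rmult_le_compat; lra.
    - right. field. lra. }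
  destruct HexP as (P & HP & HPd0 & HPdel & HPe1 & HPs).
  set (s := Rpower (/ INR P) alpha) in *.
  assert (Hs : 0 < s) by apply exp_pos.
  assert (HP' : 0 < INR P) by (apply lt_0_INR; auto).
  assert (HiP : 0 < / INR P) by (apply Rinv_0_lt_compat; auto).
  assert (HHs : 0 <= H * s) by (apply Rmult_le_pos; lra).
  assert (Hnear : forall x y, K y -> in_Rn n x -> distn n x y <= 2 * / INR P -> K' x).
  { intros x y Hy Hx Hxy. apply (Hthick y x); auto. lra. }
  assert (Hosc : forall x y, K y -> in_Rn n x -> distn n x y <= / INR P -> distn k (u x) (u y) <= H * s).
  { intros x y Hy Hx Hxy. apply Hmod; auto. apply (Hnear x y); auto. lra. }
  assert (Hmolweak : forall j y, (j < l)%nat -> K y ->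
    integral_is n (fun x => sumR n (fun i => dker n eta eta' P i y x * A i (u x) j)) 0).
  { intros j y Hj Hy.
    (* The test field has the kernel centred at [y] as its [j]-th component and zero elsewhere,
       which isolates one equation of the system. *)
    set (psi := fun j' => if Nat.eqb j' j then ker n eta P y else fun _ => 0).
    set (Dpsi := fun i j' => if Nat.eqb j' j then dker n eta eta' P i y else fun _ => 0).
    replace (fun x => sumR n (fun i => dker n eta eta' P i y x * A i (u x) j)) with
      (fun x => sumR n (fun i => sumR l (fun j' => Dpsi i j' x * A i (u x) j'))).
    - apply (Hweak psi).
      + intros j' _. unfold psi. destruct (Nat.eqb j' j).
        * split; [apply ker_Cinf; apply Hbump|].
          exists (fun x => in_Rn n x /\ distn n x y <= / INR P). split; [apply compact_cube; lra|]. split.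
          -- intros x [Hx Hxy]. apply HK'Q, (Hnear x y); auto. lra.
          -- intros x Hx Hno. apply (ker_support n eta eta' C P y x Hbump HP).
             apply Rnot_le_lt. intros Hle. apply Hno. auto.
        * split; [intros m; apply Cm_zero|]. exists K. auto.
      + intros i j' x Hi _ _. unfold psi, Dpsi. destruct (Nat.eqb j' j).
        * apply ker_partial; [apply Hbump|unfold n; lia].
        * apply (derivable_pt_lim_const 0).
    - extensionality x. apply sumR_ext. intros i _. rewrite (sumR_single l j); auto.
      + unfold Dpsi. rewrite Nat.eqb_refl. auto.
      + intros j' _ Hne. unfold Dpsi. destruct (Nat.eqb_spec j' j); [congruence|ring]. }
  (* The tolerance is divided by [INR P ^ n] because [dmol] carries that factor. The bound on [rad]
     makes the discrete averages exact at every centre in [K]. *)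
  assert (Hr : exists r, (0 < r)%nat /\ rad <= INR (P * r) - 1 /\ forall j y, (j < l)%nat -> K y ->
     Rabs (riemann n (fun x => sumR n (fun i => dker n eta eta' P i y x * A i (u x) j)) (P * r))
       <= e1 / INR P ^ n).
  { assert (HPn : 0 < INR P ^ n) by (apply pow_lt; auto).
    destruct (finite_threshold l (fun j N0 => forall N y, (N0 <= N)%nat -> K y ->
       Rabs (riemann n (fun x => sumR n (fun i => dker n eta eta' P i y x * A i (u x) j)) N)
         <= e1 / INR P ^ n)) as [N0 HN0].
    - intros j N N' HNN H1 N'' y HN''. apply H1; lia.
    - intros j Hj. apply (riemann_dker_uniform n eta eta' C P K (fun i x => A i (u x) j) Bc); auto.
      + lra.
      + intros i x y Hi Hy Hx Hxy. assert (HxK := Hnear x y Hy Hx Hxy).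
        destruct (Hloc x HxK) as (_ & _ & _ & _ & _ & HAb).
        apply (HAb i Hi j Hj); auto. rewrite distn_refl; lra.
      + apply Rdiv_lt_0_compat; auto.
    - destruct (exists_INR_gt (rad + 1)) as [m Hm]. exists (S (N0 + m)).
      assert (HPr : (S (N0 + m) <= P * S (N0 + m))%nat) by nia.
      split; [lia|]. split.
      + specialize (Hm (P * S (N0 + m))%nat ltac:(lia)). lra.
      + intros j y Hj Hy. apply HN0; auto. lia. }
  destruct Hr as (r & Hr & HrR & Hsmall).
  assert (Hrange : forall y, K y -> normn n y <= INR (P * r) - 1).
  { intros y Hy. specialize (Hbound y Hy). lra. }
  set (v := mol_vec n k eta P r u).
  set (G := fun i j => mol n eta P r (fun x => A i (u x) j)).
  set (dv := fun y c i => dmol n eta eta' P r (fun x => u x c) y i).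
  set (dG := fun y i' i j => dmol n eta eta' P r (fun x => A i (u x) j) y i').
  set (pA := fun y i j c => pd (fun w => A i w j) c (v y)).
  set (pB := fun y j c => pd (fun w => B w j) c (v y)).
  set (pq := fun y i c => pd (q i) c (v y)).
  assert (Hvu : forall y, K y -> distn k (v y) (u y) <= H * s).
  { intros y Hy. apply (mol_vec_near n k eta eta' C); auto. }
  assert (Hvk : forall y, in_Rn k (v y)) by (intros; apply vec_in).
  assert (HvM : forall y, K y -> M (v y)).
  { intros y Hy. apply (Hloc y (HKK' y Hy)); auto. specialize (Hvu y Hy). lra. }
  set (h := fun i y => sumR l (fun j => B (v y) j * (G i j y - A i (v y) j)) + q i (v y)).
  set (dh := fun i y i' =>
    sumR l (fun j => B (v y) j * (dG y i' i j - sumR k (fun c => pA y i j c * dv y c i'))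
               + (G i j y - A i (v y) j) * sumR k (fun c => pB y j c * dv y c i'))
    + sumR k (fun c => pq y i c * dv y c i')).
  (* Off [K] the average v(y) may leave [M], where [h] has no known derivative; there the product
     with [phi] vanishes locally and its derivative is 0. *)
  set (dF := fun i y i' => if excluded_middle_informative (K y)
    then phi y * dh i y i' + h i y * Dphi i' y else 0).
  assert (Hchain : forall f y, K y -> Cm k M 1 f ->
    sdiff n (fun z => f (v z)) y (fun i' => sumR k (fun c => pd f c (v y) * dv y c i'))).
  { intros f y Hy Hf. apply (sdiff_comp n k f v y _ (dv y) 1); auto; [lra| |].
    - apply (sdiff_of_C1 k M); auto.
    - intros c Hc. apply sdiff_near with (r := 1) (g := mol n eta P r (fun x => u x c)); [lra| |].
      + intros z _ _. apply vec_lt; auto.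
      + apply (mol_sdiff n eta eta' C); auto. }
  assert (HFd : forall i y, (i < n)%nat -> in_Rn n y -> sdiff n (fun z => phi z * h i z) y (dF i y)).
  { intros i y Hi Hy. unfold dF. destruct (excluded_middle_informative (K y)) as [Ky|Ky].
    - apply sdiff_mult; auto.
      + apply sdiff_eq with (L := fun i' => pd phi i' y); auto. apply (sdiff_of_C1 n (in_Rn n)); auto.
        apply open_Rn.
      + assert (Hid : (i <= d)%nat) by (unfold n in Hi; lia).
        apply (sdiff_plus n (fun z => sumR l (fun j => B (v z) j * (G i j z - A i (v z) j))) (fun z => q i (v z))).
        * apply (sdiff_sumR n l (fun j z => B (v z) j * (G i j z - A i (v z) j)) y
            (fun j i' => B (v y) j * (dG y i' i j - sumR k (fun c => pA y i j c * dv y c i'))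
               + (G i j y - A i (v y) j) * sumR k (fun c => pB y j c * dv y c i'))).
          intros j Hj.
          apply (sdiff_mult n (fun z => B (v z) j) (fun z => G i j z - A i (v z) j) y
            (fun i' => sumR k (fun c => pB y j c * dv y c i'))
            (fun i' => dG y i' i j - sumR k (fun c => pA y i j c * dv y c i'))); auto.
          -- apply (Hchain (fun w => B w j)); auto.
          -- apply sdiff_near with (r := 1) (g := fun z => G i j z + (-1) * A i (v z) j); [lra|intros; ring|].
             apply sdiff_eq with (L := fun i' => dG y i' i j + (-1) * sumR k (fun c => pA y i j c * dv y c i'));
               [intros; ring|].
             apply sdiff_plus; [apply (mol_sdiff n eta eta' C); auto|].
             apply sdiff_scal. apply (Hchain (fun w => A i w j)); auto. apply Cm_pred; auto.
        * apply Hchain; auto. apply Cm_pred; auto.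
    - destruct (compact_separated n K y HK Hy Ky) as [e [He Hsep]].
      apply sdiff_near with (r := e) (g := fun _ => 0); auto; [|apply sdiff_const].
      intros z Hz Hzy. rewrite Hphi0; auto; [ring|]. intros Kz. specialize (Hsep z Kz). lra. }
  assert (Hdiv : integral_is n (fun x => sumR n (fun i => dF i x i)) 0).
  { apply (integral_is_sumR n n (fun i x => dF i x i)). intros i Hi.
    apply (riemann_divergence_cv n i rad (fun z => phi z * h i z) (dF i)); auto; [lra|].
    intros x Hx Hxr. assert (HnK : ~ K x) by (intros Kx; specialize (Hbound x Kx); lra).
    split.
    - rewrite Hphi0 by auto. ring.
    - unfold dF. destruct (excluded_middle_informative (K x)); tauto. }
  assert (HDphi0 : forall i x, (i < n)%nat -> in_Rn n x -> ~ K x -> Dphi i x = 0).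
  { intros i x Hi Hx HnK. destruct (compact_separated n K x HK Hx HnK) as [e [He Hsep]].
    apply (has_partial_unique phi i x); [apply HDphi; auto; unfold n in Hi; lia|].
    apply (sdiff_has_partial n phi x (fun _ => 0)); auto.
    apply sdiff_near with (r := e) (g := fun _ => 0); auto; [|apply sdiff_const].
    intros z Hz Hzx. apply Hphi0; auto. intros Kz. specialize (Hsep z Kz). lra. }
  (* The error integrand: the sums of the divergence tend to zero, so it remains to bound [T]
     uniformly and to confine it to [K]. *)
  set (T := fun x => sumR n (fun i => dF i x i - Dphi i x * q i (u x))).
  assert (HT0 : forall x, in_Rn n x -> ~ K x -> T x = 0).
  { intros x Hx HnK. apply sumR_0. intros i Hi. rewrite HDphi0 by auto.
    unfold dF. destruct (excluded_middle_informative (K x)); [tauto|ring]. }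
  assert (HTK : forall x, K x -> Rabs (T x) <= C1 * (e1 + e1)).
  { intros y Hy. assert (HyK := HKK' y Hy). assert (Hyn := HKn y Hy).
    destruct (Hloc y HyK) as (_ & LB & LpB & Lq & LA & _).
    assert (Lv := Hvu y Hy). assert (Mv := HvM y Hy). assert (Mu := HuK' y HyK).
    assert (Huu : distn k (u y) (u y) <= del) by (rewrite distn_refl; lra).
    unfold T.
    rewrite (sumR_ext n _ (fun i =>
      (phi y * (sumR l (fun j => B (v y) j * (dG y i i j - sumR k (fun c => pA y i j c * dv y c i))
                            + (G i j y - A i (v y) j) * sumR k (fun c => pB y j c * dv y c i))
           + sumR k (fun c => pq y i c * dv y c i))
     + (sumR l (fun j => B (v y) j * (G i j y - A i (v y) j)) + q i (v y)) * Dphi i y)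
       - Dphi i y * q i (u y))).
    2:{ intros i Hi. unfold dF. destruct (excluded_middle_informative (K y)); [|tauto]. reflexivity. }
    rewrite (entropy_algebra n l k (fun i => Dphi i y) (phi y) (B (v y)) (fun i j => G i j y - A i (v y) j)
      (pB y) (dv y) (pA y) (fun i j => dG y i i j) (fun i => q i (v y)) (fun i => q i (u y)) (pq y)).
    2:{ intros i c Hi Hc. apply Hentropy with (i := i) (beta := c); auto; try (unfold n in Hi; lia).
        - intros j Hj. apply (Cm1_partial k M (fun w => A i w j)); auto. apply Cm_pred, HA; auto.
          unfold n in Hi; lia.
        - apply (Cm1_partial k M (q i)); auto. apply Cm_pred, Hq. unfold n in Hi; lia. }
    eapply Rle_trans.
    - apply (entropy_bound n l k _ _ _ _ _ _ _ _ Cphi Bc (Bc * (2 * (H * s)) ^ 2) Bc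
        (C0 * (INR P * (H * s))) (Bc * (H * s)) e1).
      + intros i Hi. rewrite <- HDpd by auto. apply (proj2 (Hlocp y Hy) i Hi); auto.
        rewrite distn_refl; lra.
      + apply (proj1 (Hlocp y Hy)); auto. rewrite distn_refl; lra.
      + intros j Hj. apply LB; auto; lra.
      + intros i j Hi Hj. apply (mol_commutator n k eta eta' C P r u y (fun w => A i w j) (pA y i j)); auto.
        intros x Hx Hxy. fold v.
        assert (Lx := Hosc x y Hy Hx Hxy).
        assert (Mx : M (u x)) by (apply HuK'; apply (Hnear x y); auto; lra).
        eapply Rle_trans; [apply (LA i Hi j Hj); auto; lra|].
        apply Rmult_le_compat_l; [lra|]. apply pow_incr. split; [apply distn_nonneg|].
        assert (A1 := distn_triang k (u x) (u y) (v y)). rewrite (distn_sym k (u y) (v y)) in A1. lra.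
      + intros j c Hj Hc. apply (LpB j Hj c Hc); auto; lra.
      + intros c i Hc Hi. unfold dv.
        (* Subtracting u(y) before estimating yields the order P s for the gradient of v. *)
        rewrite <- (dmol_shift n eta eta' P r (fun x => u x c) (u y c)).
        2:{ apply (ker_riemann n eta eta' C P r y); auto. }
        apply (dmol_bound n eta eta' C); auto. intros x Hx Hxy.
        eapply Rle_trans; [apply (distn_coord k (u x) (u y) c Hc)|]. apply Hosc; auto.
      + intros i Hi. eapply Rle_trans; [apply (Lq i Hi (u y) (v y)); auto; lra|].
        apply Rmult_le_compat_l; lra.
      + intros j Hj. unfold dG, dmol.
        (* The divergence of the averages is, up to sign and the factor P^n, the Riemann sum made
           small by the choice of [r]. *)
        rewrite sumR_scal, <- riemann_sumR.
        rewrite Rabs_mult, Rabs_Ropp, (Rabs_pos_eq (INR P ^ n)) by (apply pow_le; lra).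
        apply Rle_trans with (INR P ^ n * (e1 / INR P ^ n)).
        * apply Rmult_le_compat_l; [apply pow_le; lra|]. apply Hsmall; auto.
        * right. field. apply pow_nonzero. lra.
    - set (S3 := INR P * s ^ 3) in *.
      assert (HS3 : 0 <= S3) by (apply Rmult_le_pos; [lra|apply pow_le; lra]).
      (* Since s <= 1, the quadratic term is absorbed by the linear one, and s + P s^3 <= [e1]
         controls everything. *)
      assert (Hs2 : s ^ 2 <= s) by nra.
      replace (INR n * (Cphi * (INR l * (Bc * (Bc * (2 * (H * s)) ^ 2)) + Bc * (H * s)) +
        Cphi * (INR l * (Bc * (2 * (H * s)) ^ 2 * (INR k * (Bc * (C0 * (INR P * (H * s)))))))) +
        Cphi * (INR l * (Bc * e1))) with (c1 * s ^ 2 + c2 * s + c3 * S3 + c4 * e1)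
        by (unfold c1, c2, c3, c4, S3; ring).
      unfold C1.
      assert (B1 : c1 * s ^ 2 <= c1 * e1) by (apply Rmult_le_compat_l; lra).
      assert (B2 : c2 * s <= c2 * e1) by (apply Rmult_le_compat_l; lra).
      assert (B3 : c3 * S3 <= c3 * e1) by (apply Rmult_le_compat_l; lra).
      assert (B4 : 0 <= (1 + c1 + c2 + c3 + c4) * e1) by (apply Rmult_le_pos; lra).
      lra. }
  (* Only now does the outer mesh 1/(N + 1) tend to zero, with [P] and [r] fixed; the bound on [T]
     does not depend on it. *)
  destruct (Hdiv (eps / 2) ltac:(lra)) as [m Hm]. exists m. intros N HN.
  specialize (Hm N HN). unfold Rdist in *. rewrite Rminus_0_r in *.
  replace (riemann n (fun x => sumR n (fun i => Dphi i x * q i (u x))) (S N)) with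
    (riemann n (fun x => sumR n (fun i => dF i x i)) (S N) + (-1) * riemann n T (S N)).
  2:{ rewrite <- riemann_scal, <- riemann_plus. apply riemann_ext. intros x _. unfold T.
      rewrite sumR_minus. ring. }
  eapply Rle_lt_trans; [apply Rabs_triang|].
  rewrite (Rabs_mult (-1)), (Rabs_left (-1)) by lra.
  assert (HTb : Rabs (riemann n T (S N)) <= vol * (C1 * (e1 + e1))).
  { apply (riemann_bound_unif n (S N) (fun _ => 0)); try lra; try lia.
    - apply Rmult_le_pos; unfold C1; lra.
    - intros x Hx. destruct (excluded_middle_informative (K x)) as [Kx|Kx]; auto.
      rewrite HT0 by auto. rewrite Rabs_R0. apply Rmult_le_pos; unfold C1; lra.
    - intros x Hx Hxr. apply HT0; auto. intros Kx. specialize (Hbound x Kx).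
      rewrite distn_origin in Hxr. lra. }
  assert (Hfin : vol * (C1 * (e1 + e1)) = eps / 2) by (unfold e1; field; split; unfold C1; lra).
  lra.
Qed.
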